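(* Let $N\ge5$. Then a representation $V$ of $X(\mathfrak{so}_N,\mathfrak{so}_{N-2}\oplus\mathfrak{so}_2)^{tw}$ is one-dimensional if and only if $V\cong V(a)^{\nu_g}$ for some $a\in\mathbb C$ and some $g(u)\in1+u^{-2}\mathbb C[[u^{-2}]]$.
   Context: Notation. $N=2n$ or $2n+1$, $\mathcal I_N=\{-n,\dots,-1,(0),1,\dots,n\}$ ($0$ omitted if $N=2n$), $(E_{ij})^t=E_{-j,-i}$, $P=\sum_{i,j}E_{ij}\otimes E_{ji}$, $Q=P^{t_1}$, $\kappa=N/2-1$, $R(u)=I-u^{-1}P+(u-\kappa)^{-1}Q$. The extended Yangian $X(\mathfrak{so}_N)$ is the unital associative $\mathbb C$-algebra generated by $t_{ij}^{(r)}$ ($i,j\in\mathcal I_N$, $r\ge1$) with relation $R(u-v)T_1(u)T_2(v)=T_2(v)T_1(u)R(u-v)$, $T(u)=\sum E_{ij}\otimes t_{ij}(u)$, $t_{ij}(u)=\delta_{ij}+\sum_{r\ge1}t_{ij}^{(r)}u^{-r}$. Let $d=N/4-1$, $\mathcal G=I-2E_{nn}-2E_{-n,-n}=(g_{ij})$, $\mathcal G(u)=\frac{dI-u\mathcal G}{d-u}$ (expanded in $u^{-1}$). $X(\mathfrak{so}_N,\mathfrak{so}_{N-2}\oplus\mathfrak{so}_2)^{tw}$ is the subalgebra of $X(\mathfrak{so}_N)$ generated by the coefficients $s_{ij}^{(r)}$, $r\ge1$, of the entries $s_{ij}(u)=g_{ij}+\sum_{r\ge1}s_{ij}^{(r)}u^{-r}$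 of $S(u)=T(u-\kappa/2)\,\mathcal G(u)\,T^t(-u+\kappa/2)$. For $g(u)\in1+u^{-2}\mathbb C[[u^{-2}]]$, $\nu_g$ is the automorphism $S(u)\mapsto g(u-\kappa/2)S(u)$; $V^{\nu_g}$ is the module $V$ twisted by $\nu_g$. For $a\in\mathbb C$, $V(a)$ is the one-dimensional representation of $X(\mathfrak{so}_N,\mathfrak{so}_{N-2}\oplus\mathfrak{so}_2)^{tw}$ given by $S(u)\mapsto K(u;a)$, where $$K(u;a)=\frac{(u-a)(u+a-2d)}{(u-d)^2}\left(I-\frac{2u}{u-a}E_{-n,-n}-\frac{2u}{u+a-2d}E_{nn}\right)$$ (this assignment does define a representation). *)

(* Defs.v *)
From HB Require Import structures.
From mathcomp Require Import all_boot all_order all_algebra generic_quotient.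
From mathcomp Require Import ring_quotient boolp reals complex mxtens finmap monalg.

Set Implicit Arguments.
Unset Strict Implicit.
Unset Printing Implicit Defensive.

Import GRing.Theory.

Local Open Scope ring_scope.
Local Open Scope quotient_scope.

Section TwoSidedIdeal.
Variables (F : fieldType) (A : algType F) (rels : A -> Prop).

Record two_sided_ideal (J : A -> Prop) : Prop := TwoSidedIdeal {
  tsi0 : J 0;
  tsiD : forall x y, J x -> J y -> J (x + y);
  tsiMl : forall a x, J x -> J (a * x);
  tsiMr : forall a x, J x -> J (x * a)
}.

Definition ideal_gen (x : A) : Prop :=
  forall J : A -> Prop,
    two_sided_ideal J -> (forall y, rels y -> J y) -> J x.

Lemma ideal_gen_rel x : rels x -> ideal_gen x.
Proof. by move=> rx J _; apply. Qed.

Lemma ideal_gen_two_sided : two_sided_ideal ideal_gen.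
Proof.
split=> [|x y Ix Iy|a x Ix|a x Ix] J hJ relJ; first exact: tsi0.
- by apply: tsiD => //; [apply: Ix | apply: Iy].
- by apply: tsiMl => //; apply: Ix.
- by apply: tsiMr => //; apply: Ix.
Qed.

Definition ideal_pred : {pred A} := fun x => `[< ideal_gen x >].

Lemma ideal_predP x : reflect (ideal_gen x) (x \in ideal_pred).
Proof. exact: asboolP. Qed.

Lemma ideal_pred_zmod : zmod_closed ideal_pred.
Proof.
have hI := ideal_gen_two_sided.
split=> [|x y /ideal_predP Ix /ideal_predP Iy]; apply/ideal_predP.
  exact: tsi0 hI.
by apply: (tsiD hI) => //; rewrite -mulN1r; apply: (tsiMl hI).
Qed.

HB.instance Definition _ := GRing.isZmodClosed.Build A ideal_pred
  ideal_pred_zmod.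

Lemma ideal_predMl a x : x \in ideal_pred -> a * x \in ideal_pred.
Proof.
move=> /ideal_predP Ix; apply/ideal_predP.
exact: (tsiMl ideal_gen_two_sided).
Qed.

Lemma ideal_predMr a x : x \in ideal_pred -> x * a \in ideal_pred.
Proof.
move=> /ideal_predP Ix; apply/ideal_predP.
exact: (tsiMr ideal_gen_two_sided).
Qed.

End TwoSidedIdeal.

Section QuotientAlgebra.
Variables (F : fieldType) (A : algType F) (rels : A -> Prop).
Hypothesis proper : ~ ideal_gen rels 1.

Definition quotient_alg of (~ ideal_gen rels 1) : Type :=
  Quotient.quot (ideal_pred rels).

Local Notation Q := (quotient_alg proper).

HB.instance Definition _ := Choice.on Q.
HB.instance Definition _ := GRing.Zmodule.on Q.
HB.instance Definition _ := EqQuotient.on Q.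

Definition quot_pi (x : A) : Q := \pi_Q x.

Lemma quot_piE x y : (quot_pi x == quot_pi y) = (x - y \in ideal_pred rels).
Proof. by rewrite /quot_pi (Quotient.idealrBE (ideal_pred rels)). Qed.

Lemma quot_pi_eq x y : x - y \in ideal_pred rels -> quot_pi x = quot_pi y.
Proof. by rewrite -quot_piE => /eqP. Qed.

Lemma quot_reprK (x : Q) : quot_pi (repr x) = x.
Proof. exact: reprK. Qed.

Lemma quot_repr_pi x : repr (quot_pi x) - x \in ideal_pred rels.
Proof. by rewrite -quot_piE quot_reprK. Qed.

Lemma quot_piD x y : quot_pi (x + y) = quot_pi x + quot_pi y.
Proof. exact: (Quotient.pi_add (ideal_pred rels)). Qed.

Lemma quot_pi_is_zmod : zmod_morphism quot_pi.
Proof.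
move=> x y; rewrite quot_piD; congr (_ + _).
exact: (Quotient.pi_opp (ideal_pred rels)).
Qed.

Definition quot_mul (x y : Q) : Q := quot_pi (repr x * repr y).
Definition quot_scale (c : F) (x : Q) : Q := quot_pi (c *: repr x).

Lemma quot_piM x y : quot_pi (x * y) = quot_mul (quot_pi x) (quot_pi y).
Proof.
apply/esym/quot_pi_eq; set x' := repr _; set y' := repr _.
have -> : x' * y' - x * y = x' * (y' - y) + (x' - x) * y.
  by rewrite mulrBr mulrBl addrA subrK.
apply: rpredD; [apply: ideal_predMl | apply: ideal_predMr]; exact: quot_repr_pi.
Qed.

Lemma quot_piZ c x : quot_pi (c *: x) = quot_scale c (quot_pi x).
Proof.
apply/esym/quot_pi_eq; rewrite -scalerBr -mulr_algl.
by apply: ideal_predMl; apply: quot_repr_pi.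
Qed.

Lemma quot_mulA : associative quot_mul.
Proof.
move=> x y z; rewrite -[x]quot_reprK -[y]quot_reprK -[z]quot_reprK.
by rewrite -!quot_piM mulrA.
Qed.

Lemma quot_mul1l : left_id (quot_pi 1) quot_mul.
Proof. by move=> x; rewrite -[x]quot_reprK -!quot_piM mul1r. Qed.

Lemma quot_mul1r : right_id (quot_pi 1) quot_mul.
Proof. by move=> x; rewrite -[x]quot_reprK -!quot_piM mulr1. Qed.

Lemma quot_mulDl : left_distributive quot_mul +%R.
Proof.
move=> x y z; rewrite -[x]quot_reprK -[y]quot_reprK -[z]quot_reprK.
by rewrite -quot_piD -!quot_piM mulrDl quot_piD.
Qed.

Lemma quot_mulDr : right_distributive quot_mul +%R.
Proof.
move=> x y z; rewrite -[x]quot_reprK -[y]quot_reprK -[z]quot_reprK.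
by rewrite -quot_piD -!quot_piM mulrDr quot_piD.
Qed.

Lemma quot_one_neq0 : quot_pi 1 != 0.
Proof.
have <- : quot_pi 0 = 0 by rewrite -(subrr (0 : A)) quot_pi_is_zmod subrr.
by rewrite quot_piE subr0; apply/ideal_predP.
Qed.

HB.instance Definition _ := GRing.Zmodule_isNzRing.Build Q
  quot_mulA quot_mul1l quot_mul1r quot_mulDl quot_mulDr quot_one_neq0.

Lemma quot_scaleA a b x : quot_scale a (quot_scale b x) = quot_scale (a * b) x.
Proof. by rewrite -[x]quot_reprK -!quot_piZ scalerA. Qed.

Lemma quot_scale1 : left_id 1 quot_scale.
Proof. by move=> x; rewrite -[x]quot_reprK -quot_piZ scale1r. Qed.

Lemma quot_scaleDr : right_distributive quot_scale +%R.
Proof.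
move=> a x y; rewrite -[x]quot_reprK -[y]quot_reprK.
by rewrite -quot_piD -!quot_piZ scalerDr quot_piD.
Qed.

Lemma quot_scaleDl x : {morph quot_scale^~ x : a b / a + b}.
Proof. by move=> a b; rewrite -[x]quot_reprK -!quot_piZ scalerDl quot_piD. Qed.

HB.instance Definition _ := GRing.Zmodule_isLmodule.Build F Q
  quot_scaleA quot_scale1 quot_scaleDr quot_scaleDl.

Lemma quot_scaleAl (c : F) (x y : Q) : c *: (x * y) = (c *: x) * y.
Proof.
rewrite -[x]quot_reprK -[y]quot_reprK.
by rewrite /GRing.scale/= /GRing.mul/= -quot_piM -!quot_piZ -quot_piM scalerAl.
Qed.

HB.instance Definition _ := GRing.Lmodule_isLalgebra.Build F Q quot_scaleAl.

Lemma quot_scaleAr (c : F) (x y : Q) : c *: (x * y) = x * (c *: y).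
Proof.
rewrite -[x]quot_reprK -[y]quot_reprK.
by rewrite /GRing.scale/= /GRing.mul/= -quot_piM -!quot_piZ -quot_piM scalerAr.
Qed.

HB.instance Definition _ := GRing.Lalgebra_isAlgebra.Build F Q quot_scaleAr.

HB.instance Definition _ := GRing.isZmodMorphism.Build A Q quot_pi
  quot_pi_is_zmod.

HB.instance Definition _ := GRing.isMonoidMorphism.Build A Q quot_pi
  (conj (erefl _ : quot_pi 1 = 1) quot_piM).

HB.instance Definition _ := GRing.isScalable.Build F A Q *:%R quot_pi quot_piZ.

End QuotientAlgebra.

Section FreeAlgebra.
Variables (F : fieldType) (G : choiceType).

Definition free_alg : Type := {malg F[{fmonom G}]}.

HB.instance Definition _ := GRing.Lalgebra.on free_alg.

Lemma free_alg_scaleAr (c : F) (x y : {malg F[{fmonom G}]}) :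
  c *: (x * y) = x * (c *: y).
Proof.
apply/malgP => k.
rewrite [LHS](mcoeffZ c (x * y) k).
rewrite [X in c * X](mcoeffMl x y k).
rewrite (mcoeffMlw k (fsubset_refl (msupp x)) (msuppZ_le c y)) mulr_sumr.
apply: eq_bigr => k1 _; rewrite mulr_sumr; apply: eq_bigr => k2 _.
by rewrite mcoeffZ mulrnAr mulrCA.
Qed.

HB.instance Definition _ := GRing.Lalgebra_isAlgebra.Build F free_alg
  free_alg_scaleAr.

Definition free_gen (x : G) : free_alg := << fmu x >>%R.

End FreeAlgebra.

Section GeneratedSubalgebra.
Variables (F : fieldType) (A : algType F) (gens : A -> Prop).

Definition subalg_gen (x : A) : Prop :=
  forall B : {pred A},
    GRing.subalg_closed B -> (forall y, gens y -> y \in B) -> x \in B.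

Definition subalg_pred : {pred A} := fun x => `[< subalg_gen x >].

Lemma subalg_predP x : reflect (subalg_gen x) (x \in subalg_pred).
Proof. exact: asboolP. Qed.

Lemma subalg_pred_gen x : gens x -> x \in subalg_pred.
Proof. by move=> gx; apply/subalg_predP => B _; apply. Qed.

Lemma subalg_pred_closed : GRing.subalg_closed subalg_pred.
Proof.
split=> [|c x y /subalg_predP Bx /subalg_predP By
         |x y /subalg_predP Bx /subalg_predP By];
  apply/subalg_predP => B hB gB; case: (hB) => B1 BZ BM //.
  by apply: BZ; [apply: Bx | apply: By].
by apply: BM; [apply: Bx | apply: By].
Qed.

Record subalg : Type := Subalg {
  subalg_val : A;
  subalg_valP : subalg_val \in subalg_pred
}.

HB.instance Definition _ := [isSub for subalg_val].
HB.instance Definition _ := [Choice of subalg by <:].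
HB.instance Definition _ := GRing.SubChoice_isSubAlgebra.Build F A subalg_pred
  subalg (GRing.subalg_closed_semi subalg_pred_closed).

Definition subalg_of_gen x (gx : gens x) : subalg :=
  Subalg (subalg_pred_gen gx).

End GeneratedSubalgebra.

(* Formal series in u^-1: the sequence f stands for \sum_r f r * u^-r. *)

Section Series.

Definition fps_mul (A : pzRingType) (f g : nat -> A) (n : nat) : A :=
  \sum_(k < n.+1) f k * g (n - k)%N.

Definition fps_one (A : pzRingType) (n : nat) : A := (n == 0%N)%:R.

Definition fps_exp (A : pzRingType) (f : nat -> A) (r : nat) : nat -> A :=
  iter r (fps_mul f) (@fps_one A).

Definition fps_lin (A : nmodType) (a b : A) (n : nat) : A :=
  match n with 0%N => a | 1%N => b | _ => 0 end.

Definition fps_scale (F : pzRingType) (V : lmodType F)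
    (c : nat -> F) (f : nat -> V) (n : nat) : V :=
  \sum_(k < n.+1) c k *: f (n - k)%N.

(* Substitution of y for u^-1; only meaningful when y 0 = 0, in which case
   the terms with r > n do not contribute. *)
Definition fps_subst (F : pzRingType) (V : lmodType F)
    (f : nat -> V) (y : nat -> F) (n : nat) : V :=
  \sum_(r < n.+1) fps_exp y r n *: f r.

(* u / (u - c) *)
Definition fps_geo (F : pzRingType) (c : F) (n : nat) : F := c ^+ n.

(* 1 / (u - c) *)
Definition fps_inv (F : pzRingType) (c : F) (n : nat) : F :=
  if n is k.+1 then c ^+ k else 0.

(* f(u - c) *)
Definition fps_shift (F : pzRingType) (V : lmodType F)
    (f : nat -> V) (c : F) : nat -> V :=
  fps_subst f (fps_inv c).

(* f(- u + c) *)
Definition fps_reflect (F : pzRingType) (V : lmodType F)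
    (f : nat -> V) (c : F) : nat -> V :=
  fps_subst f (fun n => - fps_inv c n).

(* g(u) \in 1 + u^-2 F[[u^-2]] *)
Definition even_unital (F : pzRingType) (g : nat -> F) : Prop :=
  g 0%N = 1 /\ forall r, odd r -> g r = 0.

End Series.

(* The index set {-n, .., -1, (0), 1, .., n} is encoded by its increasing
   enumeration 'I_N: -n is the index 0, n is the index N.-1, and i |-> -i is
   rev_ord. *)

Section Orthogonal.
Variables (F : fieldType) (N : nat).

Definition kappa : F := N%:R / 2%:R - 1.
Definition dpar : F := N%:R / 4%:R - 1.

(* (E_ij)^t = E_{-j,-i} *)
Definition ttr (A : nmodType) (M : 'M[A]_N) : 'M[A]_N :=
  \matrix_(i, j) M (rev_ord j) (rev_ord i).

Definition Pmx : 'M[F]_(N * N) :=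
  \sum_(i < N) \sum_(j < N) (delta_mx i j *t delta_mx j i).

Definition Qmx : 'M[F]_(N * N) :=
  \sum_(i < N) \sum_(j < N) (ttr (delta_mx i j) *t delta_mx j i).

(* E_kk, with k a position in the increasing enumeration *)
Definition Ediag (k : nat) : 'M[F]_N :=
  \matrix_(i, j) ((i == k :> nat) && (j == k :> nat))%:R.

Definition Gmx : 'M[F]_N := 1%:M - 2%:R *: Ediag N.-1 - 2%:R *: Ediag 0%N.

(* G(u) = (d - u G) / (d - u) = (G - d u^-1) * (u / (u - d)) *)
Definition Gser : nat -> 'M[F]_N :=
  fps_scale (fps_geo dpar) (fps_lin Gmx (- dpar)%:M).

(* (u - a) (u + a - 2 d) / (u - d)^2 *)
Definition Kprefactor (a : F) : nat -> F :=
  fps_mul (fps_mul (fps_lin 1 (- a)) (fps_lin 1 (a - 2%:R * dpar)))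
          (fps_mul (fps_geo dpar) (fps_geo dpar)).

Definition Kmx (a : F) (r : nat) : 'M[F]_N :=
  (fps_one F r)%:M - (2%:R * fps_geo a r) *: Ediag 0%N
  - (2%:R * fps_geo (2%:R * dpar - a) r) *: Ediag N.-1.

Definition Kser (a : F) : nat -> 'M[F]_N :=
  fps_scale (Kprefactor a) (Kmx a).

End Orthogonal.

(* The relation R(u - v) T_1(u) T_2(v) = T_2(v) T_1(u) R(u - v), both sides
   being multiplied by (u - v) (u - v - kappa), which turns
   R(u - v) = 1 - P / (u - v) + Q / (u - v - kappa) into
   (u - v) (u - v - kappa) - (u - v - kappa) P + (u - v) Q.
   Multiplication by (u - v) (u - v - kappa) is invertible once expanded in v / u,
   so no relation is gained or lost.
   A two-sided series H : int -> int -> _ stands for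
   \sum_(r, s) H r s * u^-r * v^-s. *)

Section RTT.
Variables (F : fieldType) (N : nat) (A : algType F) (T : nat -> 'M[A]_N).

Definition scal_mx m (M : 'M[F]_m) : 'M[A]_m := map_mx (in_alg A) M.

Definition two_sided m (H : nat -> nat -> 'M[A]_m) (r s : int) : 'M[A]_m :=
  match r, s with Posz r', Posz s' => H r' s' | _, _ => 0 end.

(* (u - v - c) * H *)
Definition mul_uv m (c : F) (H : int -> int -> 'M[A]_m) (r s : int) : 'M[A]_m :=
  H (r + 1) s - H r (s + 1) - c%:A *: H r s.

Definition T1 (r : nat) : 'M[A]_(N * N) := T r *t (1%:M : 'M[A]_N).
Definition T2 (r : nat) : 'M[A]_(N * N) := (1%:M : 'M[A]_N) *t T r.

Definition T1T2 := two_sided (fun r s => T1 r *m T2 s).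
Definition T2T1 := two_sided (fun r s => T2 s *m T1 r).

Definition rtt_lhs (r s : int) : 'M[A]_(N * N) :=
  mul_uv 0 (mul_uv (kappa F N) T1T2) r s
  - scal_mx (Pmx F N) *m mul_uv (kappa F N) T1T2 r s
  + scal_mx (Qmx F N) *m mul_uv 0 T1T2 r s.

Definition rtt_rhs (r s : int) : 'M[A]_(N * N) :=
  mul_uv 0 (mul_uv (kappa F N) T2T1) r s
  - mul_uv (kappa F N) T2T1 r s *m scal_mx (Pmx F N)
  + mul_uv 0 T2T1 r s *m scal_mx (Qmx F N).

End RTT.

Section RTTEvaluation.
Variables (F : fieldType) (N : nat) (A : algType F) (T : nat -> 'M[A]_N).
Variable e : {rmorphism A -> F}.
Hypothesis eA : forall c : F, e c%:A = c.
Hypothesis eT : forall r, map_mx e (T r) = (r == 0)%:R%:M.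

Lemma rtt_eval_trivial (r0 s0 : int) :
  map_mx e (rtt_lhs T r0 s0) = map_mx e (rtt_rhs T r0 s0).
Proof.
have escal m (M : 'M[F]_m) : map_mx e (scal_mx _ M) = M.
  by apply/matrixP => i j; rewrite !mxE /= -[RHS]eA.
have eTij r i j : e (T r i j) = (r == 0)%:R *+ (i == j).
    by have := congr1 (fun M : 'M_N => M i j) (eT r); rewrite !mxE.
have eT1 r : map_mx e (T1 T r) = (r == 0)%:R%:M.
  apply/matrixP => i j; case: (mxtens_indexP i) (mxtens_indexP j).
  move=> i1 i2 [j1 j2]; rewrite !mxE rmorphM !mxtens_indexK /= eTij rmorph_nat.
  rewrite (can_eq (@mxtens_indexK _ _)) xpair_eqE.
  by case: (i1 == j1); case: (i2 == j2); rewrite ?mulr1 ?mulr0 ?mul0r.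
have eT2 r : map_mx e (T2 T r) = (r == 0)%:R%:M.
  apply/matrixP => i j; case: (mxtens_indexP i) (mxtens_indexP j).
  move=> i1 i2 [j1 j2]; rewrite !mxE rmorphM !mxtens_indexK /= eTij rmorph_nat.
  rewrite (can_eq (@mxtens_indexK _ _)) xpair_eqE.
  by case: (i1 == j1); case: (i2 == j2); rewrite ?mul1r ?mulr0 ?mul0r.
pose h (r s : int) : F := ((r == 0) && (s == 0))%:R.
have eT12 r s : map_mx e (T1T2 T r s) = (h r s)%:M.
  case: r s => [r|r] [s|s] /=; rewrite ?map_mx0 /h ?andbF ?raddf0 //=.
  by rewrite map_mxM eT1 eT2 -scalar_mxM -natrM mulnb.
have eT21 r s : map_mx e (T2T1 T r s) = (h r s)%:M.
  case: r s => [r|r] [s|s] /=; rewrite ?map_mx0 /h ?andbF ?raddf0 //=.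
  by rewrite map_mxM eT1 eT2 -scalar_mxM -natrM mulnb andbC.
have euv m c H (k : int -> int -> F) :
    (forall r s, map_mx e (H r s) = (k r s)%:M :> 'M_m) ->
    forall r s, map_mx e (mul_uv c H r s) =
      (k (r + 1) s - k r (s + 1) - c * k r s)%:M :> 'M_m.
  move=> eH r s; rewrite !map_mxB map_mxZ !eH /= eA.
  by rewrite scale_scalar_mx !raddfB.
have fin x y z (X Y Z X' Y' Z' : 'M[A]_(N * N)) (P Q : 'M[F]_(N * N)) :
    map_mx e X = x%:M -> map_mx e Y = y%:M -> map_mx e Z = z%:M ->
    map_mx e X' = x%:M -> map_mx e Y' = y%:M -> map_mx e Z' = z%:M ->
    map_mx e (X - scal_mx A P *m Y + scal_mx A Q *m Z) =
    map_mx e (X' - Y' *m scal_mx A P + Z' *m scal_mx A Q).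
  move=> eX eY eZ eX' eY' eZ'.
  rewrite !map_mxD [X in _ + X + _ = _]map_mxN [X in _ = _ + X + _]map_mxN.
  rewrite !map_mxM !escal eX eY eZ eX' eY' eZ'.
  by rewrite !scalar_mxC.
pose k := kappa F N.
apply: fin (euv _ 0 _ _ (euv _ k _ _ eT12) r0 s0) (euv _ k _ _ eT12 r0 s0)
  (euv _ 0 _ _ eT12 r0 s0) (euv _ 0 _ _ (euv _ k _ _ eT21) r0 s0)
  (euv _ k _ _ eT21 r0 s0) (euv _ 0 _ _ eT21 r0 s0).
Qed.

Lemma rtt_eval_rel (r s : int) (i j : 'I_(N * N)) :
  e (rtt_lhs T r s i j - rtt_rhs T r s i j) = 0.
Proof.
have /matrixP/(_ i j) := rtt_eval_trivial r s.
by rewrite [LHS]mxE [RHS]mxE rmorphB => ->; rewrite subrr.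
Qed.

End RTTEvaluation.

Section ExtendedYangian.
Variables (F : fieldType) (N : nat).

(* (i, j, r) stands for the generator t_ij^(r+1). *)
Definition tgen : Type := ('I_N * 'I_N * nat)%type.
HB.instance Definition _ := Choice.on tgen.

Definition free_T (r : nat) : 'M[free_alg F tgen]_N :=
  if r is r'.+1 then \matrix_(i, j) free_gen F ((i, j, r') : tgen) else 1%:M.

Definition rtt_rels (x : free_alg F tgen) : Prop :=
  exists (r s : int) (i j : 'I_(N * N)),
    x = rtt_lhs free_T r s i j - rtt_rhs free_T r s i j.

Let eps : {rmorphism free_alg F tgen -> F} :=
  [the {rmorphism {malg F[{fmonom tgen}]} -> F} of
     mcoeff (@mone {fmonom tgen})].

Lemma rtt_proper : ~ ideal_gen rtt_rels 1.
Proof.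
have eA c : eps c%:A = c.
  by rewrite (mcoeffZ c 1 _ : eps _ = c * eps 1) rmorph1 mulr1.
have eT r : map_mx eps (free_T r) = (r == 0)%:R%:M.
  case: r => [|r] /=; first by rewrite map_mx1.
  apply/matrixP => i j; rewrite !mxE /= mul0rn mcoeffU1.
  by rewrite fmP fmuE /= fm1.
move=> /(_ (fun x => eps x = 0)) one_in.
suff: eps 1 = 0 by apply/eqP; rewrite rmorph1 oner_neq0.
apply: one_in => [|_ [r [s [i [j ->]]]]].
  split=> [|x y xe ye|a x xe|a x xe]; first exact: rmorph0.
  - by rewrite rmorphD xe ye addr0.
  - by rewrite rmorphM xe mulr0.
  - by rewrite rmorphM xe mul0r.
exact: (rtt_eval_rel eA eT).
Qed.

(* X(so_N): the free algebra on the t_ij^(r), r >= 1, modulo the ideal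
   generated by all the coefficients of the RTT relation. *)
Definition yangian : algType F := quotient_alg rtt_proper.

Definition yangian_T (r : nat) : 'M[yangian]_N :=
  map_mx (quot_pi rtt_proper) (free_T r).

(* S(u) = T(u - kappa/2) G(u) T^t(- u + kappa/2) *)
Definition yangian_Tshift (r : nat) : 'M[yangian]_N :=
  \matrix_(i, j) fps_shift (fun k => yangian_T k i j) (kappa F N / 2%:R) r.

Definition yangian_Ttreflect (r : nat) : 'M[yangian]_N :=
  \matrix_(i, j)
    fps_reflect (fun k => ttr (yangian_T k) i j) (kappa F N / 2%:R) r.

Definition yangian_S : nat -> 'M[yangian]_N :=
  fps_mul (fps_mul yangian_Tshift (fun r => scal_mx yangian (Gser F N r)))
          yangian_Ttreflect.

End ExtendedYangian.

Section TwistedYangian.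
Variables (F : fieldType) (N : nat).

Definition twisted_gens (x : yangian F N) : Prop :=
  exists (r : nat) (i j : 'I_N), x = yangian_S F N r.+1 i j.

(* X(so_N, so_{N-2} + so_2)^tw; the index r.+1 in twisted_gens ranges over the
   coefficients of u^-1, u^-2, ... *)
Definition twisted_yangian : algType F := subalg twisted_gens.

Lemma twisted_gens_S (r : nat) (i j : 'I_N) :
  twisted_gens (yangian_S F N r.+1 i j).
Proof. by exists r, i, j. Qed.

(* The coefficient at u^-r of s_ij(u) = g_ij + \sum_(r >= 1) s_ij^(r) u^-r. *)
Definition twisted_s (i j : 'I_N) (r : nat) : twisted_yangian :=
  if r is r'.+1 then subalg_of_gen (twisted_gens_S r' i j)
  else (Gmx F N i j)%:A.

End TwistedYangian.

Section Representations.
Variables (F : fieldType) (A : algType F).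

Record representation : Type := Representation {
  rep_space : lmodType F;
  rep_act : A -> rep_space -> rep_space;
  rep_linearl : forall v, linear (rep_act^~ v);
  rep_linearr : forall x, linear (rep_act x);
  rep_act1 : forall v, rep_act 1 v = v;
  rep_actM : forall x y v, rep_act (x * y) v = rep_act x (rep_act y v)
}.

Definition one_dimensional (V : representation) : Prop :=
  exists v : rep_space V, v != 0 /\ forall w, exists c : F, w = c *: v.

Definition rep_iso (V W : representation) : Prop :=
  exists phi : {linear rep_space V -> rep_space W},
    bijective phi /\ forall x v, phi (rep_act x v) = rep_act x (phi v).

Section Twist.
Variables (V : representation) (nu : {lrmorphism A -> A}).

Definition twist_act (x : A) : rep_space V -> rep_space V := rep_act (nu x).

Lemma twist_linearl v : linear (twist_act^~ v).
Proof. by move=> c x y; rewrite /twist_act linearP rep_linearl. Qed.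

Lemma twist_linearr x : linear (twist_act x).
Proof. exact: rep_linearr. Qed.

Lemma twist_act1 v : twist_act 1 v = v.
Proof. by rewrite /twist_act rmorph1 rep_act1. Qed.

Lemma twist_actM x y v : twist_act (x * y) v = twist_act x (twist_act y v).
Proof. by rewrite /twist_act rmorphM rep_actM. Qed.

Definition rep_twist : representation :=
  Representation twist_linearl twist_linearr twist_act1 twist_actM.

End Twist.

End Representations.

Section Distinguished.
Variables (F : fieldType) (N : nat).
Local Notation Y := (twisted_yangian F N).

(* W is the one-dimensional representation V(a), S(u) |-> K(u;a). *)
Definition is_V (a : F) (W : representation Y) : Prop :=
  one_dimensional W /\
  forall (i j : 'I_N) (r : nat) (w : rep_space W),
    rep_act (twisted_s F i j r) w = Kser N a r i j *: w.

(* nu is the automorphism nu_g, S(u) |-> g(u - kappa/2) S(u). *)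
Definition is_nu (g : nat -> F) (nu : {lrmorphism Y -> Y}) : Prop :=
  bijective nu /\
  forall (i j : 'I_N) (r : nat),
    nu (twisted_s F i j r) =
      fps_scale (fps_shift (g : nat -> F^o) (kappa F N / 2%:R))
        (twisted_s F i j) r.

End Distinguished.

(* Main.v *)
(* A one-dimensional module is given by a character chi of the twisted Yangian.
   In the variable w = u - kappa/2 the matrix S is T(w) G' T^t(-w), up to the
   shift; it satisfies the reflection equation, and composing the RTT relation
   between T(w) and T(-w) with Q gives a fusion identity expressing S(-w) through
   S(w). Applying chi yields scalar equations for K = chi(S). The term
   v -> infinity of the reflection equation makes K diagonal with all middle
   entries equal to one series b (here N >= 5 is used). The other diagonal
   equations separate u from v and show that the two extreme entries are
   - b (w + c + a) / (w + c - a) and - b (w + c + a') / (w + c - a'), c = kappa/2,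
   for constants a and a'. Fusion forces a + a' = kappa - 1 and determines b up to
   an even series g, that is chi(S) = g(u - kappa/2) K(u;a). The automorphism nu_g
   is induced by T(u) |-> f(u) T(u) with f even and f^2 = g; hence V(a) can be
   taken to be the twist of V by nu_{1/g}, and twisting it by nu_g gives V back. *)
From HB Require Import structures.
Require Import Defs.
From mathcomp Require Import all_boot all_order all_algebra.
From mathcomp Require Import reals complex.
From mathcomp Require Import generic_quotient boolp.
From mathcomp Require Import mxtens monalg ring zify.

Set Implicit Arguments.
Unset Strict Implicit.
Unset Printing Implicit Defensive.

Import GRing.Theory Num.Theory.

Local Open Scope ring_scope.

(** * The tensor square, R-matrices and the reflection equation *)

(** Since 1/(u - v) is not a power series, each R-matrix is multiplied by its denominators and the
    equations are written in the inverse parameters x and y. Centring at u = kappa/2 turns the two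
    arguments of T in S(u) into w and -w, so sign substitutions in the single RTT relation yield
    every exchange relation needed.

    The reflection equation is homogeneous in S, hence blind to a scalar factor. Fusion has S(w) on
    one side and S(-w) on the other, and so fixes that factor up to an even series.

    The obstacle is that a character lives only on the subalgebra generated by S, whereas both
    identities are proved with T. They are established in X(so_N), pulled back along the injective
    inclusion, and only then evaluated. This needs the series of S in w to have coefficients in the
    subalgebra, which holds because the change of variable is invertible on series over any algebra.
    Taking V(a) as a twist of V also spares checking the relations for K(u;a). *)

Section TensorSquare.
Variables (L : nzRingType) (N : nat).
Implicit Types (X Y : 'M[L]_N) (Z W : 'M[L]_(N * N)) (i j k l : 'I_N).

Definition entry2 (Z : 'M[L]_(N * N)) i k j l : L :=
  Z (mxtens_index (i, k)) (mxtens_index (j, l)).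

Lemma entry2P Z W :
  (forall i k j l, entry2 Z i k j l = entry2 W i k j l) -> Z = W.
Proof.
move=> eZW; apply/matrixP => p q.
by case: (mxtens_indexP p) => i k; case: (mxtens_indexP q) => j l; apply: eZW.
Qed.

Lemma entry2M Z W i k j l :
  entry2 (Z *m W) i k j l = \sum_a \sum_b entry2 Z i k a b * entry2 W a b j l.
Proof.
rewrite /entry2 mxE pair_big.
rewrite (reindex (@mxtens_index N N)) /=; last first.
  exists (@mxtens_unindex N N) => p _; first exact: mxtens_indexK.
  exact: mxtens_unindexK.
by apply: eq_bigr => -[a b] _.
Qed.

Lemma entry2D Z W i k j l :
  entry2 (Z + W) i k j l = entry2 Z i k j l + entry2 W i k j l.
Proof. by rewrite /entry2 mxE. Qed.

Lemma entry2N Z i k j l : entry2 (- Z) i k j l = - entry2 Z i k j l.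
Proof. by rewrite /entry2 mxE. Qed.

Lemma entry2Z a Z i k j l : entry2 (a *: Z) i k j l = a * entry2 Z i k j l.
Proof. by rewrite /entry2 mxE. Qed.

Definition first X : 'M[L]_(N * N) := X *t 1%:M.
Definition second X : 'M[L]_(N * N) := 1%:M *t X.

(** [flip] and [contraction] are P and Q over an arbitrary ring, given by entries 0 and 1 so that
    every ring morphism preserves them. *)
Definition flip : 'M[L]_(N * N) :=
  \matrix_(p, q) (((mxtens_unindex p).1 == (mxtens_unindex q).2) &&
                  ((mxtens_unindex p).2 == (mxtens_unindex q).1))%:R.

Definition contraction : 'M[L]_(N * N) :=
  \matrix_(p, q)
    (((mxtens_unindex p).2 == rev_ord (mxtens_unindex p).1) &&
     ((mxtens_unindex q).2 == rev_ord (mxtens_unindex q).1))%:R.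

Lemma entry2_first X i k j l : entry2 (first X) i k j l = X i j *+ (k == l).
Proof. by rewrite /entry2 tensmxE mxE mulr_natr. Qed.

Lemma entry2_second X i k j l : entry2 (second X) i k j l = X k l *+ (i == j).
Proof. by rewrite /entry2 tensmxE mxE mulr_natl. Qed.

Lemma entry2_flip i k j l :
  entry2 flip i k j l = ((i == l) && (k == j))%:R.
Proof. by rewrite /entry2 mxE !mxtens_indexK. Qed.

Lemma entry2_contraction i k j l :
  entry2 contraction i k j l = ((k == rev_ord i) && (l == rev_ord j))%:R.
Proof. by rewrite /entry2 mxE !mxtens_indexK. Qed.

Lemma entry2_firstM X Z i k j l :
  entry2 (first X *m Z) i k j l = \sum_a X i a * entry2 Z a k j l.
Proof.
rewrite entry2M; apply: eq_bigr => a _.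
rewrite (bigD1 k) //= entry2_first eqxx big1 ?addr0 // => b bk.
by rewrite entry2_first eq_sym (negbTE bk) mul0r.
Qed.

Lemma entry2_secondM X Z i k j l :
  entry2 (second X *m Z) i k j l = \sum_b X k b * entry2 Z i b j l.
Proof.
rewrite entry2M (bigD1 i) //= [X in _ + X]big1 ?addr0 => [|a ai].
  by apply: eq_bigr => b _; rewrite entry2_second eqxx.
by apply: big1 => b _; rewrite entry2_second eq_sym (negbTE ai) mul0r.
Qed.

Lemma entry2_Msecond X Z i k j l :
  entry2 (Z *m second X) i k j l = \sum_b entry2 Z i k j b * X b l.
Proof.
rewrite entry2M (bigD1 j) //= [X in _ + X]big1 ?addr0 => [|a ai].
  by apply: eq_bigr => b _; rewrite entry2_second eqxx.
by apply: big1 => b _; rewrite entry2_second (negbTE ai) mulr0.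
Qed.

Lemma entry2_Mfirst X Z i k j l :
  entry2 (Z *m first X) i k j l = \sum_a entry2 Z i k a l * X a j.
Proof.
rewrite entry2M; apply: eq_bigr => a _.
rewrite (bigD1 l) //= entry2_first eqxx big1 ?addr0 // => b bk.
by rewrite entry2_first (negbTE bk) mulr0.
Qed.

Lemma entry2_flipM Z i k j l :
  entry2 (flip *m Z) i k j l = entry2 Z k i j l.
Proof.
rewrite entry2M (bigD1 k) //= (bigD1 i) //= entry2_flip !eqxx mul1r.
rewrite big1 => [|b bi]; last first.
  by rewrite entry2_flip eq_sym (negbTE bi) mul0r.
rewrite addr0 big1 ?addr0 // => a ak; apply: big1 => b _.
by rewrite entry2_flip andbC eq_sym (negbTE ak) mul0r.
Qed.

Lemma entry2_Mflip Z i k j l :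
  entry2 (Z *m flip) i k j l = entry2 Z i k l j.
Proof.
rewrite entry2M (bigD1 l) //= (bigD1 j) //= entry2_flip !eqxx mulr1.
rewrite big1 => [|b bi]; last first.
  by rewrite entry2_flip andbC (negbTE bi) mulr0.
rewrite addr0 big1 ?addr0 // => a ak; apply: big1 => b _.
by rewrite entry2_flip (negbTE ak) mulr0.
Qed.

Lemma entry2_contractionM Z i k j l :
  entry2 (contraction *m Z) i k j l =
  (\sum_p entry2 Z p (rev_ord p) j l) *+ (k == rev_ord i).
Proof.
rewrite entry2M -sumrMnl; apply: eq_bigr => p _.
rewrite (bigD1 (rev_ord p)) //= entry2_contraction eqxx andbT mulr_natl.
rewrite big1 ?addr0 // => b bp.
by rewrite entry2_contraction (negbTE bp) andbF mul0r.
Qed.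

Lemma entry2_Mcontraction Z i k j l :
  entry2 (Z *m contraction) i k j l =
  (\sum_p entry2 Z i k p (rev_ord p)) *+ (l == rev_ord j).
Proof.
rewrite entry2M -sumrMnl; apply: eq_bigr => p _.
rewrite (bigD1 (rev_ord p)) //= entry2_contraction eqxx mulr_natr.
rewrite big1 ?addr0 // => b bp.
by rewrite entry2_contraction (negbTE bp) mulr0.
Qed.

Lemma firstM X Y : first (X *m Y) = first X *m first Y.
Proof.
apply: entry2P => i k j l; rewrite entry2_firstM entry2_first mxE -sumrMnl.
by apply: eq_bigr => a _; rewrite entry2_first mulrnAr.
Qed.

Lemma secondM X Y : second (X *m Y) = second X *m second Y.
Proof.
apply: entry2P => i k j l; rewrite entry2_secondM entry2_second mxE -sumrMnl.
by apply: eq_bigr => a _; rewrite entry2_second mulrnAr.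
Qed.

Lemma entry2_first_second X Y i k j l :
  entry2 (first X *m second Y) i k j l = X i j * Y k l.
Proof.
rewrite entry2_firstM (bigD1 j) //= entry2_second eqxx big1 ?addr0 // => a aj.
by rewrite entry2_second (negbTE aj) mulr0.
Qed.

Lemma entry2_second_first X Y i k j l :
  entry2 (second Y *m first X) i k j l = Y k l * X i j.
Proof.
rewrite entry2_secondM (bigD1 l) //= entry2_first eqxx big1 ?addr0 // => a aj.
by rewrite entry2_first (negbTE aj) mulr0.
Qed.

Lemma first_second_comm X Y :
  (forall i j k l, X i j * Y k l = Y k l * X i j) ->
  first X *m second Y = second Y *m first X.
Proof.
move=> cXY; apply: entry2P => i k j l.
by rewrite entry2_first_second entry2_second_first.
Qed.

Lemma flipK : flip *m flip = 1%:M.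
Proof.
apply: entry2P => i k j l; rewrite entry2_flipM entry2_flip /entry2 mxE.
by rewrite (can_eq (@mxtens_indexK _ _)) xpair_eqE andbC.
Qed.

Lemma flip_first X : flip *m first X = second X *m flip.
Proof.
apply: entry2P => i k j l.
by rewrite entry2_flipM entry2_Mflip entry2_first entry2_second.
Qed.

Lemma flip_second X : flip *m second X = first X *m flip.
Proof.
apply: entry2P => i k j l.
by rewrite entry2_flipM entry2_Mflip entry2_first entry2_second.
Qed.

Lemma flip_contraction : flip *m contraction = contraction.
Proof.
apply: entry2P => i k j l; rewrite entry2_flipM !entry2_contraction.
by rewrite eq_sym (can2_eq (@rev_ordK _) (@rev_ordK _)).
Qed.

Lemma contraction_flip : contraction *m flip = contraction.
Proof.
apply: entry2P => i k j l; rewrite entry2_Mflip !entry2_contraction.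
by rewrite [j == _]eq_sym (can2_eq (@rev_ordK _) (@rev_ordK _)).
Qed.

(** The image of Q is spanned by the sum of the e_p tensor e_{-p}; on this vector, X in one factor
    acts as its transpose in the other. *)
Lemma first_contraction X :
  first X *m contraction = second (ttr X) *m contraction.
Proof.
apply: entry2P => i k j l; rewrite !entry2_Mcontraction; congr (_ *+ _).
rewrite (bigD1 (rev_ord k)) //= [RHS](bigD1 i) //=.
rewrite entry2_first entry2_second rev_ordK !eqxx mxE rev_ordK !mulr1n.
congr (_ + _); rewrite !big1 // => p pn.
  by rewrite entry2_second eq_sym (negbTE pn).
rewrite entry2_first; case: eqP => [kp|//].
by rewrite -[p]rev_ordK -kp eqxx in pn.
Qed.

Lemma ttrK X : ttr (ttr X) = X.
Proof. by apply/matrixP => i j; rewrite !mxE !rev_ordK. Qed.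

Lemma second_contraction X :
  second X *m contraction = first (ttr X) *m contraction.
Proof. by rewrite first_contraction ttrK. Qed.

End TensorSquare.

Arguments flip {L N}.
Arguments contraction {L N}.

Section MapTensorSquare.
Variables (L L' : nzRingType) (f : {rmorphism L -> L'}) (N : nat).

Lemma map_first (X : 'M[L]_N) : map_mx f (first X) = first (map_mx f X).
Proof. by rewrite /first map_mxT map_mx1. Qed.

Lemma map_second (X : 'M[L]_N) : map_mx f (second X) = second (map_mx f X).
Proof. by rewrite /second map_mxT map_mx1. Qed.

Lemma map_flip : map_mx f (flip : 'M_(N * N)) = flip.
Proof. by apply/matrixP => p q; rewrite !mxE rmorph_nat. Qed.

Lemma map_contraction : map_mx f (contraction : 'M_(N * N)) = contraction.
Proof. by apply/matrixP => p q; rewrite !mxE rmorph_nat. Qed.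

End MapTensorSquare.

(** The matrices will have entries in series over X(so_N), a noncommutative ring, so the scalars of
    an R-matrix are carried as central elements. *)
Definition central (L : nzRingType) (a : L) := forall z, a * z = z * a.

Lemma centralN (L : nzRingType) (a : L) : central a -> central (- a).
Proof. by move=> ca z; rewrite mulNr mulrN ca. Qed.

Section RMatrix.
Variables (L : nzRingType) (N : nat).
Implicit Types (a b c : L) (X Y : 'M[L]_N).

(** R(t) with cleared denominators: a, b, c are to be proportional to 1, 1/t, 1/(t - kappa). *)
Definition rmat a b c : 'M[L]_(N * N) :=
  a%:M - b *: flip + c *: contraction.

Lemma mulmxZc m (a : L) (Z W : 'M[L]_m) :
  central a -> Z *m (a *: W) = a *: (Z *m W).
Proof.
move=> ca; apply/matrixP => i j; rewrite !mxE mulr_sumr.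
by apply: eq_bigr => k _; rewrite mxE mulrA -ca mulrA.
Qed.

Lemma rmatMl a b c (Z : 'M_(N * N)) :
  rmat a b c *m Z = a *: Z - b *: (flip *m Z) + c *: (contraction *m Z).
Proof. by rewrite !mulmxDl mulNmx -!scalemxAl mul_scalar_mx. Qed.

Lemma rmatMr a b c (Z : 'M_(N * N)) :
  central a -> central b -> central c ->
  Z *m rmat a b c = a *: Z - b *: (Z *m flip) + c *: (Z *m contraction).
Proof.
move=> ca cb cc; rewrite !mulmxDr mulmxN !mulmxZc //.
by rewrite -scalemx1 mulmxZc // mulmx1.
Qed.

Lemma flip_rmat a b c : central a -> central b -> central c ->
  flip *m rmat a b c = rmat a b c *m flip.
Proof.
move=> ca cb cc.
by rewrite rmatMl rmatMr // flip_contraction contraction_flip.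
Qed.

Definition rtt a b c X Y :=
  rmat a b c *m first X *m second Y = second Y *m first X *m rmat a b c.

Lemma rttP a b c X Y : central a -> central b -> central c ->
  rtt a b c X Y <->
  forall i k j l,
    a * (X i j * Y k l) - b * (X k j * Y i l) +
      (c * \sum_p X p j * Y (rev_ord p) l) *+ (k == rev_ord i) =
    a * (Y k l * X i j) - b * (Y k j * X i l) +
      (c * \sum_p Y k (rev_ord p) * X i p) *+ (l == rev_ord j).
Proof.
move=> ca cb cc.
have el i k j l : entry2 (rmat a b c *m first X *m second Y) i k j l =
    a * (X i j * Y k l) - b * (X k j * Y i l) +
      (c * \sum_p X p j * Y (rev_ord p) l) *+ (k == rev_ord i).
  rewrite -mulmxA rmatMl !entry2D entry2N !entry2Z entry2_flipM.
  rewrite entry2_contractionM !entry2_first_second mulrnAr.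
  congr (_ + (_ * _) *+ _); apply: eq_bigr => p _.
  exact: entry2_first_second.
have er i k j l : entry2 (second Y *m first X *m rmat a b c) i k j l =
    a * (Y k l * X i j) - b * (Y k j * X i l) +
      (c * \sum_p Y k (rev_ord p) * X i p) *+ (l == rev_ord j).
  rewrite rmatMr // !entry2D entry2N !entry2Z entry2_Mflip.
  rewrite entry2_Mcontraction !entry2_second_first mulrnAr.
  congr (_ + (_ * _) *+ _); apply: eq_bigr => p _.
  exact: entry2_second_first.
split=> [h i k j l | h]; first by rewrite -el -er h.
by apply: entry2P => i k j l; rewrite el er.
Qed.

(* Transposing the first tensor factor exchanges P and Q. *)
Lemma rtt_transpose_first a b c X Y :
  central a -> central b -> central c -> rtt a b c X Y ->
  first (ttr X) *m rmat a (- c) (- b) *m second Y =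
  second Y *m rmat a (- c) (- b) *m first (ttr X).
Proof.
move=> ca cb cc h.
have cNb := centralN cb; have cNc := centralN cc.
apply: entry2P => i k j l.
rewrite -mulmxA rmatMl -mulmxA rmatMl !mulmxDr !mulmxN !mulmxZc //.
rewrite !scaleNr !opprK !entry2D !entry2N !entry2Z.
rewrite entry2_first_second entry2_second_first.
have -> : entry2 (first (ttr X) *m (flip *m second Y)) i k j l =
    (\sum_p X p (rev_ord i) * Y (rev_ord p) l) *+ (k == j).
  rewrite entry2_firstM (reindex_inj rev_ord_inj) -sumrMnl /=.
  apply: eq_bigr => p _.
  by rewrite entry2_flipM entry2_second mxE rev_ordK mulrnAr.
have -> : entry2 (first (ttr X) *m (contraction *m second Y)) i k j l =
    X k (rev_ord i) * Y (rev_ord j) l.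
  rewrite entry2_firstM (bigD1 (rev_ord k)) //= big1 ?addr0 => [|p pk].
    rewrite entry2_contractionM mxE !rev_ordK eqxx mulr1n; congr (_ * _).
    rewrite (bigD1 j) //= entry2_second eqxx big1 ?addr0 // => p pj.
    by rewrite entry2_second (negbTE pj).
  rewrite entry2_contractionM; case: eqP => [kp|]; last by rewrite mulr0.
  by rewrite kp rev_ordK eqxx in pk.
have -> : entry2 (second Y *m (flip *m first (ttr X))) i k j l =
    (\sum_p Y k (rev_ord p) * X (rev_ord j) p) *+ (i == l).
  rewrite entry2_secondM (reindex_inj rev_ord_inj) -sumrMnl /=.
  apply: eq_bigr => p _.
  by rewrite entry2_flipM entry2_first mxE rev_ordK mulrnAr.
have -> : entry2 (second Y *m (contraction *m first (ttr X))) i k j l =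
    Y k (rev_ord i) * X (rev_ord j) l.
  rewrite entry2_secondM (bigD1 (rev_ord i)) //= big1 ?addr0 => [|p pk].
    rewrite entry2_contractionM eqxx mulr1n; congr (_ * _).
    rewrite (bigD1 (rev_ord l)) //= entry2_first rev_ordK eqxx mxE rev_ordK.
    rewrite big1 ?addr0 // => p pj; rewrite entry2_first.
    by case: eqP => // pl; rewrite -pl rev_ordK eqxx in pj.
  by rewrite entry2_contractionM (negbTE pk) mulr0.
rewrite !mxE.
(* The entry (i, k; j, l) of the transposed identity is the entry (-j, k; -i, l) of the original
   one. *)
have := (rttP X Y ca cb cc).1 h (rev_ord j) k (rev_ord i) l.
rewrite !rev_ordK -!mulrnAr eq_sym [l == i]eq_sym => e.
by rewrite addrAC [RHS]addrAC [j == k]eq_sym in e *.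
Qed.

(** Transposing both factors fixes P and Q. It reverses the matrix products but not the order in
    which the entries are multiplied, so R changes side. *)
Lemma rtt_transpose a b c X Y :
  central a -> central b -> central c -> rtt a b c X Y ->
  first (ttr X) *m second (ttr Y) *m rmat a b c =
  rmat a b c *m second (ttr Y) *m first (ttr X).
Proof.
move=> ca cb cc h.
apply: entry2P => i k j l; rewrite rmatMr // -[in RHS]mulmxA rmatMl.
rewrite !entry2D !entry2N !entry2Z entry2_Mflip entry2_Mcontraction.
rewrite entry2_flipM entry2_contractionM !entry2_first_second.
rewrite !entry2_second_first.
under eq_bigr => p _ do rewrite entry2_first_second !mxE rev_ordK.
under [X in _ = _ + _ * (X *+ _)]eq_bigr => p _
  do rewrite entry2_second_first !mxE rev_ordK.
rewrite !mxE.
have := (rttP X Y ca cb cc).1 h (rev_ord j) (rev_ord l) (rev_ord i) (rev_ord k).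
rewrite !rev_ordK -!mulrnAr.
rewrite (can2_eq (@rev_ordK _) (@rev_ordK _)).
rewrite [_ == i](can2_eq (@rev_ordK _) (@rev_ordK _)).
rewrite [X in _ + _ * (X *+ _) = _](reindex_inj rev_ord_inj) /=.
rewrite [X in _ = _ + _ * (X *+ _)](reindex_inj rev_ord_inj) /=.
under eq_bigr do rewrite rev_ordK.
under [X in _ = _ + _ * (X *+ _)]eq_bigr do rewrite rev_ordK.
by [].
Qed.

Definition swap (Z : 'M[L]_(N * N)) := flip *m Z *m flip.

Lemma swapM Z W : swap (Z *m W) = swap Z *m swap W.
Proof.
by rewrite /swap !mulmxA -[_ *m flip *m flip]mulmxA flipK mulmx1.
Qed.

Lemma swap_first X : swap (first X) = second X.
Proof. by rewrite /swap flip_first -mulmxA flipK mulmx1. Qed.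

Lemma swap_second X : swap (second X) = first X.
Proof. by rewrite /swap flip_second -mulmxA flipK mulmx1. Qed.

Lemma swap_rmat a b c : central a -> central b -> central c ->
  swap (rmat a b c) = rmat a b c.
Proof. by move=> *; rewrite /swap flip_rmat // -mulmxA flipK mulmx1. Qed.

Lemma swap_crossed a b c X Y : central a -> central b -> central c ->
  first X *m rmat a b c *m second Y = second Y *m rmat a b c *m first X ->
  second X *m rmat a b c *m first Y = first Y *m rmat a b c *m second X.
Proof.
move=> ca cb cc /(congr1 swap).
by rewrite !swapM !swap_first !swap_second swap_rmat.
Qed.

Lemma swap_parallel a b c X Y : central a -> central b -> central c ->
  first X *m second Y *m rmat a b c = rmat a b c *m second Y *m first X ->
  second X *m first Y *m rmat a b c = rmat a b c *m first Y *m second X.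
Proof.
move=> ca cb cc /(congr1 swap).
by rewrite !swapM !swap_first !swap_second swap_rmat.
Qed.

End RMatrix.

Section MapRMatrix.
Variables (L L' : nzRingType) (f : {rmorphism L -> L'}) (N : nat).

Lemma map_rmat a b c :
  map_mx f (rmat N a b c) = rmat N (f a) (f b) (f c).
Proof.
by rewrite map_mxD map_mxB !map_mxZ map_flip map_contraction map_scalar_mx.
Qed.

Lemma rtt_map a b c (X Y : 'M[L]_N) :
  rtt a b c X Y -> rtt (f a) (f b) (f c) (map_mx f X) (map_mx f Y).
Proof.
move=> /(congr1 (map_mx f)).
by rewrite !map_mxM !map_rmat !map_first !map_second.
Qed.

End MapRMatrix.

Section Reflection.
Variables (L : nzRingType) (N : nat).

Definition reflection (R R' : 'M[L]_(N * N)) (X Y : 'M[L]_N) :=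
  R *m first X *m R' *m second Y = second Y *m R' *m first X *m R.

(** Dressing of a solution with central entries. The four exchange hypotheses carry the outer
    factors X, X', Y, Y' through R and R' until the equation for G and H stands alone in the
    middle. *)
Lemma reflection_conj (R R' : 'M[L]_(N * N)) (G H X X' Y Y' : 'M[L]_N) :
  (forall i j, central (G i j)) -> (forall i j, central (H i j)) ->
  R *m first X *m second Y = second Y *m first X *m R ->
  first X' *m R' *m second Y = second Y *m R' *m first X' ->
  second Y' *m R' *m first X = first X *m R' *m second Y' ->
  R *m first X' *m second Y' = second Y' *m first X' *m R ->
  reflection R R' G H ->
  reflection R R' (X *m G *m X') (Y *m H *m Y').
Proof.
move=> ceG ceH hXY hX'Y hY'X hX'Y' hGH.
have cG Z : first G *m second Z = second Z *m first G.
  by apply: first_second_comm => i j k l; rewrite ceG.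
have cH Z : first Z *m second H = second H *m first Z.
  by apply: first_second_comm => i j k l; rewrite ceH.
rewrite /reflection !firstM !secondM !mulmxA.
transitivity (second Y *m first X *m (R *m first G *m R' *m second H)
   *m first X' *m second Y').
  rewrite !mulmxA -hXY -!mulmxA; congr (_ *m (_ *m _)).
  rewrite !mulmxA -cG -!mulmxA; congr (_ *m _).
  rewrite !mulmxA hX'Y -!mulmxA; congr (_ *m (_ *m _)).
  by rewrite !mulmxA cH.
rewrite hGH -!mulmxA [R *m (first X' *m _)]mulmxA hX'Y'.
congr (second Y *m _); rewrite !mulmxA cH -!mulmxA; congr (second H *m _).
rewrite !mulmxA [in RHS]hY'X -!mulmxA; congr (first X *m (R' *m _)).
by rewrite !mulmxA cG.
Qed.

End Reflection.

Lemma reflection_map (L L' : nzRingType) (f : {rmorphism L -> L'}) N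
    (R R' : 'M[L]_(N * N)) (X Y : 'M[L]_N) :
  reflection R R' X Y ->
  reflection (map_mx f R) (map_mx f R') (map_mx f X) (map_mx f Y).
Proof.
move=> /(congr1 (map_mx f)).
by rewrite /reflection !map_mxM !map_first !map_second.
Qed.

Lemma reflection_rmat_map (L L' : nzRingType) (f : {rmorphism L -> L'}) N
    a b c a' b' c' (X Y : 'M[L]_N) :
  reflection (rmat N a b c) (rmat N a' b' c') X Y ->
  reflection (rmat N (f a) (f b) (f c)) (rmat N (f a') (f b') (f c'))
    (map_mx f X) (map_mx f Y).
Proof. by move=> /(reflection_map f); rewrite !map_rmat. Qed.

Lemma crossed_map (L L' : nzRingType) (f : {rmorphism L -> L'}) N a b c
    (X Y : 'M[L]_N) :
  first X *m rmat N a b c *m second Y = second Y *m rmat N a b c *m first X ->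
  first (map_mx f X) *m rmat N (f a) (f b) (f c) *m second (map_mx f Y) =
  second (map_mx f Y) *m rmat N (f a) (f b) (f c) *m first (map_mx f X).
Proof.
move=> /(congr1 (map_mx f)).
by rewrite !map_mxM !map_first !map_second map_rmat.
Qed.

Section DiagonalFactors.
Variables (L : nzRingType) (N : nat) (D : 'M[L]_N) (Z : 'M[L]_(N * N)).
Hypothesis D_diag : forall i j, i != j -> D i j = 0.

Lemma entry2_first_diagM i k j l :
  entry2 (first D *m Z) i k j l = D i i * entry2 Z i k j l.
Proof.
rewrite entry2_firstM (bigD1 i) //= big1 ?addr0 // => a ai.
by rewrite D_diag ?mul0r // eq_sym.
Qed.

Lemma entry2_second_diagM i k j l :
  entry2 (second D *m Z) i k j l = D k k * entry2 Z i k j l.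
Proof.
rewrite entry2_secondM (bigD1 k) //= big1 ?addr0 // => a ai.
by rewrite D_diag ?mul0r // eq_sym.
Qed.

Lemma entry2_Mfirst_diag i k j l :
  entry2 (Z *m first D) i k j l = entry2 Z i k j l * D j j.
Proof.
rewrite entry2_Mfirst (bigD1 j) //= big1 ?addr0 // => a ai.
by rewrite D_diag ?mulr0.
Qed.

Lemma entry2_Msecond_diag i k j l :
  entry2 (Z *m second D) i k j l = entry2 Z i k j l * D l l.
Proof.
rewrite entry2_Msecond (bigD1 l) //= big1 ?addr0 // => a ai.
by rewrite D_diag ?mulr0.
Qed.

End DiagonalFactors.

(** * The diagonal matrix G(u) as a solution of reflection and fusion *)

Section ScalarSolution.
Variables (C : comNzRingType) (N : nat) (g : 'I_N -> C) (d : C).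
Hypothesis g_sign : forall i, g i = 1 \/ g i = -1.
Hypothesis g_rev : forall i, g (rev_ord i) = g i.
Hypothesis g_trace : \sum_i g i = 4%:R * d.
Hypothesis dN : N%:R = 4%:R * d + 4%:R.

(** The diagonal matrix p G - q. For p = x u and q = d x it is x (u G - d), a multiple of G(u)
    without denominator. *)
Definition gmat (p q : C) : 'M[C]_N := \matrix_(i, j) ((p * g i - q) *+ (i == j)).

Lemma gmatE p q i j : gmat p q i j = (p * g i - q) *+ (i == j).
Proof. by rewrite mxE. Qed.

Lemma trace_gmat p q : \sum_i (p * g i - q) = p * (4%:R * d) - q * (4%:R * d + 4%:R).
Proof.
by rewrite big_split /= -mulr_sumr g_trace sumr_const card_ord -(mulr_natr _ N) dN mulNr.
Qed.

Lemma entry2_rmat (a b c : C) (i k j l : 'I_N) :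
  entry2 (rmat N a b c) i k j l =
  a *+ ((i == j) && (k == l)) - b *+ ((i == l) && (k == j))
  + c *+ ((k == rev_ord i) && (l == rev_ord j)).
Proof.
rewrite !entry2D entry2N !entry2Z entry2_flip entry2_contraction !mulr_natr.
by rewrite /entry2 mxE (can_eq (@mxtens_indexK _ _)) xpair_eqE.
Qed.

Lemma gmat_diag p q i j : i != j -> gmat p q i j = 0.
Proof. by move=> ij; rewrite gmatE (negbTE ij). Qed.

Lemma entry2_first_gmatM p q (Z : 'M_(N * N)) i k j l :
  entry2 (first (gmat p q) *m Z) i k j l = (p * g i - q) * entry2 Z i k j l.
Proof. by rewrite entry2_first_diagM ?gmatE ?eqxx //; apply: gmat_diag. Qed.

Lemma entry2_second_gmatM p q (Z : 'M_(N * N)) i k j l :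
  entry2 (second (gmat p q) *m Z) i k j l = (p * g k - q) * entry2 Z i k j l.
Proof. by rewrite entry2_second_diagM ?gmatE ?eqxx //; apply: gmat_diag. Qed.

Lemma entry2_Mfirst_gmat p q (Z : 'M_(N * N)) i k j l :
  entry2 (Z *m first (gmat p q)) i k j l = entry2 Z i k j l * (p * g j - q).
Proof. by rewrite entry2_Mfirst_diag ?gmatE ?eqxx //; apply: gmat_diag. Qed.

Lemma entry2_Msecond_gmat p q (Z : 'M_(N * N)) i k j l :
  entry2 (Z *m second (gmat p q)) i k j l = entry2 Z i k j l * (p * g l - q).
Proof. by rewrite entry2_Msecond_diag ?gmatE ?eqxx //; apply: gmat_diag. Qed.

Lemma centralC (a : C) : central a. Proof. by move=> z; rewrite mulrC. Qed.
Hint Resolve centralC : core.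

Lemma sum_rmatl (F : 'I_N -> C) (a b c : C) (j l : 'I_N) :
  \sum_s F s * entry2 (rmat N a b c) s (rev_ord s) j l =
  (a * F j - b * F l + c * \sum_s F s) *+ (l == rev_ord j).
Proof.
under eq_bigr => s _ do rewrite entry2_rmat eqxx /=.
case: eqP => [->|lj]; last first.
  apply: big1 => s _.
  have -> : (s == j) && (rev_ord s == l) = false.
    by apply/negP => /andP[/eqP-> /eqP e]; apply: lj.
  have -> : (s == l) && (rev_ord s == j) = false.
    by apply/negP => /andP[/eqP-> /eqP e]; apply: lj; rewrite -e rev_ordK.
  by rewrite !mulr0n subrr addr0 mulr0.
under eq_bigr => s _.
  rewrite (inj_eq rev_ord_inj) andbb (can2_eq (@rev_ordK _) (@rev_ordK _)).
  rewrite andbb mulr1n mulrDr mulrBr; over.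
rewrite big_split sumrB /= mulr1n -mulr_suml mulrC; congr (_ - _ + _).
  rewrite (bigD1 j) //= eqxx mulr1n big1 ?addr0 1?mulrC // => s sj.
  by rewrite (negbTE sj) mulr0.
  rewrite (bigD1 (rev_ord j)) //= eqxx mulr1n.
  rewrite big1 ?addr0 1?mulrC // => s sj.
  by rewrite (negbTE sj) mulr0.
Qed.

Lemma entry2_rmat_sym (a b c : C) (i k j l : 'I_N) :
  entry2 (rmat N a b c) i k j l = entry2 (rmat N a b c) j l i k.
Proof.
rewrite !entry2_rmat [i == j]eq_sym [k == l]eq_sym [i == l]eq_sym.
by rewrite [k == j]eq_sym [(l == i) && _]andbC [(k == _) && _]andbC.
Qed.

Lemma sum_rmatr (F : 'I_N -> C) (a b c : C) (i k : 'I_N) :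
  \sum_s entry2 (rmat N a b c) i k s (rev_ord s) * F s =
  (a * F i - b * F k + c * \sum_s F s) *+ (k == rev_ord i).
Proof.
rewrite -sum_rmatl; apply: eq_bigr => s _.
by rewrite mulrC entry2_rmat_sym.
Qed.

(** In the homogeneous coordinates u = p/x and v = q/y, A and B are x y (u - v) and x y (u + v), so
    the reflection equation becomes a polynomial identity in p, q, x, y, d and the signs g. *)
Lemma reflection_gmat (p q x y k A B z : C) :
  k = 2%:R * d + 1 -> z = x * y -> A = y * p - x * q -> B = y * p + x * q ->
  reflection (rmat N (A * (A - k * z)) (z * (A - k * z)) (z * A))
    (rmat N (B * (B - k * z)) (z * (B - k * z)) (z * B))
    (gmat p (d * x)) (gmat q (d * y)).
Proof.
move=> ek ez eA eB; rewrite /reflection; apply: entry2P => i k' j l.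
rewrite entry2_Msecond_gmat -!mulmxA rmatMl.
rewrite entry2_second_gmatM [in RHS]mulmxA [in RHS]rmatMr //.
rewrite !entry2D !entry2N !entry2Z.
rewrite !entry2_flipM !entry2_contractionM !entry2_Mflip !entry2_Mcontraction.
rewrite !entry2_first_gmatM !entry2_Mfirst_gmat.
under eq_bigr => s _ do rewrite entry2_first_gmatM.
rewrite sum_rmatl.
under [X in _ = _ * (_ + _ * (X *+ _))]eq_bigr => s _
  do rewrite entry2_Mfirst_gmat.
rewrite sum_rmatr trace_gmat !entry2_rmat.
have revE (a b : 'I_N) : (a == rev_ord b) = (b == rev_ord a).
  by rewrite eq_sym (can2_eq (@rev_ordK _) (@rev_ordK _)).
rewrite [i == rev_ord k']revE [j == rev_ord l]revE.
rewrite [(k' == j) && _]andbC [(k' == l) && _]andbC.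
rewrite -!mulrnA !mulnb [(l == rev_ord j) && _]andbC.
(* Every term is supported on one of three Kronecker patterns, and on each of them the signs agree
   in pairs; what remains depends on at most three signs. *)
have h1 : (i == j) && (k' == l) -> g j = g i /\ g l = g k'.
  by case/andP => /eqP-> /eqP->.
have h2 : (i == l) && (k' == j) -> g j = g k' /\ g l = g i.
  by case/andP => /eqP-> /eqP->.
have h3 : (k' == rev_ord i) && (l == rev_ord j) -> g k' = g i /\ g l = g j.
  by case/andP => /eqP-> /eqP->; rewrite !g_rev.
move: h1 h2 h3; rewrite ek ez eA eB.
case: (_ && _) => [/(_ isT)[-> ->]|_];
case: (_ && _) => [/(_ isT)[e f]|_]; [rewrite ?e ?f; clear e f| |
  rewrite ?e ?f; clear e f|];
(case: (_ && _) => [/(_ isT)[e f]|_]; [rewrite ?e ?f; clear e f|]);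
rewrite ?mulr1n ?mulr0n; try ring.
all: case: (g_sign i) (g_sign k') (g_sign j) => [] ei [] ek' [] ej.
all: by rewrite ?ei ?ek' ?ej; ring.
Qed.

(** Here u = w + c and v = - w + c with w = 1/x. Against Q on the right, P exchanges an index with
    its opposite and Q produces the trace, so each index gives one scalar equation; 2 c = 2 d + 1 is
    what balances the trace. *)
Lemma fusion_gmat (c x : C) :
  2%:R * c = 2%:R * d + 1 ->
  let k := 2%:R * d + 1 in
  let A := - x - x in
  let z := - (x * x) in
  rmat N (A * (A - k * z)) (z * (A - k * z)) (z * A)
    *m first (gmat (1 + c * x) (d * x)) *m contraction =
  (2%:R * (x * x) * (2%:R - x) * (1 + c * x)) *:
    (second (gmat (1 - c * x) (- (d * x))) *m contraction).
Proof.
move=> ck k A z; apply: entry2P => i k' j l.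
rewrite entry2_Mcontraction entry2Z entry2_second_gmatM entry2_contraction.
under eq_bigr => s _ do rewrite entry2_Mfirst_gmat.
rewrite sum_rmatr trace_gmat; case: (k' =P rev_ord i) => [->|_] /=; last first.
  by rewrite mulr0n mul0rn !mulr0.
rewrite mulr1n -[_ *+ (l == _)]mulr_natr !mulrA; congr (_ * _).
rewrite g_rev; apply/eqP; rewrite -subr_eq0.
(* The cofactor of 2 c - (2 d + 1) in the difference of the two sides is given explicitly, since c
   cannot be solved for in a ring where 2 may not be invertible. *)
have H : forall t u, t - u = (g i * (x * x * x) * (2%:R - x) * (1 + c * x)
    + d * (x * x * x * x) * (2%:R + x)) * (2%:R * c - (2%:R * d + 1)) ->
    t - u == 0 :> C.
  by move=> t u ->; rewrite ck subrr mulr0.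
by apply: H; rewrite /k /A /z; case: (g_sign i) => ->; ring.
Qed.
End ScalarSolution.

(** * Rings of formal series *)

Section TriangularSums.
Variable V : nmodType.

Lemma sum_tail (F : nat -> V) n l : (l <= n)%N ->
  \sum_(k < (n - l).+1) F k = \sum_(k < n.+1 | (l + k <= n)%N) F k.
Proof.
move=> ln; rewrite (big_ord_widen n.+1) ?ltnS ?leq_subr //.
by apply: eq_bigl => k; rewrite ltnS leq_subRL.
Qed.

Lemma sum_exchange (F : nat -> nat -> V) n :
  \sum_(l < n.+1) \sum_(k < (n - l).+1) F l k =
  \sum_(k < n.+1) \sum_(l < (n - k).+1) F l k.
Proof.
under eq_bigr => l _ do rewrite (sum_tail (F l)) -1?ltnS //.
under [RHS]eq_bigr => k _ do rewrite (sum_tail (F^~ k)) -1?ltnS //.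
rewrite (exchange_big_dep xpredT) //=; apply: eq_bigr => k _.
by apply: eq_bigl => l; rewrite addnC.
Qed.

Lemma sum_from (G : nat -> V) n j : (j <= n)%N ->
  \sum_(i < n.+1 | (j <= i)%N) G i = \sum_(k < (n - j).+1) G (j + k)%N.
Proof.
move=> jn; rewrite -(big_mkord (leq j) G) (@big_cat_nat _ _ _ j) ?leqW //=.
rewrite big1_seq ?add0r => [|i]; last first.
  rewrite mem_index_iota => /andP[ji /andP[_ ij]].
  by rewrite leqNgt ij in ji.
rewrite -{1}[j]add0n big_addn subSn // big_mkord.
by apply: eq_big => [i|i _]; rewrite ?leq_addl // addnC.
Qed.

(** Both sides run over the triples of naturals with sum n: this is the associativity of the Cauchy
    product. *)
Lemma sum_triangle (F : nat -> nat -> nat -> V) n :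
  \sum_(i < n.+1) \sum_(j < i.+1) F j (i - j)%N (n - i)%N =
  \sum_(j < n.+1) \sum_(k < (n - j).+1) F j k (n - j - k)%N.
Proof.
transitivity (\sum_(j < n.+1) \sum_(i < n.+1 | (j <= i)%N)
    F j (i - j)%N (n - i)%N).
  rewrite (exchange_big_dep xpredT) //=; apply: eq_bigr => i _.
  rewrite (big_ord_widen n.+1 (fun j => F j (i - j)%N (n - i)%N)) //.
apply: eq_bigr => j _; have jn : (j <= n)%N by rewrite -ltnS.
rewrite (sum_from (fun i => F j (i - j)%N (n - i)%N)) //.
by apply: eq_bigr => k _; rewrite addnC addnK addnC subnDA.
Qed.

End TriangularSums.

(* Formal power series in one variable, as a ring under the Cauchy product. *)
Definition ser (A : Type) : Type := nat -> A.

HB.instance Definition _ (A : Type) := gen_eqMixin (ser A).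
HB.instance Definition _ (A : Type) := gen_choiceMixin (ser A).

Section SeriesZmodule.
Variable A : zmodType.
Implicit Types f g h : ser A.

Let add f g : ser A := fun n => f n + g n.
Let opp f : ser A := fun n => - f n.
Let zero : ser A := fun=> 0.

Let addA : associative add.
Proof. by move=> f g h; apply/funext => n; apply: addrA. Qed.
Let addC : commutative add.
Proof. by move=> f g; apply/funext => n; apply: addrC. Qed.
Let add0 : left_id zero add.
Proof. by move=> f; apply/funext => n; apply: add0r. Qed.
Let addN : left_inverse zero opp add.
Proof. by move=> f; apply/funext => n; apply: addNr. Qed.

HB.instance Definition _ := GRing.isZmodule.Build (ser A) addA addC add0 addN.

Lemma serDE f g n : (f + g) n = f n + g n. Proof. by []. Qed.
Lemma serNE f n : (- f) n = - f n. Proof. by []. Qed.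
Lemma serBE f g n : (f - g) n = f n - g n. Proof. by []. Qed.

Lemma ser_sumE I (r : seq I) (P : pred I) (F : I -> ser A) n :
  (\sum_(i <- r | P i) F i) n = \sum_(i <- r | P i) F i n.
Proof. by apply: (big_morph (fun f : ser A => f n)). Qed.

Lemma serMnE f m n : (f *+ m) n = f n *+ m.
Proof. by elim: m => // m IH; rewrite !mulrS serDE IH. Qed.

End SeriesZmodule.

Section SeriesRing.
Variable A : nzRingType.
Implicit Types f g h : ser A.

Let mul f g : ser A := fps_mul f g.
Let one : ser A := @fps_one A.

Let mulA : associative mul.
Proof.
move=> f g h; apply/funext => n; rewrite /mul /fps_mul.
under [RHS]eq_bigr => i _ do rewrite mulr_suml.
rewrite (sum_triangle (fun j k l => f j * g k * h l)).
by apply: eq_bigr => j _; rewrite mulr_sumr; apply: eq_bigr => k _; rewrite mulrA.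
Qed.
Let mul1 : left_id one mul.
Proof.
move=> f; apply/funext => n; rewrite /mul /fps_mul big_ord_recl /= mul1r subn0.
by rewrite big1 ?addr0 // => i _; rewrite mul0r.
Qed.
Let mulx1 : right_id one mul.
Proof.
move=> f; apply/funext => n; rewrite /mul /fps_mul big_ord_recr /= subnn mulr1.
rewrite big1 ?add0r // => i _; rewrite /one /fps_one.
by rewrite -[(_ - _ == 0)%N]negbK -lt0n subn_gt0 ltn_ord mulr0.
Qed.
Let mulDl : left_distributive mul +%R.
Proof.
move=> f g h; apply/funext => n; rewrite /mul /fps_mul serDE -big_split.
by apply: eq_bigr => i _; rewrite serDE mulrDl.
Qed.
Let mulDr : right_distributive mul +%R.
Proof.
move=> f g h; apply/funext => n; rewrite /mul /fps_mul serDE -big_split.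
by apply: eq_bigr => i _; rewrite serDE mulrDr.
Qed.
Let one_neq0 : one != 0.
Proof.
by apply/eqP => /(congr1 (fun f : ser A => f 0%N)) /eqP; rewrite oner_eq0.
Qed.

HB.instance Definition _ := GRing.Zmodule_isNzRing.Build (ser A)
  mulA mul1 mulx1 mulDl mulDr one_neq0.

Lemma serME f g n : (f * g) n = \sum_(k < n.+1) f k * g (n - k)%N.
Proof. by []. Qed.

Lemma ser1E n : (1 : ser A) n = (n == 0%N)%:R. Proof. by []. Qed.

Lemma serM0 f g : (f * g) 0%N = f 0%N * g 0%N.
Proof. by rewrite serME big_ord_recl big_ord0 addr0. Qed.

Definition serC (a : A) : ser A := fun n => a *+ (n == 0%N).

Lemma serCM a f n : (serC a * f) n = a * f n.
Proof.
rewrite serME big_ord_recl /= big1 ?addr0 ?subn0 // => i _.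
by rewrite /serC mulr0n mul0r.
Qed.

Lemma serMC a f n : (f * serC a) n = f n * a.
Proof.
rewrite serME big_ord_recr /= big1 ?add0r ?subnn // => i _.
by rewrite /serC -[(_ - _ == 0)%N]negbK -lt0n subn_gt0 ltn_ord mulr0.
Qed.

Lemma serC_is_zmod : zmod_morphism serC.
Proof. by move=> a b; apply/funext => n; rewrite /serC mulrnBl. Qed.

Lemma serC_is_monoid : monoid_morphism serC.
Proof.
by split=> // a b; apply/funext => n; rewrite serCM /serC mulrnAr.
Qed.

HB.instance Definition _ := GRing.isZmodMorphism.Build A (ser A) serC
  serC_is_zmod.
HB.instance Definition _ := GRing.isMonoidMorphism.Build A (ser A) serC
  serC_is_monoid.

Definition serX : ser A := fun n => (n == 1%N)%:R.

Lemma serXM0 f : (serX * f) 0%N = 0.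
Proof. by rewrite serM0 mul0r. Qed.

Lemma serXMS f n : (serX * f) n.+1 = f n.
Proof.
rewrite serME !big_ord_recl /= mul0r add0r mul1r subSS subn0.
by rewrite big1 ?addr0 // => i _; rewrite mul0r.
Qed.

Lemma central_serX : central serX.
Proof.
move=> f; apply/funext => -[|n]; first by rewrite !serM0 mul0r mulr0.
rewrite serXMS serME big_ord_recr /= subnn mulr0 addr0.
rewrite big_ord_recr /= subSn // subnn mulr1 big1 ?add0r // => i _.
by rewrite /serX subSn ?(ltnW (ltn_ord _)) // eqSS subn_eq0 leqNgt ltn_ord mulr0.
Qed.

Lemma serX_reg f : serX * f = 0 -> f = 0.
Proof.
by move=> e; apply/funext => n; rewrite -serXMS e.
Qed.

Lemma central_serC a : central a -> central (serC a).
Proof. by move=> ca f; apply/funext => n; rewrite serCM serMC ca. Qed.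

Definition ser_neg f : ser A := fun n => (-1) ^+ n * f n.

Lemma ser_neg_is_zmod : zmod_morphism ser_neg.
Proof. by move=> f g; apply/funext => n; rewrite /ser_neg mulrBr. Qed.

Lemma ser_neg_is_monoid : monoid_morphism ser_neg.
Proof.
split=> [|f g]; apply/funext => n.
  by case: n => [|n]; rewrite /ser_neg ?mul1r ?mulr0.
rewrite /ser_neg !serME mulr_sumr; apply: eq_bigr => i _.
rewrite -{1}(subnKC (leq_ord i)) exprD.
by rewrite -!mulrA; congr (_ * _); rewrite !mulrA commr_sign.
Qed.

HB.instance Definition _ := GRing.isZmodMorphism.Build (ser A) (ser A) ser_neg
  ser_neg_is_zmod.
HB.instance Definition _ := GRing.isMonoidMorphism.Build (ser A) (ser A) ser_neg
  ser_neg_is_monoid.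

Lemma ser_negK : involutive ser_neg.
Proof.
by move=> f; apply/funext => n; rewrite /ser_neg signrMK.
Qed.

Lemma ser_negX : ser_neg serX = - serX.
Proof.
apply/funext => -[|[|n]]; rewrite /ser_neg serNE /serX /=.
- by rewrite mulr0 oppr0.
- by rewrite expr1 mulr1.
by rewrite mulr0 oppr0.
Qed.

Lemma ser_negC a : ser_neg (serC a) = serC a.
Proof.
apply/funext => -[|n]; rewrite /ser_neg /serC /= ?mul1r //.
by rewrite mulr0n mulr0.
Qed.

End SeriesRing.

Arguments serX {A}.

Section SeriesComRing.
Variable A : comNzRingType.

Let mulC : commutative (@GRing.mul (ser A)).
Proof.
move=> f g; apply/funext => n; rewrite !serME (reindex_inj rev_ord_inj) /=.
apply: eq_bigr => i _; rewrite subSS mulrC subKn //.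
by rewrite -ltnS.
Qed.

HB.instance Definition _ := GRing.PzRing_hasCommutativeMul.Build (ser A) mulC.

End SeriesComRing.

Section SeriesMap.
Variables (A B : nzRingType) (phi : {rmorphism A -> B}).

Definition ser_map (f : ser A) : ser B := fun n => phi (f n).

Lemma ser_map_is_zmod : zmod_morphism ser_map.
Proof. by move=> f g; apply/funext => n; rewrite /ser_map serBE rmorphB. Qed.

Lemma ser_map_is_monoid : monoid_morphism ser_map.
Proof.
split=> [|f g]; apply/funext => n; first by rewrite /ser_map ser1E rmorph_nat.
rewrite /ser_map !serME rmorph_sum; apply: eq_bigr => i _.
by rewrite rmorphM.
Qed.

HB.instance Definition _ := GRing.isZmodMorphism.Build (ser A) (ser B) ser_map
  ser_map_is_zmod.
HB.instance Definition _ := GRing.isMonoidMorphism.Build (ser A) (ser B) ser_map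
  ser_map_is_monoid.

Lemma ser_mapX : ser_map serX = serX.
Proof. by apply/funext => n; rewrite /ser_map rmorph_nat. Qed.

Lemma ser_mapC a : ser_map (serC a) = serC (phi a).
Proof. by apply/funext => n; rewrite /ser_map /serC rmorphMn. Qed.

Lemma ser_map_neg f : ser_map (ser_neg f) = ser_neg (ser_map f).
Proof.
by apply/funext => n; rewrite /ser_map /ser_neg rmorphM rmorph_sign.
Qed.

Lemma ser_map_inj : injective phi -> injective ser_map.
Proof. by move=> inj f g /funeqP e; apply/funext => n; apply: inj; apply: e. Qed.

End SeriesMap.

(* In [ser (ser A)] the inner variable is 1/u and the outer one 1/v. *)
Section TwoVariables.
Variable A : nzRingType.
Implicit Types f g : ser (ser A).

Definition serx : ser (ser A) := serC serX.
Definition sery : ser (ser A) := serX.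

Lemma central_serx : central serx.
Proof. by apply: central_serC; apply: central_serX. Qed.

Lemma central_sery : central sery.
Proof. exact: central_serX. Qed.

Lemma ser2ME f g r s : (f * g) s r =
  \sum_(j < s.+1) \sum_(i < r.+1) f j i * g (s - j)%N (r - i)%N.
Proof. by rewrite serME ser_sumE. Qed.

Definition ser_swap f : ser (ser A) := fun s r => f r s.

Lemma ser_swap_is_zmod : zmod_morphism ser_swap.
Proof. by []. Qed.

Lemma ser_swap_is_monoid : monoid_morphism ser_swap.
Proof.
split=> [|f g]; apply/funext => s; apply/funext => r; rewrite /ser_swap.
  by case: r s => [|r] [|s].
by rewrite !ser2ME exchange_big.
Qed.

HB.instance Definition _ := GRing.isZmodMorphism.Build (ser (ser A))
  (ser (ser A)) ser_swap ser_swap_is_zmod.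
HB.instance Definition _ := GRing.isMonoidMorphism.Build (ser (ser A))
  (ser (ser A)) ser_swap ser_swap_is_monoid.

(** The substitution y = x. It is multiplicative even over a noncommutative A because the variables
    are central. *)
Definition ser_diag f : ser A := fun n => \sum_(i < n.+1) f i (n - i)%N.

Lemma ser_diag_is_zmod : zmod_morphism ser_diag.
Proof. by move=> f g; apply/funext => n; rewrite serBE -sumrB. Qed.

Lemma ser_diag_is_monoid : monoid_morphism ser_diag.
Proof.
split=> [|f g]; apply/funext => n; rewrite /ser_diag.
  rewrite big_ord_recl big1 ?addr0 ?subn0 // => i _.
under eq_bigr => i _ do rewrite ser2ME.
rewrite (sum_triangle (fun j l m => \sum_(k < m.+1) f j k * g l (m - k)%N)).
rewrite serME; under [RHS]eq_bigr => m _ do rewrite mulr_suml.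
rewrite (sum_triangle (fun j k m =>
  f j k * \sum_(l < m.+1) g l (m - l)%N)).
apply: eq_bigr => j _; set m := (n - j)%N.
rewrite (sum_exchange (fun l k => f j k * g l (m - l - k)%N)).
apply: eq_bigr => k _; rewrite mulr_sumr; apply: eq_bigr => l _.
by rewrite subnAC.
Qed.

HB.instance Definition _ := GRing.isZmodMorphism.Build (ser (ser A))
  (ser A) ser_diag ser_diag_is_zmod.
HB.instance Definition _ := GRing.isMonoidMorphism.Build (ser (ser A))
  (ser A) ser_diag ser_diag_is_monoid.

Lemma ser_swapC (f : ser A) : ser_swap (serC f) = ser_map (@serC A) f.
Proof.
apply/funext => s; apply/funext => r.
by rewrite /ser_swap /serC serMnE /ser_map.
Qed.

Lemma ser_swapK : involutive ser_swap.
Proof. by []. Qed.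

Lemma ser_diagC (f : ser A) : ser_diag (serC f) = f.
Proof.
apply/funext => n; rewrite /ser_diag big_ord_recl /= subn0 big1 ?addr0 //.
Qed.

Lemma ser_diag_map (f : ser A) : ser_diag (ser_map (@serC A) f) = f.
Proof.
apply/funext => n; rewrite /ser_diag big_ord_recr /= subnn big1 ?add0r //.
move=> i _; rewrite /ser_map /serC -[(_ - _ == 0)%N]negbK -lt0n subn_gt0.
by rewrite ltn_ord mulr0n.
Qed.

End TwoVariables.

Arguments serx {A}.
Arguments sery {A}.

Lemma Pmx_flip (F : fieldType) N : Pmx F N = flip.
Proof.
apply: entry2P => i k j l; rewrite entry2_flip.
rewrite /entry2 /Pmx summxE (bigD1 i) //= summxE (bigD1 k) //= tensmxE !mxE.
rewrite !eqxx /= big1 ?addr0 => [|b bk]; last first.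
  by rewrite tensmxE !mxE [k == b]eq_sym (negbTE bk) mulr0.
rewrite big1 ?addr0 => [|a ai]; last first.
  rewrite summxE big1 // => b _.
  by rewrite tensmxE !mxE [i == a]eq_sym (negbTE ai) mul0r.
by rewrite -natrM mulnb [l == i]eq_sym [j == k]eq_sym andbC.
Qed.

Lemma Qmx_contraction (F : fieldType) N : Qmx F N = contraction.
Proof.
apply: entry2P => i k j l; rewrite entry2_contraction.
rewrite /entry2 /Qmx summxE (bigD1 l) //= summxE (bigD1 k) //= tensmxE !mxE.
rewrite !eqxx /= big1 ?addr0 => [|b bk]; last first.
  by rewrite tensmxE !mxE [k == b]eq_sym (negbTE bk) mulr0.
rewrite big1 ?addr0 => [|a ai]; last first.
  rewrite summxE big1 // => b _.
  by rewrite tensmxE !mxE [l == a]eq_sym (negbTE ai) andbF mulr0.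
by rewrite mulr1 andbC [k == _]eq_sym [l == _]eq_sym.
Qed.

(** * The RTT relation in power series *)

Section TwoSidedCoefficients.
Variables (F : fieldType) (A : algType F).
Local Notation S2 := (ser (ser A)).

Definition serK (c : F) : S2 := serC (serC (c%:A)).

Lemma central_scalar (c : F) : central (c%:A : A).
Proof. by move=> z; rewrite -scalerAl mul1r -scalerAr mulr1. Qed.

Lemma central_serK c : central (serK c).
Proof. by do 2! apply: central_serC; apply: central_scalar. Qed.

Lemma serxME (f : S2) s r : ((serx : S2) * f) s r = (serX * f s) r.
Proof. by rewrite serCM. Qed.

(** The coefficient at x^r y^s, extended by zero to negative exponents in the manner of
    [two_sided]. *)
Definition coef2 m (Z : 'M[S2]_m) (r s : int) : 'M[A]_m :=
  two_sided (fun r' s' => map_mx (fun f : S2 => f s' r') Z) r s.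

Lemma coef2D m (Z W : 'M[S2]_m) r s :
  coef2 (Z + W) r s = coef2 Z r s + coef2 W r s.
Proof.
case: r s => [r|r] [s|s] /=; rewrite ?addr0 //.
by apply/matrixP => i j; rewrite !mxE.
Qed.

Lemma coef2N m (Z : 'M[S2]_m) r s : coef2 (- Z) r s = - coef2 Z r s.
Proof.
case: r s => [r|r] [s|s] /=; rewrite ?oppr0 //.
by apply/matrixP => i j; rewrite !mxE.
Qed.

Lemma coef2x m (Z : 'M[S2]_m) r s : coef2 (serx *: Z) (r + 1) s = coef2 Z r s.
Proof.
case: s => s; last by case: (r + 1); case: r.
case: r => r; first by apply/matrixP => i j; rewrite addrC !mxE serxME serXMS.
case: r => [|r]; last by [].
by apply/matrixP => i j; rewrite !mxE serxME serXM0.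
Qed.

Lemma coef2y m (Z : 'M[S2]_m) r s : coef2 (sery *: Z) r (s + 1) = coef2 Z r s.
Proof.
case: r => r; last by [].
case: s => s; first by apply/matrixP => i j; rewrite addrC !mxE serXMS.
case: s => [|s]; last by [].
by apply/matrixP => i j; rewrite !mxE serXM0.
Qed.

Lemma coef2K m c (Z : 'M[S2]_m) r s :
  coef2 (serK c *: Z) r s = c%:A *: coef2 Z r s.
Proof.
case: r s => [r|r] [s|s] /=; rewrite ?scaler0 //.
by apply/matrixP => i j; rewrite !mxE !serCM.
Qed.

(** The offset by two in each exponent is the one produced by applying [mul_uv] twice; as r and s
    range over all integers, every coefficient is reached. *)
Lemma coef2_inj m (Z W : 'M[S2]_m) :
  (forall r s, coef2 Z (r + 1 + 1) (s + 1 + 1) = coef2 W (r + 1 + 1) (s + 1 + 1)) ->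
  Z = W.
Proof.
move=> e; apply/matrixP => i j; apply/funext => s; apply/funext => r.
have := e (Posz r - 1 - 1) (Posz s - 1 - 1); rewrite !subrK.
by move=> /matrixP/(_ i j); rewrite !mxE.
Qed.

Lemma coef2_mulmxl m (M : 'M[F]_m) (Z : 'M[S2]_m) r s :
  coef2 (map_mx (fun c => serK c) M *m Z) r s = scal_mx A M *m coef2 Z r s.
Proof.
case: r s => [r|r] [s|s] /=; rewrite ?mulmx0 //.
apply/matrixP => i j; rewrite !mxE !ser_sumE; apply: eq_bigr => k _.
by rewrite !mxE !serCM.
Qed.

Lemma coef2_mulmxr m (M : 'M[F]_m) (Z : 'M[S2]_m) r s :
  coef2 (Z *m map_mx (fun c => serK c) M) r s = coef2 Z r s *m scal_mx A M.
Proof.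
case: r s => [r|r] [s|s] /=; rewrite ?mul0mx //.
apply/matrixP => i j; rewrite !mxE !ser_sumE; apply: eq_bigr => k _.
by rewrite !mxE !serMC.
Qed.

(** Since u - v - c = (y - x - c x y) / (x y), multiplying by it amounts to multiplying by the
    numerator and reading one exponent higher in x and in y. *)
Lemma mul_uv_coef2 m c (Z : 'M[S2]_m) r s :
  mul_uv c (coef2 Z) r s =
  coef2 ((sery - serx - serK c * serx * sery) *: Z) (r + 1) (s + 1).
Proof.
rewrite !scalerBl -!scalerA 2!coef2D 2!coef2N coef2K.
have ey := coef2y Z (r + 1) s; have ex := coef2x Z r (s + 1).
have exy := coef2x (sery *: Z) r (s + 1); rewrite coef2y in exy.
rewrite /mul_uv -ey -ex -exy. reflexivity.
Qed.

Lemma mul_uv_ext m c (H H' : int -> int -> 'M[A]_m) :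
  (forall r s, H r s = H' r s) -> forall r s, mul_uv c H r s = mul_uv c H' r s.
Proof. by move=> e r s; rewrite /mul_uv !e. Qed.

Lemma serK_flip N : map_mx (fun c => serK c) (Pmx F N) = flip.
Proof.
apply/matrixP => p q; rewrite Pmx_flip !mxE /serK.
by case: (_ && _); rewrite ?scale1r ?scale0r ?rmorph1 ?rmorph0.
Qed.

Lemma serK_contraction N : map_mx (fun c => serK c) (Qmx F N) = contraction.
Proof.
apply/matrixP => p q; rewrite Qmx_contraction !mxE /serK.
by case: (_ && _); rewrite ?scale1r ?scale0r ?rmorph1 ?rmorph0.
Qed.

Variables (N : nat) (T : nat -> 'M[A]_N).

Definition ser_mx : 'M[ser A]_N := \matrix_(i, j) (fun n => T n i j : A).

Definition ser_mx1 : 'M[S2]_N := map_mx (@serC (ser A)) ser_mx.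
Definition ser_mx2 : 'M[S2]_N := map_mx (ser_map (@serC A)) ser_mx.

Lemma T1T2_coef2 r s : T1T2 T r s = coef2 (first ser_mx1 *m second ser_mx2) r s.
Proof.
case: r s => [r|r] [s|s] //=; apply: entry2P => i k j l.
rewrite [LHS]entry2_first_second /entry2 mxE -/(entry2 _ i k j l).
by rewrite entry2_first_second !mxE serCM serMC.
Qed.

Lemma T2T1_coef2 r s : T2T1 T r s = coef2 (second ser_mx2 *m first ser_mx1) r s.
Proof.
case: r s => [r|r] [s|s] //=; apply: entry2P => i k j l.
rewrite [LHS]entry2_second_first /entry2 mxE -/(entry2 _ i k j l).
by rewrite entry2_second_first !mxE serMC serCM.
Qed.

Let k := serK (kappa F N).
Let z : S2 := serx * sery.
Let D : S2 := sery - serx.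

(* With [x = u^-1] and [y = v^-1] one has [D = x y (u - v)], so the three scalars
   are those of [(u - v) (u - v - kappa) R(u - v)] times [(x y)^2]. *)
Definition rtt_series :=
  rtt (D * (D - k * z)) (z * (D - k * z)) (z * D) ser_mx1 ser_mx2.

Let cz : central z.
Proof. by move=> t; rewrite /z -mulrA central_sery mulrA (@central_serx A) -mulrA. Qed.
Let cD : central D.
Proof. by move=> t; rewrite mulrBl mulrBr central_serx central_sery. Qed.
Let ckz : central (k * z).
Proof. by move=> t; rewrite -mulrA cz mulrA central_serK -mulrA. Qed.
Let cDk : central (D - k * z).
Proof. by move=> t; rewrite mulrBl mulrBr ckz cD. Qed.
Let centralM (R : nzRingType) (a b : R) : central a -> central b -> central (a * b).
Proof. by move=> ca cb t; rewrite -mulrA cb mulrA ca -mulrA. Qed.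

Lemma rtt_seriesP :
  (forall r s, rtt_lhs T r s = rtt_rhs T r s) <-> rtt_series.
Proof.
have K0 : serK 0 = 0 by rewrite /serK scale0r !rmorph0.
set Z := first ser_mx1 *m second ser_mx2.
set W := second ser_mx2 *m first ser_mx1.
(* The P and Q terms undergo [mul_uv] only once; an extra factor z = x y brings them to the same
   offset as the scalar term. *)
have gen (H : int -> int -> 'M[A]_(N * N)) V :
    (forall r s, H r s = coef2 V r s) ->
    [/\ forall r s, mul_uv 0 (mul_uv (kappa F N) H) r s =
          coef2 ((D * (D - k * z)) *: V) (r + 1 + 1) (s + 1 + 1),
        forall r s, mul_uv (kappa F N) H r s =
          coef2 ((z * (D - k * z)) *: V) (r + 1 + 1) (s + 1 + 1) &
        forall r s, mul_uv 0 H r s =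
          coef2 ((z * D) *: V) (r + 1 + 1) (s + 1 + 1)].
  move=> eH.
  have e c r s : mul_uv c H r s =
      coef2 ((D - serK c * z) *: V) (r + 1) (s + 1).
    by rewrite (mul_uv_ext _ eH) mul_uv_coef2 mulrA.
  have e0 (W' : 'M[S2]_(N * N)) r s :
      mul_uv 0 (coef2 W') r s = coef2 (D *: W') (r + 1) (s + 1).
    by rewrite mul_uv_coef2 K0 !mul0r subr0.
  split=> r s.
  - rewrite (mul_uv_ext 0 (e (kappa F N))).
    by rewrite -scalerA -e0.
  - have ex := coef2x (sery *: ((D - k * z) *: V)) (r + 1) (s + 1 + 1).
    have ey := coef2y ((D - k * z) *: V) (r + 1) (s + 1).
    rewrite e; apply: etrans (esym ey) _; apply: etrans (esym ex) _.
    by rewrite !scalerA.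
  have ex := coef2x (sery *: (D *: V)) (r + 1) (s + 1 + 1).
  have ey := coef2y (D *: V) (r + 1) (s + 1).
  rewrite e K0 mul0r subr0; apply: etrans (esym ey) _.
  apply: etrans (esym ex) _; by rewrite !scalerA.
have c0 : central (D * (D - k * z)) by exact: centralM.
have cP : central (z * (D - k * z)) by exact: centralM.
have cQ : central (z * D) by exact: centralM.
have [l0 lP lQ] := gen _ _ T1T2_coef2; have [r0 rP rQ] := gen _ _ T2T1_coef2.
have eL r s : rtt_lhs T r s =
    coef2 (rmat N (D * (D - k * z)) (z * (D - k * z)) (z * D) *m Z)
      (r + 1 + 1) (s + 1 + 1).
  rewrite /rtt_lhs l0 lP lQ rmatMl !(coef2D, coef2N).
  rewrite -!coef2_mulmxl serK_flip serK_contraction.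
  by rewrite !mulmxZc.
have eR r s : rtt_rhs T r s =
    coef2 (W *m rmat N (D * (D - k * z)) (z * (D - k * z)) (z * D))
      (r + 1 + 1) (s + 1 + 1).
  have hP V r' s' : coef2 V r' s' *m scal_mx A (Pmx F N) =
      coef2 (V *m flip) r' s' by rewrite -serK_flip coef2_mulmxr.
  have hQ V r' s' : coef2 V r' s' *m scal_mx A (Qmx F N) =
      coef2 (V *m contraction) r' s' by rewrite -serK_contraction coef2_mulmxr.
  rewrite rmatMr // 2!coef2D coef2N /rtt_rhs r0 rP rQ.
  congr (_ - _ + _); first by rewrite hP -scalemxAl.
  by rewrite hQ -scalemxAl.
split.
  move=> e; rewrite /rtt_series; unfold rtt.
  apply: etrans (esym (mulmxA _ _ _)) _.
  apply: coef2_inj => r s.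
  exact: etrans (esym (eL r s)) (etrans (e r s) (eR r s)).
move=> e r s; apply: etrans (eL r s) (etrans _ (esym (eR r s))).
exact: (congr1 (fun M => coef2 M (r + 1 + 1) (s + 1 + 1))
  (etrans (mulmxA _ _ _) e)).
Qed.

End TwoSidedCoefficients.

Lemma map_ttr (L L' : nzRingType) (f : {rmorphism L -> L'}) N (X : 'M[L]_N) :
  map_mx f (ttr X) = ttr (map_mx f X).
Proof. by apply/matrixP => i j; rewrite !mxE. Qed.

Section SignMatrix.
Variables (F : numFieldType) (N : nat).
Hypothesis N2 : (2 <= N)%N.

Definition gsign (i : 'I_N) : F :=
  if ((i : nat) == 0) || ((i : nat) == N.-1) then -1 else 1.

Lemma Gmx_gsign i j : Gmx F N i j = gsign i *+ (i == j).
Proof.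
rewrite /Gmx /Ediag /gsign !mxE.
case: (i =P j) => [->|ij].
  case: (j =P 0 :> nat) => [->|_] /=.
    have -> : (0 == N.-1) = false by case: N N2 => [|[|]].
    by rewrite !(mulr0, mulr1, mulr1n, subr0); ring.
  by case: eqP => _ /=; rewrite !(mulr0, mulr1, mulr1n, subr0); ring.
rewrite mulr0n; have dis k : ((i : nat) == k) && ((j : nat) == k) = false.
  by apply/negP => /andP[/eqP ik /eqP jk]; apply/ij/val_inj; rewrite /= ik.
by rewrite !dis !mulr0 !subr0.
Qed.

Lemma gsign_pm i : gsign i = 1 \/ gsign i = -1.
Proof. by rewrite /gsign; case: ifP => _; [right|left]. Qed.

Lemma gsign_rev i : gsign (rev_ord i) = gsign i.
Proof.
rewrite /gsign /=; congr (if _ then _ else _); rewrite orbC.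
by congr (_ || _); apply/eqP/eqP; have := ltn_ord i; lia.
Qed.

Lemma dpar_kappa : kappa F N = 2%:R * dpar F N + 1.
Proof.
by rewrite /kappa /dpar; field.
Qed.

Lemma dparN : N%:R = 4%:R * dpar F N + 4%:R.
Proof.
by rewrite /dpar; field.
Qed.

Lemma gsign_trace : \sum_i gsign i = 4%:R * dpar F N.
Proof.
have -> : 4%:R * dpar F N = N%:R - 4%:R by rewrite [N%:R]dparN; ring.
have N0 : (0 < N)%N by apply: leq_trans N2.
have i1P : (N.-1 < N)%N by rewrite prednK.
pose i0 := Ordinal N0; pose i1 := Ordinal i1P.
have i10 : i1 != i0 by rewrite -val_eqE /=; case: N N2 => [|[|]].
have -> : \sum_i gsign i = \sum_i ((1 : F) - 2%:R *+ (i == i0) - 2%:R *+ (i == i1)).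
  apply: eq_bigr => i _; rewrite /gsign -!val_eqE /=.
  case: (i =P 0 :> nat) => [->|_] /=.
    have -> : (0 == N.-1) = false by case: N N2 => [|[|]].
    by rewrite mulr1n mulr0n; ring.
  by case: eqP => _; rewrite ?mulr1n ?mulr0n; ring.
rewrite !sumrB sumr_const card_ord (bigD1 i0) //= big1 => [|i]; last first.
  by case: eqP.
rewrite [X in _ - X](bigD1 i1) //= big1 => [|i]; last by case: eqP.
by rewrite !eqxx !mulr1n; ring.
Qed.

End SignMatrix.

Section ScalarSeries.
Variables (F : fieldType) (A : algType F).

Definition ser_alg : {rmorphism ser F -> ser A} := ser_map (in_alg A).
Definition ser2_alg : {rmorphism ser (ser F) -> ser (ser A)} := ser_map ser_alg.

Lemma central_ser_alg a : central (ser_alg a).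
Proof.
move=> f; apply/funext => n; rewrite !serME (reindex_inj rev_ord_inj) /=.
apply: eq_bigr => i _; rewrite subSS subKn -1?ltnS //.
exact: central_scalar.
Qed.

Lemma central_ser2_alg a : central (ser2_alg a).
Proof.
move=> f; apply/funext => n; rewrite !serME (reindex_inj rev_ord_inj) /=.
apply: eq_bigr => i _; rewrite subSS subKn -1?ltnS //.
exact: central_ser_alg.
Qed.

Lemma ser2_algX : ser2_alg serx = serx.
Proof. by rewrite /serx [LHS]ser_mapC [X in serC X]ser_mapX. Qed.

Lemma ser2_algY : ser2_alg sery = sery.
Proof. exact: ser_mapX. Qed.

Lemma ser2_algC c : ser2_alg (serC (serC c)) = serK A c.
Proof. by rewrite [LHS]ser_mapC [X in serC X]ser_mapC. Qed.

End ScalarSeries.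

(** * Sign changes and exchange of the two variables *)

Section Substitutions.
Variable A : nzRingType.

Definition negx : {rmorphism ser (ser A) -> ser (ser A)} := ser_map (@ser_neg A).
Definition negy : {rmorphism ser (ser A) -> ser (ser A)} := @ser_neg (ser A).
Definition swapxy : {rmorphism ser (ser A) -> ser (ser A)} := @ser_swap A.
Definition inx : {rmorphism ser A -> ser (ser A)} := @serC (ser A).
Definition iny : {rmorphism ser A -> ser (ser A)} := ser_map (@serC A).

Lemma negx_inx f : negx (inx f) = inx (ser_neg f).
Proof. exact: ser_mapC. Qed.

Lemma negx_iny f : negx (iny f) = iny f.
Proof.
by apply/funext => s; apply: ser_negC.
Qed.

Lemma negy_inx f : negy (inx f) = inx f.
Proof. exact: ser_negC. Qed.

Lemma negy_iny f : negy (iny f) = iny (ser_neg f).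
Proof. by rewrite /negy /= -ser_map_neg. Qed.

Lemma swapxy_inx f : swapxy (inx f) = iny f.
Proof. exact: ser_swapC. Qed.

Lemma swapxy_iny f : swapxy (iny f) = inx f.
Proof. by rewrite -swapxy_inx; apply: ser_swapK. Qed.

Lemma serx_in : serx = inx serX. Proof. by []. Qed.
Lemma sery_in : sery = iny serX. Proof. by rewrite /iny /= ser_mapX. Qed.

End Substitutions.

Section SubstitutionScalars.
Variables (F : fieldType) (A : algType F).

Lemma negx_alg a : negx A (ser2_alg A a) = ser2_alg A (negx F a).
Proof.
apply/funext => s; apply/funext => r.
apply/esym/(etrans (rmorphM (in_alg A) ((-1) ^+ r) (a s r))).
by rewrite rmorph_sign.
Qed.

Lemma negy_alg a : negy A (ser2_alg A a) = ser2_alg A (negy F a).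
Proof. by rewrite /negy /= -ser_map_neg. Qed.

Lemma swapxy_alg a : swapxy A (ser2_alg A a) = ser2_alg A (swapxy F a).
Proof. by []. Qed.

Lemma inx_alg a : inx A (ser_alg A a) = ser2_alg A (inx F a).
Proof. by rewrite /inx /= [RHS]ser_mapC. Qed.

Lemma iny_alg a : iny A (ser_alg A a) = ser2_alg A (iny F a).
Proof.
apply/funext => s; apply/funext => r.
exact/esym/(rmorphMn (in_alg A) (r == 0)%N (a s)).
Qed.

End SubstitutionScalars.

(** * The reflection equation and fusion for S *)

Section ReflectionSeries.
Variables (F : numFieldType) (N : nat).
Hypothesis N2 : (2 <= N)%N.
Local Notation kap := (kappa F N).
Local Notation d := (dpar F N).
Local Notation C2 := (ser (ser F)).

Definition konst : {rmorphism F -> C2} := @serC (ser F) \o @serC F.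

(** R(t) at t = D/z, multiplied by z^2 t (t - kappa) = D (D - kappa z). *)
Definition rser (A : algType F) (D z : C2) : 'M[ser (ser A)]_(N * N) :=
  rmat N (ser2_alg A (D * (D - konst kap * z)))
    (ser2_alg A (z * (D - konst kap * z))) (ser2_alg A (z * D)).

(* [x] and [y] stand for the inverses of [w1 = u - kappa/2] and [w2 = v - kappa/2]:
   [dminus = x y (u - v)] and [dplus = x y (u + v)]. *)
Definition dminus : C2 := sery - serx.
Definition dplus : C2 := sery + serx + konst kap * (serx * sery).
Definition xy : C2 := serx * sery.

Definition rminus A := rser A dminus xy.
Definition rplus A := rser A dplus xy.

(* [(w + kappa/2) Gmx - d], divided by [w]: up to a scalar, G(u) in the variable
   [w = u - kappa/2]. *)
Definition gser : 'M[ser F]_N :=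
  gmat (fun i => serC (gsign F i)) (1 + serC (kap / 2%:R) * serX) (serC d * serX).

Lemma dminus_dplus_xy_map (f : {rmorphism C2 -> C2}) a b :
  f serx = a -> f sery = b -> (forall c, f (konst c) = konst c) ->
  [/\ f dminus = b - a, f dplus = b + a + konst kap * (a * b) & f xy = a * b].
Proof.
move=> fx fy fk; rewrite /dplus (rmorphB f) (rmorphD f (sery + serx)).
by rewrite (rmorphD f sery) !(rmorphM f) fk fx fy.
Qed.

Lemma negxX : negx F serx = - serx.
Proof. by rewrite serx_in negx_inx ser_negX rmorphN. Qed.
Lemma negxY : negx F sery = sery.
Proof. by rewrite sery_in negx_iny. Qed.
Lemma negxK c : negx F (konst c) = konst c.
Proof. by rewrite (negx_inx (serC c)) ser_negC. Qed.
Lemma negyX : negy F serx = serx.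
Proof. by rewrite serx_in negy_inx. Qed.
Lemma negyY : negy F sery = - sery.
Proof. by rewrite sery_in negy_iny ser_negX rmorphN. Qed.
Lemma negyK c : negy F (konst c) = konst c.
Proof. by rewrite (negy_inx (serC c)). Qed.
Lemma swapX : swapxy F serx = sery.
Proof. by rewrite serx_in swapxy_inx -sery_in. Qed.
Lemma swapY : swapxy F sery = serx.
Proof. by rewrite sery_in swapxy_iny. Qed.
Lemma swapK c : swapxy F (konst c) = konst c.
Proof. by rewrite (swapxy_inx (serC c)) /iny /= ser_mapC. Qed.

Lemma reflection_gser (A : algType F) :
  reflection (rminus A) (rplus A)
    (map_mx (inx A) (map_mx (ser_alg A) gser))
    (map_mx (iny A) (map_mx (ser_alg A) gser)).
Proof.
have g_sign (i : 'I_N) : konst (gsign F i) = 1 \/ konst (gsign F i) = -1.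
  by case: (gsign_pm F i) => ->; [left|right]; rewrite ?rmorphN rmorph1.
have g_rev (i : 'I_N) : konst (gsign F (rev_ord i)) = konst (gsign F i).
  by rewrite gsign_rev.
have g_tr : \sum_(i < N) konst (gsign F i) = 4%:R * konst d.
  by rewrite -rmorph_sum gsign_trace // rmorphM rmorph_nat.
have dN : N%:R = 4%:R * konst d + 4%:R.
  by rewrite -(rmorph_nat konst) dparN rmorphD rmorphM !rmorph_nat.
have ek : konst kap = 2%:R * konst d + 1.
  by rewrite dpar_kappa rmorphD rmorphM rmorph_nat rmorph1.
have ec : 2%:R * konst (kap / 2%:R) = konst kap.
  rewrite -(rmorph_nat konst) -rmorphM; congr (konst _).
  by rewrite mulrC divfK ?pnatr_eq0.
(* With p = x u = 1 + (kappa/2) x and q = y v, these are the A and B of [reflection_gmat]: the two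
   halves of kappa cancel in u - v and add up in u + v. *)
have eD : dminus = sery * (1 + konst (kap / 2%:R) * serx) -
    serx * (1 + konst (kap / 2%:R) * sery) by rewrite /dminus; ring.
have eB : dplus = sery * (1 + konst (kap / 2%:R) * serx) +
    serx * (1 + konst (kap / 2%:R) * sery) by rewrite /dplus -ec; ring.
have := reflection_gmat g_sign g_rev g_tr dN ek (erefl xy) eD eB.
move=> /(reflection_rmat_map (ser2_alg A)) h.
have eG (f : {rmorphism ser A -> ser (ser A)}) (f0 : {rmorphism ser F -> C2}) v :
    (forall a, f (ser_alg A a) = ser2_alg A (f0 a)) -> f0 serX = v ->
    (forall a, f0 (serC a) = konst a) ->
    map_mx f (map_mx (ser_alg A) gser) =
    map_mx (ser2_alg A) (gmat (fun i => konst (gsign F i))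
      (1 + konst (kap / 2%:R) * v) (konst d * v)).
  move=> ef fv fc; rewrite -map_mx_comp -[RHS]/(map_mx _ _) /gser.
  apply/matrixP => i j; rewrite !mxE /= ef; congr (ser2_alg A _).
  rewrite (rmorphMn f0) (rmorphB f0) (rmorphM f0) (rmorphD f0) (rmorph1 f0).
  by rewrite !(rmorphM f0) fv !fc.
have e1 := eG (inx A) (inx F) _ (@inx_alg _ _) (erefl _) (fun=> erefl _).
have e2 := eG (iny A) (iny F) _ (@iny_alg _ _) (esym (sery_in F))
  (fun a => ser_mapC _ a).
by rewrite /rminus /rplus /rser e1 e2; exact: h.
Qed.

End ReflectionSeries.

Section ReflectionOfS.
Variables (F : numFieldType) (N : nat).
Hypothesis N2 : (2 <= N)%N.
Variables (A : algType F) (T : nat -> 'M[A]_N).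
Hypothesis hT : rtt_series T.
Local Notation kap := (kappa F N).
Local Notation k2 := (konst F kap).
Local Notation phi := (ser2_alg A).
Local Notation Ts := (ser_mx T).
Local Notation Tn := (map_mx (@ser_neg A) Ts).

(** T(w) G(u) T^t(-w) in the variable w = u - kappa/2, that is S(u), up to the scalar (u - d)/w by
    which [gser] differs from G(u). *)
Definition Sser : 'M[ser A]_N := Ts *m map_mx (ser_alg A) (gser F N) *m ttr Tn.

Lemma rtt_scalars :
  let D := dminus F in let z := xy F in
  rtt (phi (D * (D - k2 * z))) (phi (z * (D - k2 * z))) (phi (z * D))
    (map_mx (inx A) Ts) (map_mx (iny A) Ts).
Proof.
move=> D z; have eD : phi D = sery - serx.
  by rewrite (rmorphB phi) ser2_algX ser2_algY.
have ez : phi z = serx * sery.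
  by rewrite (rmorphM phi) ser2_algX ser2_algY.
have ek : phi k2 = serK A kap by rewrite ser2_algC.
have eDk : phi (D - k2 * z) = sery - serx - serK A kap * (serx * sery).
  by rewrite (rmorphB phi) (rmorphM phi k2) eD ez ek.
rewrite (rmorphM phi D) (rmorphM phi z) (rmorphM phi z) eDk eD ez; exact: hT.
Qed.

Let cphi a : central (phi a) := @central_ser2_alg F A a.
Hint Resolve cphi : core.

Lemma negx_Ts : map_mx (negx A) (map_mx (inx A) Ts) = map_mx (inx A) Tn.
Proof. by apply/matrixP => i j; rewrite !mxE negx_inx. Qed.
Lemma negx_iTs (X : 'M[ser A]_N) :
  map_mx (negx A) (map_mx (iny A) X) = map_mx (iny A) X.
Proof. by apply/matrixP => i j; rewrite !mxE negx_iny. Qed.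
Lemma negy_Ts : map_mx (negy A) (map_mx (iny A) Ts) = map_mx (iny A) Tn.
Proof. by apply/matrixP => i j; rewrite !mxE negy_iny. Qed.
Lemma negy_iTs (X : 'M[ser A]_N) :
  map_mx (negy A) (map_mx (inx A) X) = map_mx (inx A) X.
Proof. by apply/matrixP => i j; rewrite !mxE negy_inx. Qed.
Lemma swap_inx (X : 'M[ser A]_N) :
  map_mx (swapxy A) (map_mx (inx A) X) = map_mx (iny A) X.
Proof. by apply/matrixP => i j; rewrite !mxE swapxy_inx. Qed.
Lemma swap_iny (X : 'M[ser A]_N) :
  map_mx (swapxy A) (map_mx (iny A) X) = map_mx (inx A) X.
Proof. by apply/matrixP => i j; rewrite !mxE swapxy_iny. Qed.

Lemma rscalarsE (f : {rmorphism ser (ser F) -> ser (ser F)}) a b :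
  f serx = a -> f sery = b -> (forall c, f (konst F c) = konst F c) ->
  let D := dminus F in let z := xy F in
  [/\ f (D * (D - k2 * z)) = (b - a) * ((b - a) - k2 * (a * b)),
      f (z * (D - k2 * z)) = a * b * ((b - a) - k2 * (a * b)) &
      f (z * D) = a * b * (b - a)].
Proof.
move=> fx fy fk D z; have [eD _ ez] := dminus_dplus_xy_map N fx fy fk.
have ek : f (D - k2 * z) = (b - a) - k2 * (a * b).
  by rewrite (rmorphB f) (rmorphM f) fk eD ez.
by split; rewrite (rmorphM f) ?ek ?eD ?ez.
Qed.

(** Replacing w1 by -w1 turns the parameter u - v into kappa - u - v. Crossing symmetry, the partial
    transposition exchanging P and Q, then converts R(kappa - u - v) into R(u + v), which is how
    [rplus] enters [crossed_xy]. *)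
Lemma rtt_neg_x :
  rtt (phi (dplus F N * (dplus F N - k2 * xy F)))
    (phi (- (xy F * dplus F N))) (phi (- (xy F * (dplus F N - k2 * xy F))))
    (map_mx (inx A) Tn) (map_mx (iny A) Ts).
Proof.
have := rtt_map (negx A) rtt_scalars.
rewrite negx_Ts negx_iTs !negx_alg.
have [-> -> ->] := rscalarsE (negxX F) (negxY F) (negxK (F := F)).
have -> : (sery - - serx) * (sery - - serx - k2 * (- serx * sery)) =
    dplus F N * (dplus F N - k2 * xy F) by rewrite /dplus /xy; ring.
have -> : - serx * sery * (sery - - serx - k2 * (- serx * sery)) =
    - (xy F * dplus F N) by rewrite /dplus /xy; ring.
have -> : - serx * sery * (sery - - serx) =
    - (xy F * (dplus F N - k2 * xy F)) by rewrite /dplus /xy; ring.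
by [].
Qed.

Lemma crossed_xy :
  first (ttr (map_mx (inx A) Tn)) *m rplus N A *m second (map_mx (iny A) Ts) =
  second (map_mx (iny A) Ts) *m rplus N A *m first (ttr (map_mx (inx A) Tn)).
Proof.
have := rtt_transpose_first (cphi _) (cphi _) (cphi _) rtt_neg_x.
by rewrite -!(rmorphN phi) !opprK.
Qed.

(** The mirror image of [crossed_xy]: [rplus] is unchanged when the variables and the tensor factors
    are exchanged together. *)
Lemma crossed_yx :
  second (ttr (map_mx (iny A) Tn)) *m rplus N A *m first (map_mx (inx A) Ts) =
  first (map_mx (inx A) Ts) *m rplus N A *m second (ttr (map_mx (iny A) Tn)).
Proof.
apply: (swap_crossed (cphi _) (cphi _) (cphi _)).
have h := crossed_map (swapxy A) crossed_xy.
have [_ eD ez] := dminus_dplus_xy_map N (swapX F) (swapY F) (swapK (F := F)).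
have {}eD : swapxy F (dplus F N) = dplus F N.
  by rewrite eD /dplus; ring.
have {}ez : swapxy F (xy F) = xy F by rewrite ez /xy mulrC.
have ek : swapxy F (dplus F N - k2 * xy F) = dplus F N - k2 * xy F.
  by rewrite (rmorphB (swapxy F)) (rmorphM (swapxy F)) swapK eD ez.
have e1 : swapxy A (phi (dplus F N * (dplus F N - k2 * xy F))) =
    phi (dplus F N * (dplus F N - k2 * xy F)).
  by rewrite swapxy_alg (rmorphM (swapxy F)) ek eD.
have e2 : swapxy A (phi (xy F * (dplus F N - k2 * xy F))) =
    phi (xy F * (dplus F N - k2 * xy F)).
  by rewrite swapxy_alg (rmorphM (swapxy F)) ek ez.
have e3 : swapxy A (phi (xy F * dplus F N)) = phi (xy F * dplus F N).
  by rewrite swapxy_alg (rmorphM (swapxy F)) eD ez.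
by move: h; rewrite e1 e2 e3 map_ttr swap_inx swap_iny.
Qed.

(** The substitution (w1, w2) to (-w2, -w1) keeps u - v. Transposing both tensor factors and then
    exchanging them puts the resulting relation for T(-w) in the required order. *)
Lemma parallel_xy :
  rminus N A *m first (ttr (map_mx (inx A) Tn)) *m
    second (ttr (map_mx (iny A) Tn)) =
  second (ttr (map_mx (iny A) Tn)) *m first (ttr (map_mx (inx A) Tn)) *m
    rminus N A.
Proof.
have := rtt_map (negy A) (rtt_map (negx A) rtt_scalars).
rewrite negx_Ts negx_iTs negy_Ts negy_iTs !negx_alg !negy_alg => h.
have {}h := rtt_map (swapxy A) h.
move: h; rewrite !swapxy_alg swap_inx swap_iny.
pose f : {rmorphism ser (ser F) -> ser (ser F)} := swapxy F \o negy F \o negx F.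
have fx : f serx = - sery.
  by rewrite /f /= negxX (rmorphN (negy F)) negyX (rmorphN (swapxy F)) swapX.
have fy : f sery = - serx.
  by rewrite /f /= negxY negyY (rmorphN (swapxy F)) swapY.
have fk c : f (konst F c) = konst F c.
  by rewrite /f /= negxK negyK swapK.
have [e1 e2 e3] := rscalarsE fx fy fk; move: e1 e2 e3; rewrite /f /= => -> -> ->.
have -> : (- serx - - sery) * (- serx - - sery - k2 * (- sery * - serx)) =
    dminus F * (dminus F - k2 * xy F) by rewrite /dminus /xy; ring.
have -> : - sery * - serx * (- serx - - sery - k2 * (- sery * - serx)) =
    xy F * (dminus F - k2 * xy F) by rewrite /dminus /xy; ring.
have -> : - sery * - serx * (- serx - - sery) =
    xy F * dminus F by rewrite /dminus /xy; ring.
move=> /(rtt_transpose (cphi _) (cphi _) (cphi _)) h.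
exact/esym/(swap_parallel (cphi _) (cphi _) (cphi _)).
Qed.

Theorem reflection_Sser :
  reflection (rminus N A) (rplus N A) (map_mx (inx A) Sser) (map_mx (iny A) Sser).
Proof.
rewrite /Sser !map_mxM !map_ttr; apply: reflection_conj.
- by move=> i j; rewrite !mxE inx_alg; apply: cphi.
- by move=> i j; rewrite !mxE iny_alg; apply: cphi.
- exact: rtt_scalars.
- exact: crossed_xy.
- exact: crossed_yx.
- exact: parallel_xy.
exact: reflection_gser.
Qed.

End ReflectionOfS.

(** * The fusion identity between S(w) and S(-w) *)

Section FusionConj.
Variables (L : nzRingType) (N : nat).

(** Against Q, the factor ttr X' in slot 1 becomes X' in slot 2, where it passes G and meets R X_1.
    After RTT and the scalar fusion for G, the remaining X_1 is turned by Q into ttr X in slot 2. *)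
Lemma fusion_conj (R : 'M[L]_(N * N)) (X X' G G' : 'M[L]_N) (a : L) :
  central a ->
  (forall i j, central (G i j)) -> (forall i j, central (G' i j)) ->
  R *m first X *m second X' = second X' *m first X *m R ->
  R *m first G *m contraction = a *: (second G' *m contraction) ->
  R *m first (X *m G *m ttr X') *m contraction =
  a *: (second (X' *m G' *m ttr X) *m contraction).
Proof.
move=> ca cG cG' hX hG.
have sG Z : first G *m second Z = second Z *m first G.
  by apply: first_second_comm => i j k l; rewrite cG.
have sG' Z : first Z *m second G' = second G' *m first Z.
  by apply: first_second_comm => i j k l; rewrite cG'.
rewrite !firstM !secondM -!mulmxA -second_contraction.
rewrite [first G *m _]mulmxA sG -mulmxA.
rewrite (mulmxA (first X)) (mulmxA R) (mulmxA R) hX -!mulmxA (mulmxA R) hG.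
rewrite !mulmxZc //; congr (a *: (_ *m _)).
by rewrite mulmxA sG' -mulmxA first_contraction.
Qed.

Lemma fusion_rmat_map (L' : nzRingType) (f : {rmorphism L -> L'}) (a b c e : L)
    (X Y : 'M[L]_N) :
  rmat N a b c *m first X *m contraction = e *: (second Y *m contraction) ->
  rmat N (f a) (f b) (f c) *m first (map_mx f X) *m contraction =
  f e *: (second (map_mx f Y) *m contraction).
Proof.
move=> /(congr1 (map_mx f)).
by rewrite map_mxZ !map_mxM map_first map_second map_rmat map_contraction.
Qed.

End FusionConj.

Section FusionOfS.
Variables (F : numFieldType) (N : nat).
Hypothesis N2 : (2 <= N)%N.
Variables (A : algType F) (T : nat -> 'M[A]_N).
Hypothesis hT : rtt_series T.
Local Notation kap := (kappa F N).
Local Notation psi := (ser_alg A).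
Local Notation Ts := (ser_mx T).
Local Notation Tn := (map_mx (@ser_neg A) Ts).

(* The substitution [y = - x]. *)
Definition diagneg (B : nzRingType) : {rmorphism ser (ser B) -> ser B} :=
  @ser_diag B \o negy B.

Lemma diagneg_inx (B : nzRingType) (f : ser B) : diagneg B (inx B f) = f.
Proof. by rewrite /diagneg /= negy_inx [LHS]ser_diagC. Qed.

Lemma diagneg_iny (B : nzRingType) (f : ser B) : diagneg B (iny B f) = ser_neg f.
Proof. by rewrite /diagneg /= negy_iny [LHS]ser_diag_map. Qed.

Lemma diagneg_alg a : diagneg A (ser2_alg A a) = psi (diagneg F a).
Proof.
rewrite /diagneg /= negy_alg; apply/funext => n; rewrite /ser_diag.
rewrite [RHS](rmorph_sum (in_alg A)); apply: eq_bigr => i _; by [].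
Qed.

Lemma ser_alg_neg a : ser_neg (psi a) = psi (ser_neg a).
Proof. exact/esym/(ser_map_neg (in_alg A)). Qed.

(* [dminus] and [xy] at [y = - x]. *)
Definition fuse_D : ser F := - serX - serX.
Definition fuse_z : ser F := - (serX * serX).

(** R(2w) with cleared denominators, as [fuse_D] / [fuse_z] = 2/x. *)
Definition fuse : 'M[ser A]_(N * N) :=
  rmat N (psi (fuse_D * (fuse_D - serC kap * fuse_z)))
    (psi (fuse_z * (fuse_D - serC kap * fuse_z))) (psi (fuse_z * fuse_D)).

Definition fuse_factor : ser F :=
  2%:R * (serX * serX) * (2%:R - serX) * (1 + serC (kap / 2%:R) * serX).

Lemma fuse_T :
  fuse *m first Ts *m second Tn = second Tn *m first Ts *m fuse.
Proof.
have := rtt_map (diagneg A) (rtt_scalars hT).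
have eX : map_mx (diagneg A) (map_mx (inx A) Ts) = Ts.
  by apply/matrixP => i j; rewrite !mxE diagneg_inx.
have eY : map_mx (diagneg A) (map_mx (iny A) Ts) = Tn.
  by apply/matrixP => i j; rewrite !mxE diagneg_iny.
rewrite eX eY !diagneg_alg.
have ex : diagneg F serx = serX by rewrite serx_in diagneg_inx.
have ey : diagneg F sery = - serX by rewrite sery_in diagneg_iny ser_negX.
have ek : diagneg F (konst F kap) = serC kap by rewrite (diagneg_inx (serC kap)).
have eD : diagneg F (dminus F) = fuse_D by rewrite (rmorphB (diagneg F)) ex ey.
have ez : diagneg F (xy F) = fuse_z.
  by rewrite (rmorphM (diagneg F)) ex ey mulrN.
have eDk : diagneg F (dminus F - konst F kap * xy F) =
    fuse_D - serC kap * fuse_z.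
  by rewrite (rmorphB (diagneg F)) (rmorphM (diagneg F)) eD ek ez.
by rewrite (rmorphM _ (dminus F)) 2!(rmorphM _ (xy F)) eDk eD ez.
Qed.

Lemma neg_lin (c g d : F) :
  ser_neg ((1 + serC c * serX) * serC g - serC d * serX) =
  (1 - serC c * serX) * serC g - - (serC d * serX).
Proof.
rewrite rmorphB !rmorphM rmorphD rmorph1 rmorphM /= !ser_negC !ser_negX.
by rewrite !mulrN.
Qed.

(** RTT at v = -u (in the centred variable) dresses [fusion_gmat]. Changing w to -w turns T(w) G
    T^t(-w) into T(-w) G T^t(w), which is exactly the order that [fusion_conj] delivers. *)
Lemma fusion_Sser :
  fuse *m first (Sser T) *m contraction =
  psi fuse_factor *: (second (map_mx (@ser_neg A) (Sser T)) *m contraction).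
Proof.
pose C := ser F.
have g_sign (i : 'I_N) : serC (gsign F i) = 1 \/ serC (gsign F i) = -1 :> C.
  by case: (gsign_pm F i) => ->; [left|right]; rewrite ?rmorphN rmorph1.
have g_rev (i : 'I_N) : serC (gsign F (rev_ord i)) = serC (gsign F i).
  by rewrite gsign_rev.
have g_tr : \sum_(i < N) serC (gsign F i) = 4%:R * serC (dpar F N).
  by rewrite -rmorph_sum gsign_trace // rmorphM rmorph_nat.
have dN : N%:R = 4%:R * serC (dpar F N) + 4%:R.
  by rewrite -(rmorph_nat (@serC F)) dparN rmorphD rmorphM !rmorph_nat.
have ek : serC kap = 2%:R * serC (dpar F N) + 1.
  by rewrite dpar_kappa rmorphD rmorphM rmorph_nat rmorph1.
have ec : 2%:R * serC (kap / 2%:R) = 2%:R * serC (dpar F N) + 1.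
  rewrite -ek -(rmorph_nat (@serC F)) -rmorphM; congr serC.
  by rewrite mulrC divfK ?pnatr_eq0.
have := fusion_gmat g_sign g_rev g_tr dN serX ec; rewrite /= -ek => h.
have {}h := fusion_rmat_map psi h.
have eneg : map_mx (@ser_neg A) (Sser T) =
    Tn *m map_mx psi (gmat (fun i => serC (gsign F i))
      (1 - serC (kap / 2%:R) * serX) (- (serC (dpar F N) * serX))) *m ttr Ts.
  rewrite /Sser 2!map_mxM map_ttr; congr (_ *m _ *m ttr _).
    apply/matrixP => i j; rewrite !mxE [LHS]ser_alg_neg.
    by congr (psi _); rewrite (rmorphMn (@ser_neg F)); congr (_ *+ _); apply: neg_lin.
  by apply/matrixP => i j; rewrite !mxE; apply: ser_negK.
rewrite eneg; apply: fusion_conj.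
- exact: central_ser_alg.
- by move=> i j; rewrite mxE; apply: central_ser_alg.
- by move=> i j; rewrite mxE; apply: central_ser_alg.
- exact: fuse_T.
exact: h.
Qed.

End FusionOfS.

(** * Regular series, inverses and square roots *)

Section SeriesRegularity.

Lemma ser_lreg (A : nzRingType) (f g : ser A) :
  (forall h, f 0%N * h = 0 -> h = 0) -> f * g = 0 -> g = 0.
Proof.
move=> reg fg0; suff H n : forall m, (m < n)%N -> g m = 0.
  by apply/funext => n; apply: (H n.+1).
elim: n => // n IH m; rewrite ltnS leq_eqVlt => /orP[/eqP->|]; last exact: IH.
apply: reg; have := congr1 (fun h : ser A => h n) fg0.
rewrite serME big_ord_recl subn0 big1 ?addr0 // => i _.
by rewrite IH ?mulr0 //= /bump /=; have := ltn_ord i; lia.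
Qed.

Lemma ser_field_lreg (F : fieldType) (f g : ser F) :
  f 0%N != 0 -> f * g = 0 -> g = 0.
Proof.
move=> f0; apply: ser_lreg => h /eqP.
by rewrite mulf_eq0 (negbTE f0) => /eqP.
Qed.

(* Course-of-values recursion: [Phi n f] only looks at [f] below [n]. *)
Lemma ser_rec (A : nzRingType) (Phi : nat -> ser A -> A) :
  (forall n f g, (forall m, (m < n)%N -> f m = g m) -> Phi n f = Phi n g) ->
  exists f : ser A, forall n, f n = Phi n f.
Proof.
move=> loc.
pose step (s : seq A) : seq A := rcons s (Phi (size s) (fun i => nth 0 s i)).
pose pre n := iter n step [::].
have szp n : size (pre n) = n by elim: n => //= n IH; rewrite size_rcons IH.
have nthp n k i : (i < n)%N -> nth 0 (pre (n + k)%N) i = nth 0 (pre n) i.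
  move=> ni; elim: k => [|k IH]; rewrite ?addn0 // addnS /= nth_rcons szp.
  by rewrite ltn_addr.
exists (fun n => nth 0 (pre n.+1) n) => n.
rewrite /= nth_rcons szp ltnn eqxx; apply: loc => m mn /=.
by rewrite -(subnKC mn) nthp.
Qed.

Lemma ser_inverse (F : fieldType) (f : ser F) :
  f 0%N != 0 -> exists g : ser F, f * g = 1.
Proof.
move=> f0.
have [|g gE] := @ser_rec F (fun n g =>
  ((n == 0%N)%:R - \sum_(i < n) f i.+1 * g (n - i.+1)%N) / f 0%N).
  move=> n g h e; congr ((_ - _) / _); apply: eq_bigr => i _; congr (_ * _).
  by apply: e; have := ltn_ord i; lia.
exists g; apply/funext => n; rewrite serME big_ord_recl subn0 gE.
rewrite mulrCA divff // mulr1; set s := (X in _ - X).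
rewrite (_ : \sum_(i < n) _ = s) ?subrK //.
Qed.

(** For n > 0 the coefficient of g^2 at n is 2 g_n plus a sum over lower indices, so the square root
    is computed recursively by dividing by 2. *)
Lemma ser_sqrt (F : numFieldType) (f : ser F) :
  f 0%N = 1 -> exists g : ser F, g 0%N = 1 /\ g * g = f.
Proof.
move=> f0.
have [|g gE] := @ser_rec F (fun n g => if n is m.+1 then
  (f n - \sum_(i < m) g i.+1 * g (m - i)%N) / 2%:R else 1).
  case=> // n g h e; congr ((_ - _) / _); apply: eq_bigr => i _.
  by rewrite !e //; have := ltn_ord i; lia.
have g0 : g 0%N = 1 by rewrite gE.
exists g; split=> //; apply/funext => -[|n]; first by rewrite serM0 g0 mulr1.
rewrite serME big_ord_recl big_ord_recr /= subn0 subSS subnn g0 mul1r mulr1.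
under eq_bigr => i _ do rewrite subSS.
rewrite addrCA -mulr2n -mulr_natr (gE n.+1) divfK ?pnatr_eq0 //.
by rewrite addrC subrK.
Qed.

(** A root with constant term 1 is unique: g(-x)^2 = g(x)^2 factors, and g(-x) + g(x) has constant
    term 2, hence is regular. *)
Lemma ser_sqrt_even (F : numFieldType) (f : ser F) :
  f 0%N = 1 -> ser_neg f = f ->
  exists g : ser F, [/\ g 0%N = 1, ser_neg g = g & g * g = f].
Proof.
move=> f0 fe; have [g [g0 gg]] := ser_sqrt f0; exists g; split=> //.
apply/eqP; rewrite -subr_eq0; apply/eqP.
apply: (@ser_field_lreg _ (ser_neg g + g)).
  by rewrite serDE /ser_neg mul1r g0 -[1 + 1]/(2%:R) pnatr_eq0.
rewrite -[LHS]/((_ + _) * (_ - _)) mulrC -subr_sqr !expr2 gg.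
by rewrite -(rmorphM (@ser_neg F)) gg /= fe subrr.
Qed.

Lemma even_unitalP (F : numFieldType) (g : ser F) :
  even_unital g <-> g 0%N = 1 /\ ser_neg g = g.
Proof.
split=> -[g0 ge]; split=> //.
  apply/funext => r; rewrite /ser_neg -signr_odd.
  by case: (boolP (odd r)) => [/ge->|_]; rewrite ?mulr0 ?mul1r.
move=> r ro; have := congr1 (fun f : ser F => f r) ge.
rewrite /ser_neg -signr_odd ro expr1 mulN1r => /eqP.
by rewrite eq_sym -addr_eq0 -mulr2n mulrn_eq0 => /eqP.
Qed.

End SeriesRegularity.

(** * Scalar solutions *)

Section ConstantTerm.
Variable A : nzRingType.

Definition ser_ev (f : ser A) : A := f 0%N.

Lemma ser_ev_is_zmod : zmod_morphism ser_ev.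
Proof. by []. Qed.

Lemma ser_ev_is_monoid : monoid_morphism ser_ev.
Proof. by split=> // f g; apply: serM0. Qed.

HB.instance Definition _ := GRing.isZmodMorphism.Build (ser A) A ser_ev
  ser_ev_is_zmod.
HB.instance Definition _ := GRing.isMonoidMorphism.Build (ser A) A ser_ev
  ser_ev_is_monoid.

End ConstantTerm.

(** The order zero term a a' (X Z - Z X) vanishes, so the whole equation is divisible by the regular
    element y; the quotient is what survives at y = 0. *)
Lemma reflection_expand (C : comNzRingType) n (P Q X Z : 'M[C]_n) (a a' y : C) :
  X *m Z = Z *m X -> (forall h, y * h = 0 -> h = 0) ->
  (a%:M + y *: P) *m X *m (a'%:M + y *: Q) *m Z =
    Z *m (a'%:M + y *: Q) *m X *m (a%:M + y *: P) ->
  a *: (X *m Q *m Z - Z *m Q *m X) + a' *: (P *m X *m Z - Z *m X *m P)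
    + y *: (P *m X *m Q *m Z - Z *m Q *m X *m P) = 0.
Proof.
move=> XZ reg /eqP; rewrite -subr_eq0 => /eqP e.
apply/matrixP => i j; rewrite [RHS]mxE; apply: reg.
move/matrixP/(_ i j): e; rewrite [RHS]mxE => <-.
rewrite !(mulmxDl, mulmxDr) !mul_scalar_mx !mul_mx_scalar -!scalemxAl -!scalemxAr.
by rewrite -!scalemxAl XZ !mxE; ring.
Qed.

Lemma reflection_leading (C C' : comNzRingType) (f : {rmorphism C -> C'}) n
    (P Q X Z : 'M[C]_n) (a a' y : C) (P' Q' X' Z' : 'M[C']_n) (b b' : C') :
  f y = 0 -> X *m Z = Z *m X -> (forall h, y * h = 0 -> h = 0) ->
  (a%:M + y *: P) *m X *m (a'%:M + y *: Q) *m Z =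
    Z *m (a'%:M + y *: Q) *m X *m (a%:M + y *: P) ->
  map_mx f P = P' -> map_mx f Q = Q' -> map_mx f X = X' -> map_mx f Z = Z' ->
  f a = b -> f a' = b' ->
  b *: (X' *m Q' *m Z' - Z' *m Q' *m X')
    + b' *: (P' *m X' *m Z' - Z' *m X' *m P') = 0.
Proof.
move=> fy XZ reg /(reflection_expand XZ reg) /(congr1 (map_mx f)).
rewrite map_mx0 2!map_mxD 3!map_mxZ fy scale0r addr0 !map_mxB !map_mxM.
by move=> h <- <- <- <- <- <-.
Qed.

Lemma rmat_split (C : comNzRingType) N (a b c y b' c' : C) :
  b = y * b' -> c = y * c' ->
  rmat N a b c = a%:M + y *: (c' *: contraction - b' *: flip).
Proof.
by move=> -> ->; rewrite scalerBr !scalerA /rmat -!addrA [- _ + _]addrC.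
Qed.

Lemma map_contraction_flip (C C' : comNzRingType) (f : {rmorphism C -> C'}) N
    (a b : C) :
  map_mx f (a *: contraction - b *: flip : 'M_(N * N)) =
  f a *: contraction - f b *: flip.
Proof. by rewrite map_mxB !map_mxZ map_flip map_contraction. Qed.

Section LeadingTerm.
Variables (F : numFieldType) (N : nat) (K : 'M[ser F]_N).
Local Notation k2 := (konst F (kappa F N)).

Definition rminusF : 'M[ser (ser F)]_(N * N) :=
  let D := dminus F in let z := xy F in
  rmat N (D * (D - k2 * z)) (z * (D - k2 * z)) (z * D).

Definition rplusF : 'M[ser (ser F)]_(N * N) :=
  let D := dplus F N in let z := xy F in
  rmat N (D * (D - k2 * z)) (z * (D - k2 * z)) (z * D).

Let Om : 'M[ser F]_(N * N) := flip - contraction.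
Let ev : {rmorphism ser (ser F) -> ser F} := @ser_ev (ser F).

Let evx : ev serx = serX. Proof. by []. Qed.
Let evy : ev sery = 0. Proof. by []. Qed.
Let evz : ev (xy F) = 0. Proof. by rewrite (rmorphM ev) evy mulr0. Qed.

(** At y = 0 the R-matrix is the scalar t^2. Its P and Q terms both carry a factor x y and have
    equal coefficients at y = 0, whence P - Q in first order. *)
Lemma rmat_ev (D : ser (ser F)) (t : ser F) : ev D = t ->
  exists a P, [/\ rmat N (D * (D - k2 * xy F)) (xy F * (D - k2 * xy F)) (xy F * D)
      = a%:M + sery *: P, ev a = t * t & map_mx ev P = - (serX * t) *: Om].
Proof.
move=> evD; have evDk : ev (D - k2 * xy F) = t.
  by rewrite (rmorphB ev) (rmorphM ev) evz mulr0 subr0.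
exists (D * (D - k2 * xy F)).
exists ((serx * D) *: contraction - (serx * (D - k2 * xy F)) *: flip).
split.
- have e3 (u v w : ser (ser F)) : u * v * w = v * (u * w) by ring.
  by apply: rmat_split; apply: (e3 serx sery).
- by rewrite (rmorphM ev) evDk evD.
rewrite map_contraction_flip.
have -> : ev (serx * D) = serX * t by rewrite (rmorphM ev) evD.
have -> : ev (serx * (D - k2 * xy F)) = serX * t by rewrite (rmorphM ev) evDk.
by rewrite -scalerBr scaleNr -scalerN opprB.
Qed.

Hypothesis hrefl : reflection rminusF rplusF (map_mx (inx F) K) (map_mx (iny F) K).
Hypothesis hK0 : forall i j, K i j 0%N = gsign F i *+ (i == j).

Lemma leading_commutation :
  let G := map_mx (@serC F) (map_mx (@ser_ev F) K) in
  Om *m first K *m second G - second G *m first K *m Om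
  - first K *m Om *m second G + second G *m Om *m first K = 0.
Proof.
move=> G.
have eD : ev (dminus F) = - serX by rewrite (rmorphB ev) evx evy sub0r.
have eB : ev (dplus F N) = serX.
  rewrite (rmorphD ev) (rmorphD ev sery) (rmorphM ev k2).
  by rewrite [ev (_ * _)]evz mulr0 evx evy add0r addr0.
have [a [P [eR ea eP]]] := rmat_ev eD; have [a' [Q [eR' ea' eQ]]] := rmat_ev eB.
have h0 := hrefl; rewrite /reflection /rminusF /rplusF eR eR' in h0.
have XZ : first (map_mx (inx F) K) *m second (map_mx (iny F) K) =
    second (map_mx (iny F) K) *m first (map_mx (inx F) K).
  by apply: first_second_comm => i j k l; rewrite mulrC.
have eX : map_mx ev (first (map_mx (inx F) K)) = first K.
  by rewrite map_first; congr first; apply/matrixP => i j; rewrite !mxE.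
have eZ : map_mx ev (second (map_mx (iny F) K)) = second G.
  by rewrite map_second; congr second; apply/matrixP => i j; rewrite !mxE.
have := reflection_leading evy XZ (@serX_reg _) h0 eP eQ eX eZ ea ea'.
rewrite -!(scalemxAl, scalemxAr).
set w1 := first K *m Om *m _; set w2 := _ *m Om *m first K.
set w3 := Om *m first K *m _; set w4 := _ *m first K *m Om.
move: w1 w2 w3 w4 => w1 w2 w3 w4 h.
(* With t = -x for u - v and t = x for u + v, one R-matrix contributes t^2 and the other x t, up to
   sign: all four terms share the factor x^4. *)
suff : (serX * serX * (serX * serX)) *: (w3 - w4 - w1 + w2) = 0.
  move=> {}h; apply/matrixP => i j; rewrite [RHS]mxE.
  move/matrixP/(_ i j): h; rewrite [LHS]mxE [RHS]mxE -!mulrA.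
  by do 4!move/serX_reg.
by apply: etrans h; apply/matrixP => i j; rewrite !mxE; ring.
Qed.

(** When g_k = g_l, the four terms of [leading_commutation] add up to 2 g_l times an entry of the
    commutator of P - Q with K_1; opposite signs would make them cancel. *)
Lemma leading_entry i k j l : gsign F k = gsign F l ->
  K k j *+ (i == l) - K (rev_ord l) j *+ (k == rev_ord i) =
  K i l *+ (k == j) - K i (rev_ord k) *+ (l == rev_ord j).
Proof.
move=> gkl; set t := LHS; set t' := RHS.
have eG : map_mx (@serC F) (map_mx (@ser_ev F) K) =
    gmat (fun i => serC (gsign F i)) 1 0.
  apply/matrixP => a b; rewrite !mxE /ser_ev hK0 mul1r subr0.
  by rewrite (rmorphMn (@serC F)).
have := leading_commutation; rewrite /= eG.
move=> /(congr1 (fun Z => entry2 Z i k j l)).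
rewrite 3!entry2D 2!entry2N -!(mulmxA (second _)).
rewrite !entry2_Msecond_gmat !entry2_second_gmatM mul1r !subr0 gkl mul1r.
have -> : entry2 (Om *m first K) i k j l = t.
  rewrite mulmxBl entry2D entry2N entry2_flipM entry2_contractionM.
  rewrite entry2_first (bigD1 (rev_ord l)) //= big1 ?addr0 => [|p pl].
    by rewrite entry2_first rev_ordK eqxx.
  rewrite entry2_first; case: eqP => // pl'.
  by rewrite -pl' rev_ordK eqxx in pl.
have -> : entry2 (first K *m Om) i k j l = t'.
  rewrite mulmxBr entry2D entry2N entry2_Mflip entry2_Mcontraction.
  rewrite entry2_first (bigD1 (rev_ord k)) //= big1 ?addr0 => [|p pl].
    by rewrite entry2_first rev_ordK eqxx.
  rewrite entry2_first; case: eqP => // pl'.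
  by rewrite pl' rev_ordK eqxx in pl.
have -> : entry2 (0 : 'M[ser F]_(N * N)) i k j l = 0 by rewrite /entry2 mxE.
move=> h; apply/eqP; rewrite -subr_eq0; apply/eqP.
apply: (@ser_field_lreg _ (2%:R * serC (gsign F l))).
  rewrite serM0 mulf_neq0 //.
    by rewrite serMnE ser1E pnatr_eq0.
  by case: (gsign_pm F l) => ->; rewrite ?oppr_eq0 oner_eq0.
by apply: etrans h; ring.
Qed.

(** The entries with k = l meet the sign condition automatically. If j is the opposite of i, the Q
    term only gives K i j = - K i j, which suffices as 2 is regular. *)
Lemma offdiag0 i j : i != j -> K i j = 0.
Proof.
have two_reg (f : ser F) : f + f = 0 -> f = 0.
  move=> f2; apply: (@ser_field_lreg _ (2%:R)).
    by rewrite serMnE ser1E pnatr_eq0.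
  by apply: etrans f2; ring.
(* The choice k = l = i fails for the self-opposite index of odd N. That index is unique, so then j
   is not self-opposite and k = l = j works. *)
move=> ij; have [irev|irev] := eqVneq i (rev_ord i); last first.
  have := @leading_entry i i j i erefl.
  rewrite eqxx (negbTE irev) (negbTE ij) mulr1n !mulr0n subr0 sub0r.
  case: (i =P rev_ord j) => [e|_]; last by rewrite mulr0n oppr0.
  by rewrite mulr1n {3}e rev_ordK => /eqP; rewrite -addr_eq0 => /eqP/two_reg.
have [jrev|jrev] := eqVneq j (rev_ord j).
  have ei : i = j :> nat.
    by have := congr1 val irev; have := congr1 val jrev; rewrite /=;
       have := ltn_ord i; have := ltn_ord j; lia.
  by rewrite (val_inj ei) eqxx in ij.
have := @leading_entry i j j j erefl.
rewrite eqxx (negbTE ij) (negbTE jrev) mulr1n !mulr0n subr0 sub0r.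
case: (j =P rev_ord i) => [e|_]; last by rewrite mulr0n oppr0.
by move: ij; rewrite e -irev eqxx.
Qed.

Lemma diag_const a b : a != b -> a != rev_ord b -> gsign F a = gsign F b ->
  K a a = K b b.
Proof.
move=> ab arb gab; have := @leading_entry a b b a (esym gab).
rewrite !eqxx (negbTE arb) mulr1n [b == _]eq_sym.
rewrite (can2_eq (@rev_ordK _) (@rev_ordK _)) (negbTE arb) !mulr0n !subr0.
by rewrite mulr1n.
Qed.

(** [diag_const] says nothing about two opposite indices. For N >= 5 there are at least three middle
    ones, and position 2 links position 1 with its opposite; for N = 4 the only two middle indices
    are opposite. *)
Lemma diag_middle (i j : 'I_N) : (5 <= N)%N ->
  gsign F i = 1 -> gsign F j = 1 -> K i i = K j j.
Proof.
move=> N5.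
have mid (i0 : 'I_N) : gsign F i0 = 1 -> (0 < i0 < N.-1)%N.
  rewrite /gsign; case: ifP => [_ /eqP|/norP[n0 n1] _].
    by rewrite eq_sym -addr_eq0 -[1 + 1]/(2%:R) pnatr_eq0.
  by have := ltn_ord i0; lia.
have one2 : (1 < N)%N by lia.
have two2 : (2 < N)%N by lia.
pose o1 := Ordinal one2; pose o2 := Ordinal two2.
have g1 : gsign F o1 = 1 by rewrite /gsign /=; case: eqP => // e; lia.
have g2 : gsign F o2 = 1 by rewrite /gsign /=; case: eqP => // e; lia.
have e12 : K o1 o1 = K o2 o2.
  by apply: diag_const; rewrite ?g1 ?g2 // -val_eqE /=; lia.
suff H i0 : gsign F i0 = 1 -> K i0 i0 = K o1 o1 by move=> /H-> /H->.
move=> gi; have := mid _ gi => /andP[i_gt0 i_lt].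
have [->//|n1] := eqVneq i0 o1.
have [e|nr] := eqVneq i0 (rev_ord o1); last first.
  by apply: diag_const; rewrite ?gi ?g1.
rewrite e12; apply: diag_const; rewrite ?gi ?g2 // e -val_eqE /=; lia.
Qed.

End LeadingTerm.

(** This is the entry (i, m; m, i), where the Q terms vanish because i and m are not opposite. *)
Lemma reflection_diag_entry (C : comNzRingType) N (a b c a' b' c' : C)
    (X Y : 'M[C]_N) (i m : 'I_N) :
  (forall i j, i != j -> X i j = 0) -> (forall i j, i != j -> Y i j = 0) ->
  reflection (rmat N a b c) (rmat N a' b' c') X Y ->
  i != m -> i != rev_ord m ->
  (a * b' * X i i + b * a' * X m m) * Y i i =
  (a * b' * X m m + b * a' * X i i) * Y m m.
Proof.
move=> dX dY h im irm.
have mi : m != i by rewrite eq_sym.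
have mri : m == rev_ord i = false.
  by apply: contraNF irm => /eqP->; rewrite rev_ordK.
have := congr1 (fun Z => entry2 Z i m m i) h; rewrite /=.
rewrite entry2_Msecond_diag // -!mulmxA rmatMl.
rewrite entry2_second_diagM // [in RHS]mulmxA [in RHS]rmatMr; try exact: centralC.
rewrite !entry2D !entry2N !entry2Z entry2_flipM entry2_contractionM mri.
rewrite entry2_Mflip entry2_Mcontraction (negbTE irm) !mulr0n !mulr0 !addr0.
rewrite !entry2_first_diagM // !entry2_Mfirst_diag // !entry2_rmat.
rewrite !eqxx (negbTE im) (negbTE mi) mri (negbTE irm) /= ?andbF ?mulr1n ?mulr0n.
move=> e; apply/eqP; rewrite -subr_eq0; apply/eqP.
move/eqP: e; rewrite -subr_eq0 => /eqP e.
rewrite -[RHS]oppr0 -[in RHS]e; ring.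
Qed.

(** Against Q on the right, P X_1 Q picks the opposite diagonal entry and Q X_1 Q = tr(X) Q. *)
Lemma fusion_diag_entry (C : comNzRingType) N (a b c f : C)
    (X Y : 'M[C]_N) (i : 'I_N) :
  (forall i j, i != j -> X i j = 0) -> (forall i j, i != j -> Y i j = 0) ->
  rmat N a b c *m first X *m contraction = f *: (second Y *m contraction) ->
  a * X i i - b * X (rev_ord i) (rev_ord i) + c * \sum_s X s s =
  f * Y (rev_ord i) (rev_ord i).
Proof.
move=> dX dY /(congr1 (fun Z => entry2 Z i (rev_ord i) i (rev_ord i))); rewrite /=.
rewrite entry2_Mcontraction eqxx mulr1n entry2Z entry2_second_diagM //.
rewrite entry2_contraction !eqxx mulr1 => <-.
under [RHS]eq_bigr => s _ do rewrite entry2_Mfirst_diag //.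
by rewrite sum_rmatr eqxx mulr1n.
Qed.

Section RatioSolution.
Variables (F : numFieldType) (N : nat) (K : 'M[ser F]_N).
Local Notation kap := (kappa F N).
Local Notation k2 := (konst F kap).
Hypothesis hrefl : reflection (rminusF F N) (rplusF F N)
  (map_mx (inx F) K) (map_mx (iny F) K).
Hypothesis hK0 : forall i j, K i j 0%N = gsign F i *+ (i == j).

Let Kd := offdiag0 hrefl hK0.

(** Separation of variables: formally the conclusion says that P/(x Q) takes the same value in x and
    in y. This ratio is u (K_i + K_m) / (K_m - K_i). *)
Lemma ratio_equation (i m : 'I_N) : i != m -> i != rev_ord m ->
  let p := 1 + serC (kap / 2%:R) * serX in
  let P := p * (K i i + K m m) in let Q := K m m - K i i in
  sery * (inx F P * iny F Q) = serx * (inx F Q * iny F P).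
Proof.
move=> im irm p P Q.
have dX i' j' : i' != j' -> (map_mx (inx F) K) i' j' = 0.
  by move=> ij; rewrite mxE Kd // rmorph0.
have dY i' j' : i' != j' -> (map_mx (iny F) K) i' j' = 0.
  by move=> ij; rewrite mxE Kd // rmorph0.
have := reflection_diag_entry dX dY hrefl im irm; rewrite !mxE.
set xi := inx F (K i i); set xm := inx F (K m m).
set yi := iny F (K i i); set ym := iny F (K m m).
set D := dminus F; set B := dplus F N; set z := xy F => h.
have {}h : z * ((D - k2 * z) * ((B - k2 * z) *
    ((D * xi + B * xm) * yi - (D * xm + B * xi) * ym))) = 0.
  by move/eqP: h; rewrite -subr_eq0 => /eqP h; apply: etrans h; ring.
(* As series in y, D - kappa z and B - kappa z start with -x and x, both regular among series in x;
   so the common factors can be cancelled. *)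
have rX (f : ser F) : (- serX) * f = 0 -> f = 0.
  by rewrite mulNr => /eqP; rewrite oppr_eq0 => /eqP; apply: serX_reg.
have z0 : z 0%N = 0 by rewrite /z /xy serM0 mulr0.
have eD0 : (D - k2 * z) 0%N = - serX.
  by rewrite serBE serM0 z0 mulr0 subr0 /D /dminus serBE sub0r.
have rD g : (D - k2 * z) * g = 0 -> g = 0.
  by apply: ser_lreg; rewrite eD0.
have eB0 : (B - k2 * z) 0%N = serX.
  by rewrite serBE serM0 z0 mulr0 subr0 /B /dplus serDE (serM0 k2) (serM0 serx)
    !mulr0 addr0 serDE add0r.
have rB g : (B - k2 * z) * g = 0 -> g = 0.
  by apply: ser_lreg; rewrite eB0; apply: serX_reg.
have rx g : serx * g = 0 -> g = 0 := @ser_lreg _ serx g (@serX_reg F).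
have {}h : (D * xi + B * xm) * yi - (D * xm + B * xi) * ym = 0.
  by apply/rB/rD/(serX_reg (A := ser F))/rx; apply: etrans (mulrA _ _ _) h.
have ec : k2 = 2%:R * konst F (kap / 2%:R).
  rewrite -(rmorph_nat (konst F)) -(rmorphM (konst F)).
  by congr (konst F _); rewrite mulrC divfK ?pnatr_eq0.
have epx : inx F p = 1 + konst F (kap / 2%:R) * serx.
  by rewrite (rmorphD (inx F)) (rmorphM (inx F)) rmorph1.
have epy : iny F p = 1 + konst F (kap / 2%:R) * sery.
  rewrite (rmorphD (iny F)) (rmorphM (iny F)) rmorph1 -sery_in.
  by congr (_ + _ * _); apply: ser_mapC.
rewrite /P /Q 2!(rmorphM _ p) epx epy 2!(rmorphD _ (K i i)) 2!(rmorphB _ (K m m)).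
rewrite -/xi -/xm -/yi -/ym; apply/eqP; rewrite -subr_eq0; apply/eqP.
rewrite -[RHS]oppr0 -[in RHS]h /D /B /dminus /dplus ec /xy.
ring.
Qed.

(** The separated equation makes P a constant multiple of x Q. Solving P = - a x Q for K_i gives the
    stated ratio. *)
Lemma ratio_solution (i m : 'I_N) : i != m -> i != rev_ord m ->
  gsign F i = -1 -> gsign F m = 1 ->
  exists a : F,
    K i i * (1 + serC (kap / 2%:R) * serX - serC a * serX) =
    - (K m m * (1 + serC (kap / 2%:R) * serX + serC a * serX)).
Proof.
move=> im irm gi gm; have := ratio_equation im irm; rewrite /=.
set p := 1 + _; set P := p * _; set Q := K m m - K i i => h.
have Q0 : Q 0%N = 2%:R by rewrite /Q serBE !hK0 !eqxx gi gm opprK.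
have P0 : P 0%N = 0.
  by rewrite /P serM0 serDE !hK0 !eqxx gi gm addNr mulr0.
have coefXY (f g : ser F) s r : (inx F f * iny F g) s r = f r * g s.
  by rewrite serCM serMC.
have PQ r : P r.+1 * Q 0%N = Q r * P 1%N.
  have := congr1 (fun f : ser (ser F) => f 1%N r.+1) h; rewrite /=.
  have e1 (f : ser (ser F)) t : (sery * f) t.+1 = f t := serXMS _ _.
  have e2 (f : ser (ser F)) t : (serx * f) t = serX * f t := serCM _ _ _.
  by rewrite e1 e2 serXMS !coefXY.
(* The coefficient of y gives the constant P_1/Q_0, and Q_0 = g_m - g_i = 2. *)
exists (- (P 1%N / 2%:R)).
have eP : P = serC (P 1%N / 2%:R) * serX * Q.
  apply/funext => -[|r]; first by rewrite P0 -mulrA serCM serXM0 mulr0.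
  rewrite -mulrA serCM serXMS; apply: (@mulIf _ 2%:R); first by rewrite pnatr_eq0.
  by rewrite -Q0 PQ Q0 mulrAC divfK ?pnatr_eq0 // mulrC.
rewrite rmorphN; apply/eqP; rewrite -subr_eq0; apply/eqP.
have : P - serC (P 1%N / 2%:R) * serX * Q = 0 by rewrite {1}eP subrr.
rewrite {1}/P /Q => e; apply: etrans e; ring.
Qed.

End RatioSolution.

(** * Consequences of fusion for the three diagonal series *)

Section ScalarEquations.
Variables (F : numFieldType) (c a a' : F) (al be ga : ser F).
Local Notation x := (serX : ser F).
Local Notation U := (1 + serC c * x - serC a * x).
Local Notation V := (1 + serC c * x + serC a * x).
Local Notation U' := (1 + serC c * x - serC a' * x).
Local Notation V' := (1 + serC c * x + serC a' * x).
Hypothesis be0 : be 0%N = 1.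
Hypothesis alE : al * U = - (be * V).
Hypothesis gaE : ga * U' = - (be * V').
Hypothesis traceE :
  (2%:R - 2%:R * serC c * x) * (2%:R - x) * be
    + 2%:R * x * (al + ga + 4%:R * serC c * be) =
  (2%:R - x) * (2%:R + 2%:R * serC c * x) * ser_neg be.

Lemma horner_coef (l0 l1 l2 : F) (t f : ser F) :
  let p := serC l0 + x * (serC l1 + x * (serC l2 + x * t)) in
  [/\ (p * f) 1%N = l0 * f 1%N + l1 * f 0%N &
      (p * f) 2%N = l0 * f 2%N + (l1 * f 1%N + l2 * f 0%N)].
Proof.
move=> p; rewrite /p !mulrDl -!mulrA !mulrDl -!mulrA !mulrDl -!mulrA.
by rewrite !(serDE, serXMS, serCM, serXM0, addr0).
Qed.

(** [traceE] multiplied by U U', the denominators of al and ga: an equation between be and be(-x)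
    alone. *)
Lemma cleared_equation :
  ((2%:R - 2%:R * serC c * x) * (2%:R - x) * (U * U')
    + 2%:R * x * (4%:R * serC c * (U * U') - V * U' - V' * U)) * be =
  (2%:R - x) * (2%:R + 2%:R * serC c * x) * (U * U') * ser_neg be.
Proof.
transitivity ((U * U') * ((2%:R - 2%:R * serC c * x) * (2%:R - x) * be
    + 2%:R * x * (al + ga + 4%:R * serC c * be))
    - 2%:R * x * (U' * (al * U + be * V) + U * (ga * U' + be * V'))).
  by ring.
rewrite alE gaE !addNr !mulr0 addr0 mulr0 subr0 traceE; ring.
Qed.

(** The coefficient of x gives be_1 = 1/2. In that of x^2, be_2 cancels since it is of even index,
    and what remains forces 2 c - a - a' = 1. *)
Lemma parameter_sum : a + a' = 2%:R * c - 1.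
Proof.
(* U U' = 1 + s x + p x^2, and q is the coefficient of x^2 in V U' + V' U. *)
pose s := 2%:R * c - a - a'; pose p := (c - a) * (c - a').
pose q := (c + a) * (c - a') + (c + a') * (c - a).
have eL : (2%:R - 2%:R * serC c * x) * (2%:R - x) * (U * U')
    + 2%:R * x * (4%:R * serC c * (U * U') - V * U' - V' * U) =
    serC 4%:R + x * (serC (4%:R * s + 4%:R * c - 6%:R) +
      x * (serC (4%:R * p + (4%:R * c - 2%:R) * s - 6%:R * c) +
      x * (serC (2%:R * c * s + (4%:R * c - 2%:R) * p - 2%:R * q)
        + x * serC (2%:R * c * p)))).
  rewrite /q /p /s !(rmorphB, rmorphD, rmorphM, rmorph_nat) /=; ring.
have eR : (2%:R - x) * (2%:R + 2%:R * serC c * x) * (U * U') =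
    serC 4%:R + x * (serC (4%:R * s + 4%:R * c - 2%:R) +
      x * (serC (4%:R * p + (4%:R * c - 2%:R) * s - 2%:R * c) +
      x * (serC ((4%:R * c - 2%:R) * p - 2%:R * c * s)
        - x * serC (2%:R * c * p)))).
  rewrite /p /s !(rmorphB, rmorphD, rmorphM, rmorph_nat) /=; ring.
have := cleared_equation; rewrite eL eR => h.
have := congr1 (fun f : ser F => f 2%N) h; have := congr1 (fun f : ser F => f 1%N) h.
rewrite /= !(horner_coef _ _ _ _ _).1 !(horner_coef _ _ _ _ _).2.
rewrite /ser_neg be0 !expr1 expr0 !mulN1r !mul1r sqrrN expr1n mul1r !mulr1.
move: (be 1%N) (be 2%N) => b1 b2 h1 h2.
have two0 : (2%:R : F) != 0 by rewrite pnatr_eq0.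
have four0 : (4%:R : F) != 0 by rewrite pnatr_eq0.
have {}h1 : 2%:R * b1 - 1 = 0.
  apply: (mulfI four0); rewrite mulr0; move/eqP: h1; rewrite -subr_eq0 => /eqP h1.
  by apply: etrans h1; ring.
have s1 : s = 1.
  apply/eqP; rewrite -subr_eq0; apply/eqP/(mulfI four0)/(mulfI two0).
  move/eqP: h2; rewrite -subr_eq0 => /eqP h2; rewrite !mulr0.
  transitivity (- ((8%:R * s + 8%:R * c - 8%:R) * (2%:R * b1 - 1))).
    by rewrite -[LHS](subrK (2%:R * 0)) -{1}h2; ring.
  by rewrite h1 mulr0 oppr0.
transitivity (2%:R * c - s); [by rewrite /s; ring | by rewrite s1].
Qed.

(** Once a + a' = 2 c - 1, the factor 2 + 2 c x splits off [cleared_equation], and the rest says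
    that (2 + x) be / (U U') is invariant under x to -x. *)
Lemma even_solution :
  exists g : ser F, [/\ g 0%N = 1, ser_neg g = g &
    (2%:R + x) * be = 2%:R * (g * (U * U'))].
Proof.
have hs := parameter_sum.
have UU0 : (U * U') 0%N = 1.
  by rewrite serM0 !serBE !serDE !serCM !mulr0 !subr0 !addr0 mulr1.
have [v uv] := @ser_inverse _ (U * U') (eq_ind_r (fun t => t != 0) (oner_neq0 F) UU0).
pose n := ser_neg (U * U').
have nE : n = (1 - serC c * x + serC a * x) * (1 - serC c * x + serC a' * x).
  rewrite /n (rmorphM (@ser_neg F)) 2!(rmorphB (@ser_neg F)) (rmorphD (@ser_neg F)).
  by rewrite 3!(rmorphM (@ser_neg F)) rmorph1 /= !ser_negC !ser_negX !mulrN !opprK.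
have n0 : n 0%N = 1 by rewrite /n /ser_neg UU0 expr0 mulr1.
have ea' : serC a' = 2%:R * serC c - 1 - serC a.
  have -> : a' = 2%:R * c - 1 - a by rewrite -hs addrAC subrr add0r.
  by rewrite !rmorphB rmorphM rmorph_nat rmorph1.
have hE : (2%:R + x) * (n * be) = (2%:R - x) * (U * U' * ser_neg be).
  apply/eqP; rewrite -subr_eq0; apply/eqP.
  apply: (@ser_field_lreg _ (2%:R + 2%:R * serC c * x)).
    by rewrite serDE serMnE ser1E serM0 mulr0 addr0 pnatr_eq0.
  move/eqP: cleared_equation; rewrite -subr_eq0 => /eqP h; apply: etrans h.
  by rewrite nE ea'; ring.
(* v is the inverse of U U'; the factor 1/2 normalizes the constant term to 1. *)
exists (serC 2%:R^-1 * ((2%:R + x) * be * v)).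
set g := _ * _; have half : 2%:R * serC 2%:R^-1 = 1 :> ser F.
  by rewrite -(rmorph_nat (@serC F)) -rmorphM divff ?pnatr_eq0 // rmorph1.
have gE : (2%:R + x) * be = 2%:R * (g * (U * U')).
  rewrite /g; transitivity ((2%:R * serC 2%:R^-1) * ((U * U') * v)
    * ((2%:R + x) * be)); first by rewrite half uv !mul1r.
  by ring.
have v0 : v 0%N = 1.
  by have := congr1 (fun f : ser F => f 0%N) uv; rewrite serM0 UU0 mul1r.
split=> //.
  rewrite /g serCM !serM0 be0 v0 serDE serMnE ser1E addr0 !mulr1.
  by rewrite mulVf ?pnatr_eq0.
have gN : (2%:R - x) * ser_neg be = 2%:R * (ser_neg g * n).
  have := congr1 (@ser_neg F) gE; rewrite !(rmorphM (@ser_neg F)) rmorphD /=.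
  by rewrite ser_negX !rmorph_nat -!(rmorphM (@ser_neg F)).
apply/eqP; rewrite -subr_eq0; apply/eqP.
apply: (@ser_field_lreg _ (2%:R * (n * (U * U')))).
  by rewrite !serM0 n0 -serM0 UU0 serMnE ser1E !mulr1 pnatr_eq0.
transitivity (U * U' * (2%:R * (ser_neg g * n)) - n * (2%:R * (g * (U * U')))).
  by ring.
rewrite -gN -gE; apply/eqP; rewrite subr_eq0; apply/eqP.
transitivity ((2%:R - x) * (U * U' * ser_neg be)); first by ring.
by rewrite -hE; ring.
Qed.

End ScalarEquations.

(** * The change of variable u to u - c *)

Section Powers.
Variables (F : fieldType) (y : ser F).
Hypothesis y0 : y 0%N = 0.

Lemma fps_expE r : fps_exp y r = y ^+ r :> ser F.
Proof. by elim: r => // r IH; rewrite exprS -IH. Qed.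

Lemma ser_exp_small r n : (n < r)%N -> (y ^+ r) n = 0.
Proof.
elim: r n => // r IH n nr; rewrite exprS serME big1 // => -[k /= kn] _.
case: k kn => [|k] kn; first by rewrite y0 mul0r.
by rewrite IH ?mulr0 //; lia.
Qed.

End Powers.

Section Shift.
Variables (F : fieldType) (A : algType F) (c : F).
Implicit Types f g : ser A.
Local Notation y := (fps_inv c : ser F).

Definition ser_shift f : ser A := fps_shift f c.

(** y^r has no coefficient below index r, so any bound M > n may be used and different coefficients
    can share one summation range. *)
Lemma ser_shift_widen f n M : (n < M)%N ->
  ser_shift f n = \sum_(r < M) (y ^+ r) n *: f r.
Proof.
move=> nM; rewrite /ser_shift /fps_shift /fps_subst.
under eq_bigr => r _ do rewrite fps_expE.
rewrite (big_ord_widen _ (fun r => (y ^+ r) n *: f r) nM) big_mkcond.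
apply: eq_bigr => r _; case: ifP => // /negbT; rewrite -leqNgt => nr.
by rewrite ser_exp_small // scale0r.
Qed.

Lemma ser_shift_is_zmod : zmod_morphism ser_shift.
Proof.
move=> f g; apply/funext => n; rewrite serBE !(@ser_shift_widen _ n n.+1) //.
by rewrite -sumrB; apply: eq_bigr => r _; rewrite -scalerBr.
Qed.

Lemma ser_shift_is_monoid : monoid_morphism ser_shift.
Proof.
split=> [|f g]; apply/funext => n.
  rewrite (@ser_shift_widen _ n n.+1) // big_ord_recl big1 ?addr0 => [|r _].
    by rewrite expr0 !ser1E scaler_nat; case: n.
  by rewrite ser1E scaler0.
rewrite (@ser_shift_widen _ n n.+1) //.
under eq_bigr => r _ do rewrite serME scaler_sumr.
transitivity (\sum_(r < n.+1) \sum_(k < r.+1)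
    ((y ^+ (k + (r - k))) n *: (f k * g (r - k)%N))).
  by apply: eq_bigr => r _; apply: eq_bigr => k _; rewrite subnKC // -ltnS.
rewrite (sum_triangle (fun k l _ => (y ^+ (k + l)) n *: (f k * g l))).
rewrite serME.
(* The triangle k + l <= n is completed to a square, the added powers y^(k+l) having no coefficient
   at n; then y^(k+l) = y^k y^l is expanded as a Cauchy product. *)
transitivity (\sum_(k < n.+1) \sum_(l < n.+1)
    ((y ^+ (k + l)) n *: (f k * g l))).
  apply: eq_bigr => k _; have kn : (k <= n)%N by rewrite -ltnS.
  rewrite (sum_tail (fun l => (y ^+ (k + l)) n *: (f k * g l))) // big_mkcond.
  apply: eq_bigr => l _; case: ifP => // /negbT; rewrite -ltnNge => nkl.
  by rewrite ser_exp_small // scale0r.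
transitivity (\sum_(i < n.+1) \sum_(k < n.+1) \sum_(l < n.+1)
    (((y ^+ k) i * (y ^+ l) (n - i)%N) *: (f k * g l))).
  rewrite [RHS]exchange_big; apply: eq_bigr => k _; rewrite [RHS]exchange_big /=.
  by apply: eq_bigr => l _; rewrite exprD serME scaler_suml.
apply: eq_bigr => i _; have iM : (i < n.+1)%N by [].
rewrite (ser_shift_widen f iM) (@ser_shift_widen g (n - i)%N n.+1) ?ltnS ?leq_subr //.
rewrite mulr_suml; apply: eq_bigr => k _; rewrite mulr_sumr; apply: eq_bigr => l _.
by rewrite -scalerAl -scalerAr scalerA.
Qed.

HB.instance Definition _ := GRing.isZmodMorphism.Build (ser A) (ser A) ser_shift
  ser_shift_is_zmod.
HB.instance Definition _ := GRing.isMonoidMorphism.Build (ser A) (ser A) ser_shift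
  ser_shift_is_monoid.

(** y = x + c x^2 + ... makes the shift unitriangular on coefficients; this gives its injectivity
    and, by recursion, its surjectivity. *)
Lemma ser_shift_lead n : (y ^+ n) n = 1.
Proof.
elim: n => // n IH; rewrite exprS serME 2!big_ord_recl /= mul0r add0r expr0 mul1r.
rewrite subSS subn0 IH big1 ?addr0 // => i _.
by rewrite ser_exp_small ?mulr0 //= /bump /=; have := ltn_ord i; lia.
Qed.

Lemma ser_shiftE f n :
  ser_shift f n = f n + \sum_(r < n) (y ^+ r) n *: f r.
Proof.
by rewrite (@ser_shift_widen _ n n.+1) // big_ord_recr /= ser_shift_lead
  scale1r addrC.
Qed.

Lemma ser_shift_inj : injective ser_shift.
Proof.
move=> f g fg; suff H n : forall m, (m < n)%N -> f m = g m.
  by apply/funext => n; apply: (H n.+1).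
elim: n => // n IH m; rewrite ltnS leq_eqVlt => /orP[/eqP->|]; last exact: IH.
have := congr1 (fun h : ser A => h n) fg; rewrite /= !ser_shiftE.
rewrite (eq_bigr (fun r : 'I_n => (y ^+ r) n *: g r)); first exact: addIr.
by move=> r _; rewrite IH.
Qed.

Lemma ser_shift_surj g : exists f, ser_shift f = g.
Proof.
have [|f fE] := @ser_rec A (fun n f => g n - \sum_(r < n) (y ^+ r) n *: f r).
  move=> n f f' e; congr (_ - _); apply: eq_bigr => r _; congr (_ *: _).
  exact: e.
by exists f; apply/funext => n; rewrite ser_shiftE [f n]fE subrK.
Qed.

Lemma ser_shift_reflect f : fps_reflect f c = ser_shift (ser_neg f).
Proof.
apply/funext => n; rewrite (@ser_shift_widen _ n n.+1) // /fps_reflect /fps_subst.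
apply: eq_bigr => r _; rewrite fps_expE.
have -> : (fun n => - fps_inv c n) = - y :> ser F by [].
rewrite exprNn -signr_odd /ser_neg -[in RHS]signr_odd.
case: (odd r); rewrite ?expr1 ?expr0 ?mul1r // !mulN1r.
by rewrite serNE scaleNr scalerN.
Qed.

Lemma ser_shift_alg (f : ser F) :
  ser_shift (ser_alg A f) = ser_alg A (fps_shift (f : nat -> F^o) c).
Proof.
apply/funext => n; rewrite (@ser_shift_widen _ n n.+1) //.
rewrite [RHS](rmorph_sum (in_alg A)); apply: eq_bigr => r _.
by rewrite fps_expE /= scalerA.
Qed.

End Shift.

Section ShiftMap.
Variables (F : fieldType) (A B : algType F) (c : F) (f : {rmorphism A -> B}).
Hypothesis fZ : scalable f.

Lemma ser_shift_map h : ser_map f (ser_shift c h) = ser_shift c (ser_map f h).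
Proof.
apply/funext => n; rewrite /ser_map !(@ser_shift_widen _ _ _ _ n n.+1) //.
by rewrite rmorph_sum; apply: eq_bigr => r _; rewrite fZ.
Qed.

End ShiftMap.

Section RationalSeries.
Variable F : fieldType.

Definition geo (c : F) : ser F := fps_geo c.

Lemma geoE c : (1 - serC c * serX) * geo c = 1.
Proof.
rewrite mulrBl mul1r -mulrA; apply/funext => -[|n].
  by rewrite serBE serCM serXM0 mulr0 subr0.
by rewrite serBE serCM serXMS /geo /fps_geo exprS subrr.
Qed.

Lemma fps_linE (a b : F) : fps_lin a b = serC a + serC b * serX :> ser F.
Proof.
apply/funext => -[|[|n]]; rewrite serDE serCM /serC /serX /= ?mulr0n.
- by rewrite mulr0 addr0.
- by rewrite add0r mulr1.
by rewrite add0r mulr0.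
Qed.

Definition shiftF (c : F) (f : ser F) : ser F := fps_shift (f : nat -> F^o) c.

Lemma shiftF_is_zmod c : zmod_morphism (shiftF c).
Proof. exact: (@ser_shift_is_zmod F F^o c). Qed.

Lemma shiftF_is_monoid c : monoid_morphism (shiftF c).
Proof. exact: (@ser_shift_is_monoid F F^o c). Qed.

HB.instance Definition _ c := GRing.isZmodMorphism.Build (ser F) (ser F)
  (shiftF c) (shiftF_is_zmod c).
HB.instance Definition _ c := GRing.isMonoidMorphism.Build (ser F) (ser F)
  (shiftF c) (shiftF_is_monoid c).

Lemma shiftFC c a : shiftF c (serC a) = serC a.
Proof.
apply/funext => n; rewrite [LHS](@ser_shift_widen F F^o c (serC a) n n.+1) //.
rewrite big_ord_recl big1 ?addr0 => [|r _].
  by rewrite expr0 /serC ser1E mulr1n; case: n => [|n]; rewrite ?scale1r // scale0r.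
by rewrite /serC mulr0n scaler0.
Qed.

Lemma shiftFX c : (1 - serC c * serX) * shiftF c serX = serX.
Proof.
have -> : shiftF c serX = serX * geo c.
  apply/funext => n; rewrite [LHS](@ser_shift_widen F F^o c serX n n.+2); last by lia.
  rewrite 2!big_ord_recl big1 => [|r _]; last by rewrite /serX scaler0.
  rewrite /= addr0 [X in X + _]scaler0 add0r expr1.
  case: n => [|n]; first by rewrite serXM0; exact: mul0r.
  by rewrite serXMS; exact: mulr1.
by rewrite mulrCA geoE mulr1.
Qed.

Lemma shiftF_linD c e b :
  shiftF c (1 + serC e * serX + serC b * serX) =
  1 + serC e * shiftF c serX + serC b * shiftF c serX.
Proof. by rewrite !rmorphD !rmorphM rmorph1 /= !shiftFC. Qed.

Lemma shiftF_linB c e b :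
  shiftF c (1 + serC e * serX - serC b * serX) =
  1 + serC e * shiftF c serX - serC b * shiftF c serX.
Proof. by rewrite rmorphB rmorphD !rmorphM rmorph1 /= !shiftFC. Qed.

End RationalSeries.

(** * Identification of the scalar solution with K(u;a) *)

Section ScalarTheorem.
Variables (F : numFieldType) (N : nat).
Hypothesis N5 : (5 <= N)%N.
Local Notation kap := (kappa F N).
Local Notation d := (dpar F N).
Local Notation c := (kap / 2%:R).
Local Notation x := (serX : ser F).
Let N0 : (0 < N)%N. Proof. by lia. Qed.
Let N1 : (N.-1 < N)%N. Proof. by lia. Qed.
Let i0 : 'I_N := Ordinal N0.
Let i1 : 'I_N := Ordinal N1.

Lemma Kser_entry a i j : (fun r => Kser N a r i j) =
  ((1 - serC a * x) * (1 - serC (2%:R * d - a) * x) * (geo d * geo d)) *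
  ((1 - 2%:R * geo a *+ (i == i0) - 2%:R * geo (2%:R * d - a) *+ (i == i1))
    *+ (i == j)).
Proof.
have -> : (1 - serC a * x) * (1 - serC (2%:R * d - a) * x) * (geo d * geo d) =
    Kprefactor N a :> ser F.
  rewrite -[RHS]/((fps_lin 1 (- a) : ser F) * (fps_lin 1 (a - 2%:R * d) : ser F) *
    (geo d * geo d)) !fps_linE !rmorph1 !rmorphB rmorphN.
  by congr (_ * _ * _); ring.
apply/funext => r; rewrite /Kser /fps_scale summxE serME.
apply: eq_bigr => k _; rewrite mxE; congr (_ * _).
rewrite serMnE /Kmx /Ediag !mxE !serBE !serMnE -!val_eqE /= /fps_one ser1E.
have mul2 (f : ser F) n : (2%:R * f) n = 2%:R * f n.
  by rewrite -(rmorph_nat (@serC F)) serCM.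
rewrite !mul2; case: (i =P j :> nat) => [->|ij].
  rewrite !andbb !mulr1n; congr (_ - _ - _).
    by case: eqP => _; rewrite ?mulr1 ?mulr1n ?mulr0 ?mulr0n.
  by case: eqP => _; rewrite ?mulr1 ?mulr1n ?mulr0 ?mulr0n.
have dis k' : ((i : nat) == k') && ((j : nat) == k') = false.
  by apply/negP => /andP[/eqP ik /eqP jk]; apply: ij; rewrite ik.
by rewrite !dis !mulr0 !subr0 !mulr0n.
Qed.

Variables (K Kf : 'M[ser F]_N).
Hypothesis hrefl : reflection (rminusF F N) (rplusF F N)
  (map_mx (inx F) K) (map_mx (iny F) K).
Hypothesis hK0 : forall i j, K i j 0%N = gsign F i *+ (i == j).
Hypothesis hfuse :
  rmat N (fuse_D F * (fuse_D F - serC kap * fuse_z F))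
    (fuse_z F * (fuse_D F - serC kap * fuse_z F)) (fuse_z F * fuse_D F)
    *m first K *m contraction =
  fuse_factor F N *: (second (map_mx (@ser_neg F) K) *m contraction).
Hypothesis hKf : forall i j,
  (1 - serC c * x) * shiftF c (K i j) = (1 - serC d * x) * Kf i j.

Theorem scalar_solution : exists (a : F) (g : ser F), even_unital g /\
  forall i j, Kf i j = shiftF c g * (fun r => Kser N a r i j).
Proof.
have N2 : (2 <= N)%N by lia.
have N1' : (1 < N)%N by lia.
pose m : 'I_N := Ordinal N1'.
have gm : gsign F m = 1 by rewrite /gsign /=; case: eqP => // e; lia.
have grm : gsign F (rev_ord m) = 1 by rewrite gsign_rev.
have g0 : gsign F i0 = -1 by rewrite /gsign eqxx.
have g1 : gsign F i1 = -1 by rewrite /gsign eqxx orbT.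
have Kd := offdiag0 hrefl hK0.
have mid i : gsign F i = 1 -> K i i = K m m.
  by move=> gi; apply: (diag_middle hrefl hK0).
have [a alE] : exists a, K i0 i0 * (1 + serC c * x - serC a * x) =
    - (K m m * (1 + serC c * x + serC a * x)).
  by apply: (ratio_solution hrefl hK0 _ _ g0 gm); rewrite -val_eqE /=; lia.
have [a' gaE] : exists a, K i1 i1 * (1 + serC c * x - serC a * x) =
    - (K m m * (1 + serC c * x + serC a * x)).
  by apply: (ratio_solution hrefl hK0 _ _ g1 gm); rewrite -val_eqE /=; lia.
set be := K m m in alE gaE mid; set al := K i0 i0 in alE.
set ga := K i1 i1 in gaE.
have be0 : be 0%N = 1 by rewrite /be hK0 eqxx gm.
have ck : 2%:R * c = kap by rewrite mulrC divfK ?pnatr_eq0.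
(* There are N - 2 = 4 c middle entries, all equal to be. *)
have trK : \sum_s K s s = al + ga + 4%:R * serC c * be.
  have i10 : i1 != i0 by rewrite -val_eqE /=; lia.
  have -> : \sum_s K s s = \sum_s (be + (al - be) *+ (s == i0)
      + (ga - be) *+ (s == i1)).
    apply: eq_bigr => s _; have [->|s0] := eqVneq s i0.
      by rewrite eq_sym (negbTE i10) mulr1n mulr0n addr0 addrC subrK.
    have [->|s1] := eqVneq s i1; first by rewrite mulr1n mulr0n addr0 addrC subrK.
    rewrite !mulr0n !addr0; apply: mid; rewrite /gsign.
    by move: s0 s1; rewrite -!val_eqE /= => /negbTE-> /negbTE->.
  have pick (t : ser F) k : \sum_(s < N) t *+ (s == k) = t.
    rewrite (bigD1 k) //= eqxx mulr1n big1 ?addr0 // => s /negbTE->.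
    exact: mulr0n.
  rewrite !big_split /= !pick sumr_const card_ord -(mulr_natr be N).
  have -> : N%:R = 4%:R * serC c + 2%:R :> ser F.
    rewrite -!(rmorph_nat (@serC F)) -rmorphM -rmorphD; congr serC.
    by rewrite /kappa; field.
  ring.
have traceE : (2%:R - 2%:R * serC c * x) * (2%:R - x) * be
    + 2%:R * x * (al + ga + 4%:R * serC c * be) =
    (2%:R - x) * (2%:R + 2%:R * serC c * x) * ser_neg be.
  have dn i j : i != j -> (map_mx (@ser_neg F) K) i j = 0.
    by move=> ij; rewrite mxE Kd // rmorph0.
  (* At a middle index, m and its opposite carry the same series be; a common factor x^2 is
     cancelled below. *)
  have := fusion_diag_entry m Kd dn hfuse.
  rewrite trK !mxE (mid _ grm) -/be.
  have -> : serC kap = 2%:R * serC c.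
    by rewrite -[in LHS]ck rmorphM rmorph_nat.
  rewrite /fuse_D /fuse_z /fuse_factor => e.
  apply/eqP; rewrite -subr_eq0; apply/eqP/serX_reg/serX_reg.
  move/eqP: e; rewrite -subr_eq0 => /eqP e; apply: etrans e; ring.
have [g [g_0 gN gE]] := even_solution be0 alE gaE traceE.
have asum := parameter_sum be0 alE gaE traceE.
exists a, g; split; first exact/even_unitalP.
have c2d : 2%:R * c = 2%:R * d + 1 by rewrite ck dpar_kappa.
(* a + a' = kappa - 1 = 2 d, which explains the root 2 d - a in K(u;a). *)
have ea' : a' = 2%:R * d - a.
  by apply: (addrI a); rewrite asum c2d; ring.
have sc2d : 2%:R * serC c = 2%:R * serC d + 1 :> ser F.
  have := congr1 (@serC F) c2d.
  by rewrite rmorphD !(rmorphM (@serC F) 2%:R) !rmorph_nat rmorph1.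
set y := shiftF c x; have yx : (1 - serC c * x) * y = x := shiftFX c.
have eP b : shiftF c (1 + serC c * x + serC b * x) =
    1 + serC c * y + serC b * y.
  exact: shiftF_linD.
have eN b : shiftF c (1 + serC c * x - serC b * x) =
    1 + serC c * y - serC b * y.
  exact: shiftF_linB.
(* With y = 1/(u - c), this is w + c + b = u + b divided by u; likewise for [linN]. *)
have linP b : (1 - serC c * x) * (1 + serC c * y + serC b * y) = 1 + serC b * x.
  transitivity (1 - serC c * x + (serC c + serC b) * ((1 - serC c * x) * y)).
    by ring.
  by rewrite yx; ring.
have linN b : (1 - serC c * x) * (1 + serC c * y - serC b * y) = 1 - serC b * x.
  transitivity (1 - serC c * x + (serC c - serC b) * ((1 - serC c * x) * y)).
    by ring.
  by rewrite yx; ring.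
have reg1 (f : ser F) : (1 - serC d * x) * f = 0 -> f = 0.
  apply: ser_field_lreg; rewrite serBE ser1E serCM /serX mulr0 subr0.
  exact: oner_neq0.
have Kmid : Kf m m = shiftF c g *
    ((1 - serC a * x) * (1 - serC (2%:R * d - a) * x) * (geo d * geo d)).
  have h : (2%:R + y) * shiftF c be = 2%:R * (shiftF c g *
      ((1 + serC c * y - serC a * y) * (1 + serC c * y - serC a' * y))).
    rewrite -!eN -!(rmorphM (shiftF c)) -[2%:R in LHS](rmorph_nat (shiftF c)).
    rewrite -(rmorphD (shiftF c)) -(rmorphM (shiftF c)) gE.
    by rewrite (rmorphM (shiftF c) 2%:R) rmorph_nat.
  have := hKf m m; rewrite -/be => hb.
  (* One factor 1 - d x comes from [hKf], the other from (2 + y)(1 - c x) = 2 (1 - d x), valid as 2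
     c = 2 d + 1: together they give the square (u - d)^2 in K(u;a). *)
  have h2 : 2%:R * ((1 - serC d * x) * ((1 - serC d * x) * Kf m m)) =
      2%:R * (shiftF c g * ((1 - serC a * x) * (1 - serC a' * x))).
    rewrite -hb; transitivity ((1 - serC c * x) * ((1 - serC c * x) *
      ((2%:R + y) * shiftF c be))).
      transitivity ((1 - serC c * x) * shiftF c be *
        (2%:R * (1 - serC c * x) + (1 - serC c * x) * y)); last by ring.
      rewrite yx [2%:R * (1 - _)]mulrBr mulr1 [2%:R * (serC c * x)]mulrA sc2d.
      ring.
    rewrite h; transitivity (2%:R * shiftF c g *
      ((1 - serC c * x) * (1 + serC c * y - serC a * y)) *
      ((1 - serC c * x) * (1 + serC c * y - serC a' * y))); first by ring.
    by rewrite !linN; ring.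
  have two_reg (f : ser F) : 2%:R * f = 0 -> f = 0.
    by apply: ser_field_lreg; rewrite serMnE ser1E pnatr_eq0.
  have h3 : (1 - serC d * x) * ((1 - serC d * x) * Kf m m) =
      shiftF c g * ((1 - serC a * x) * (1 - serC a' * x)).
    apply/eqP; rewrite -subr_eq0; apply/eqP/two_reg.
    by rewrite mulrBr h2 subrr.
  rewrite -ea' !mulrA -(mulrA (shiftF c g)) -h3.
  transitivity (((1 - serC d * x) * geo d) * ((1 - serC d * x) * geo d) * Kf m m).
    by rewrite geoE !mul1r.
  by ring.
(* The ratio -(1 + b x)/(1 - b x) equals 1 - 2/(1 - b x), the form of the extreme entries of
   K(u;a). *)
have Kend i b : K i i * (1 + serC c * x - serC b * x) =
      - (be * (1 + serC c * x + serC b * x)) ->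
    Kf i i = Kf m m * (1 - 2%:R * geo b).
  move=> /(congr1 (shiftF c)).
  rewrite (rmorphM (shiftF c) (K i i)) (rmorphN (shiftF c)).
  rewrite (rmorphM (shiftF c) be) /= eN eP => h.
  have hb := hKf m m; rewrite -/be in hb.
  have h2 : Kf i i * (1 - serC b * x) = - (Kf m m * (1 + serC b * x)).
    apply/eqP; rewrite -subr_eq0; apply/eqP/reg1.
    transitivity ((1 - serC d * x) * Kf i i * (1 - serC b * x)
      + (1 - serC d * x) * Kf m m * (1 + serC b * x)); first by ring.
    rewrite -hKf -hb -(linN b) -(linP b).
    transitivity ((1 - serC c * x) * (1 - serC c * x) *
      (shiftF c (K i i) * (1 + serC c * y - serC b * y) +
       shiftF c be * (1 + serC c * y + serC b * y))); first by ring.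
    by rewrite h addNr mulr0.
  rewrite -[LHS]mulr1 -(geoE b) mulrA h2.
  transitivity (Kf m m * ((1 - serC b * x) * geo b - 2%:R * geo b)).
    by ring.
  by rewrite geoE.
have Koff i j : i != j -> Kf i j = 0.
  by move=> ij; apply: reg1; rewrite -hKf Kd // (rmorph0 (shiftF c)) mulr0.
move=> i j; rewrite Kser_entry.
have [<-|ij] := eqVneq i j; last by rewrite Koff // mulr0n !mulr0.
rewrite mulr1n mulrA -Kmid.
have i10 : i1 != i0 by rewrite -val_eqE /=; lia.
have [->|n0] := eqVneq i i0.
  by rewrite eq_sym (negbTE i10) mulr1n mulr0n subr0; apply: Kend.
have [->|n1] := eqVneq i i1.
  by rewrite mulr1n mulr0n subr0 -ea'; apply: Kend.
rewrite !mulr0n !subr0 mulr1; apply/eqP; rewrite -subr_eq0; apply/eqP/reg1.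
rewrite mulrBr -!hKf mid ?subrr // /gsign.
by move: n0 n1; rewrite -!val_eqE /= => /negbTE-> /negbTE->.
Qed.

End ScalarTheorem.

(** * Characters of the twisted Yangian *)

Section MapRTT.
Variables (F : fieldType) (N : nat) (A A' : algType F) (f : {rmorphism A -> A'}).
Hypothesis fA : forall c : F, f c%:A = c%:A.
Variable T : nat -> 'M[A]_N.
Local Notation fT := (fun r => map_mx f (T r)).

Lemma map_scal_mx m (M : 'M[F]_m) : map_mx f (scal_mx A M) = scal_mx A' M.
Proof. by apply/matrixP => i j; rewrite !mxE /= fA. Qed.

Lemma map_mul_uv m c (H : int -> int -> 'M[A]_m) (H' : int -> int -> 'M[A']_m) :
  (forall r s, map_mx f (H r s) = H' r s) ->
  forall r s, map_mx f (mul_uv c H r s) = mul_uv c H' r s.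
Proof. by move=> e r s; rewrite /mul_uv !map_mxB map_mxZ !e fA. Qed.

Lemma map_T1T2 r s : map_mx f (T1T2 T r s) = T1T2 fT r s.
Proof.
case: r s => [r|r] [s|s] /=; rewrite ?map_mx0 //.
by rewrite /T1 /T2 map_mxM !map_mxT !map_mx1.
Qed.

Lemma map_T2T1 r s : map_mx f (T2T1 T r s) = T2T1 fT r s.
Proof.
case: r s => [r|r] [s|s] /=; rewrite ?map_mx0 //.
by rewrite /T1 /T2 map_mxM !map_mxT !map_mx1.
Qed.

Lemma map_rtt_lhs r s : map_mx f (rtt_lhs T r s) = rtt_lhs fT r s.
Proof.
rewrite /rtt_lhs map_mxD map_mxB !map_mxM !map_scal_mx.
by rewrite !(map_mul_uv _ map_T1T2) (map_mul_uv _ (map_mul_uv _ map_T1T2)).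
Qed.

Lemma map_rtt_rhs r s : map_mx f (rtt_rhs T r s) = rtt_rhs fT r s.
Proof.
rewrite /rtt_rhs map_mxD map_mxB !map_mxM !map_scal_mx.
by rewrite !(map_mul_uv _ map_T2T1) (map_mul_uv _ (map_mul_uv _ map_T2T1)).
Qed.

End MapRTT.

Lemma morph_scalar (F : fieldType) (A A' : algType F) (f : {lrmorphism A -> A'})
  (c : F) : f c%:A = c%:A.
Proof. by rewrite linearZ rmorph1. Qed.

Section SeriesMatrices.
Variables (F : fieldType) (N : nat) (A : algType F).

Lemma ser_mxM (P Q : nat -> 'M[A]_N) :
  ser_mx (fps_mul P Q) = ser_mx P *m ser_mx Q.
Proof.
apply/matrixP => i j; rewrite !mxE; apply/funext => n.
rewrite /fps_mul summxE ser_sumE.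
under eq_bigr => k _ do rewrite mxE.
rewrite exchange_big; apply: eq_bigr => l _; rewrite serME.
by apply: eq_bigr => k _; rewrite !mxE.
Qed.

Variables (T : nat -> 'M[A]_N) (c : F).

Lemma ser_mx_shift :
  ser_mx (fun r => \matrix_(i, j) fps_shift (fun k => T k i j) c r : 'M_N) =
  map_mx (@ser_shift F A c) (ser_mx T).
Proof. by apply/matrixP => k l; rewrite !mxE; apply/funext => r; rewrite mxE. Qed.

Lemma ser_mx_reflect :
  ser_mx (fun r => \matrix_(i, j) fps_reflect (fun k => ttr (T k) i j) c r : 'M_N) =
  map_mx (@ser_shift F A c) (ttr (map_mx (@ser_neg A) (ser_mx T))).
Proof.
apply/matrixP => k l; rewrite !mxE -ser_shift_reflect; apply/funext => r.
by rewrite mxE; congr (fps_reflect _ _ _); apply/funext => s; rewrite !mxE.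
Qed.

Lemma ser_mx_scal (G : nat -> 'M[F]_N) :
  ser_mx (fun r => scal_mx A (G r)) =
  map_mx (ser_alg A) (\matrix_(i, j) (fun r => G r i j : F)).
Proof. by apply/matrixP => k l; rewrite !mxE; apply/funext => r; rewrite mxE. Qed.

End SeriesMatrices.

Lemma map_Sser (F : numFieldType) N (A : algType F) (T : nat -> 'M[A]_N)
    (L : nzRingType) (f : {rmorphism ser A -> L}) :
  map_mx f (Sser T) = map_mx f (ser_mx T) *m
    map_mx f (map_mx (ser_alg A) (gser F N)) *m
    map_mx f (ttr (map_mx (@ser_neg A) (ser_mx T))).
Proof. by rewrite /Sser 2!map_mxM. Qed.

Lemma ser_mxE (F : fieldType) N (A : algType F) (T : nat -> 'M[A]_N) i j :
  ser_mx T i j = (fun n => T n i j).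
Proof. by rewrite mxE. Qed.

Lemma scalemx_eq_entry (L : nzRingType) (R : Type) n (f : R -> L) (a b : L)
    (M : 'M[R]_n) (M' : 'M[L]_n) i j :
  a *: map_mx f M = b *: M' -> a * f (M i j) = b * M' i j.
Proof. by move=> /matrixP/(_ i j); rewrite !mxE. Qed.

Lemma scalemx_map_eq (L : nzRingType) (R S R' : Type) n (f : S -> L) (h : R -> S)
    (h' : R' -> L) (a b : L) (M : 'M[R]_n) (M' : 'I_n -> 'I_n -> R') :
  (forall i j, a * f (h (M i j)) = b * h' (M' i j)) ->
  a *: map_mx f (map_mx h M) = b *: map_mx h' (\matrix_(i, j) M' i j).
Proof. by move=> e; apply/matrixP => i j; rewrite !mxE e. Qed.

Lemma mulmx_scalars (L : nzRingType) N (a b : L) (X G H Z : 'M[L]_N) :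
  central a -> central b -> a *: G = b *: H ->
  a *: (X *m G *m Z) = b *: (X *m H *m Z).
Proof.
by move=> ca cb e; rewrite scalemxAl -mulmxZc // e mulmxZc // -scalemxAl.
Qed.

Section YangianSeries.
Variables (F : numFieldType) (N : nat).
Local Notation A := (yangian F N).
Local Notation T := (yangian_T F N).
Local Notation pi := (quot_pi (@rtt_proper F N)).

Lemma yangian_rtt r s : rtt_lhs T r s = rtt_rhs T r s.
Proof.
have fA (c : F) : pi c%:A = c%:A by exact: (@morph_scalar F _ A pi c).
rewrite -(map_rtt_lhs fA) -(map_rtt_rhs fA).
apply/matrixP => i j; rewrite [LHS]mxE [RHS]mxE; apply: quot_pi_eq.
apply/ideal_predP; apply: ideal_gen_rel; rewrite /rtt_rels.
by exists r, s, i, j.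
Qed.

Lemma yangian_rtt_series : rtt_series T.
Proof. exact/rtt_seriesP/yangian_rtt. Qed.

Local Notation c := (kappa F N / 2%:R).
Local Notation d := (dpar F N).
Local Notation x := (serX : ser F).
Local Notation Ts := (ser_mx T).
Local Notation Tn := (map_mx (@ser_neg A) Ts).

Hypothesis N2 : (2 <= N)%N.

Lemma Gser_entry i j : (fun r => Gser F N r i j) =
  geo d * ((serC (gsign F i) - serC d * x) *+ (i == j)).
Proof.
apply/funext => r; rewrite /Gser /fps_scale summxE serME.
apply: eq_bigr => k _; rewrite mxE; congr (_ * _).
rewrite serMnE serBE serCM; case: (r - k)%N => [|[|n]] /=.
- by rewrite Gmx_gsign // /serC mulr1n /serX mulr0 subr0.
- by rewrite mxE /serC mulr0n sub0r /serX mulr1.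
by rewrite mxE /serC /serX mulr0 mulr0n subr0 mul0rn.
Qed.

(** Both sides are an entry of (u G - d)/u: on the left 1 - c x = w/u clears the division of [gser]
    by w, on the right 1 - d x = (u - d)/u clears the denominator of G(u). *)
Lemma gser_shiftF i j :
  (1 - serC c * x) * shiftF c (gser F N i j) =
  (1 - serC d * x) * (fun r => Gser F N r i j).
Proof.
rewrite Gser_entry mulrA geoE mul1r mxE (rmorphMn (shiftF c)) /=.
rewrite mulrnAr; congr (_ *+ _).
have -> : shiftF c ((1 + serC c * x) * serC (gsign F i) - serC d * x) =
    (1 + serC c * shiftF c x) * serC (gsign F i) - serC d * shiftF c x.
  rewrite (rmorphB (shiftF c)) (rmorphM (shiftF c) (1 + _)).
  rewrite (rmorphD (shiftF c) 1) (rmorphM (shiftF c) (serC c)).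
  by rewrite (rmorphM (shiftF c) (serC d)) rmorph1 /= !shiftFC.
have yx := shiftFX c; set y := shiftF c x in yx *.
transitivity (((1 - serC c * x) + serC c * ((1 - serC c * x) * y)) *
  serC (gsign F i) - serC d * ((1 - serC c * x) * y)); first by ring.
by rewrite yx; ring.
Qed.

Lemma gser_shift i j :
  ser_alg A (1 - serC c * x) * ser_shift c (ser_alg A (gser F N i j)) =
  ser_alg A (1 - serC d * x) * ser_alg A (fun r => Gser F N r i j).
Proof.
rewrite ser_shift_alg -[RHS](rmorphM (ser_alg A)) -gser_shiftF.
exact/esym/(rmorphM (ser_alg A)).
Qed.

Lemma yangian_S_shift i j :
  ser_alg A (1 - serC c * x) * ser_shift c (Sser T i j) =
  ser_alg A (1 - serC d * x) * (fun r => yangian_S F N r i j).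
Proof.
have eS : ser_mx (yangian_S F N) = map_mx (@ser_shift F A c) Ts *m
    map_mx (ser_alg A) (\matrix_(i, j) (fun r => Gser F N r i j : F)) *m
    map_mx (@ser_shift F A c) (ttr Tn).
  rewrite -ser_mx_shift -ser_mx_reflect -ser_mx_scal /yangian_S 2!ser_mxM.
  by [].
have eS' : map_mx (@ser_shift F A c) (Sser T) = map_mx (@ser_shift F A c) Ts *m
    map_mx (@ser_shift F A c) (map_mx (ser_alg A) (gser F N)) *m
    map_mx (@ser_shift F A c) (ttr Tn) by exact: map_Sser.
have eG : ser_alg A (1 - serC c * x) *:
      map_mx (@ser_shift F A c) (map_mx (ser_alg A) (gser F N)) =
    ser_alg A (1 - serC d * x) *:
      map_mx (ser_alg A) (\matrix_(i, j) (fun r => Gser F N r i j : F)).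
  exact: scalemx_map_eq gser_shift.
have cs f := @central_ser_alg F A f.
rewrite -ser_mxE; apply: scalemx_eq_entry.
by rewrite eS eS'; apply: mulmx_scalars.
Qed.

End YangianSeries.

Lemma map_mx_inj (R S : Type) (f : R -> S) m n :
  injective f -> injective (fun M : 'M[R]_(m, n) => map_mx f M).
Proof.
move=> inj M M' e; apply/matrixP => i j; apply: inj.
by have := congr1 (fun Z : 'M[S]_(m, n) => Z i j) e; rewrite !mxE.
Qed.

Section Transfer.
Variables (L L' : nzRingType) (f : {rmorphism L -> L'}) (N : nat).

Lemma reflection_transfer (R R' : 'M[L]_(N * N)) (X Y : 'M[L]_N) S S' X' Y' :
  map_mx f R = S -> map_mx f R' = S' -> map_mx f X = X' -> map_mx f Y = Y' ->
  reflection R R' X Y -> reflection S S' X' Y'.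
Proof. by move=> <- <- <- <-; apply: reflection_map. Qed.

(** Applied to the inclusion of the twisted Yangian: the equation mentions only entries of the
    subalgebra, although its derivation uses T. *)
Lemma reflection_descent (R R' : 'M[L]_(N * N)) (X Y : 'M[L]_N) S S' X' Y' :
  injective f ->
  map_mx f R = S -> map_mx f R' = S' -> map_mx f X = X' -> map_mx f Y = Y' ->
  reflection S S' X' Y' -> reflection R R' X Y.
Proof.
move=> inj <- <- <- <- h; apply: (map_mx_inj inj).
by rewrite !map_mxM !map_first !map_second; apply: h.
Qed.

Lemma fusion_transfer a b c e (X Y : 'M[L]_N) a' b' c' e' X' Y' :
  f a = a' -> f b = b' -> f c = c' -> f e = e' ->
  map_mx f X = X' -> map_mx f Y = Y' ->
  rmat N a b c *m first X *m contraction = e *: (second Y *m contraction) ->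
  rmat N a' b' c' *m first X' *m contraction = e' *: (second Y' *m contraction).
Proof. by move=> <- <- <- <- <- <-; apply: fusion_rmat_map. Qed.

Lemma fusion_descent a b c e (X Y : 'M[L]_N) a' b' c' e' X' Y' : injective f ->
  f a = a' -> f b = b' -> f c = c' -> f e = e' ->
  map_mx f X = X' -> map_mx f Y = Y' ->
  rmat N a' b' c' *m first X' *m contraction = e' *: (second Y' *m contraction) ->
  rmat N a b c *m first X *m contraction = e *: (second Y *m contraction).
Proof.
move=> inj <- <- <- <- <- <- h; apply: (map_mx_inj inj).
by rewrite map_mxZ !map_mxM map_first map_second map_rmat map_contraction.
Qed.

End Transfer.

Section AlgebraMaps.
Variables (F : fieldType) (A B : algType F) (v : {rmorphism A -> B}).
Hypothesis vA : forall k, v k%:A = k%:A.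

Lemma ser_map_alg a : ser_map v (ser_alg A a) = ser_alg B a.
Proof. by apply/funext => n; apply: vA. Qed.

Lemma ser_map_scale a h : ser_map v (ser_alg A a * h) = ser_alg B a * ser_map v h.
Proof.
exact: etrans (rmorphM (ser_map v) _ _) (congr1 (fun t => t * _) (ser_map_alg a)).
Qed.

Lemma ser2_map_alg a : ser_map (ser_map v) (ser2_alg A a) = ser2_alg B a.
Proof. by apply/funext => n; apply: ser_map_alg. Qed.

Lemma map_inx N (X : 'M[ser A]_N) :
  map_mx (ser_map (ser_map v)) (map_mx (inx A) X) =
  map_mx (inx B) (map_mx (ser_map v) X).
Proof. by apply/matrixP => i j; rewrite !mxE; apply: ser_mapC. Qed.

Lemma map_iny N (X : 'M[ser A]_N) :
  map_mx (ser_map (ser_map v)) (map_mx (iny A) X) =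
  map_mx (iny B) (map_mx (ser_map v) X).
Proof.
apply/matrixP => i j; rewrite !mxE; apply/funext => s; exact: ser_mapC.
Qed.

Lemma ser_shift_morph c h : ser_map v (ser_shift c h) = ser_shift c (ser_map v h).
Proof.
apply: ser_shift_map => k y.
by rewrite -mulr_algl rmorphM vA mulr_algl.
Qed.

End AlgebraMaps.

Section ScalarMaps.
Variables (F : fieldType) (A : algType F) (chi : {rmorphism A -> F}).
Hypothesis chiA : forall k, chi k%:A = k.

Lemma ser_map_scal a : ser_map chi (ser_alg A a) = a.
Proof. by apply/funext => n; apply: chiA. Qed.

Lemma ser_map_scal_scale a h : ser_map chi (ser_alg A a * h) = a * ser_map chi h.
Proof.
exact: etrans (rmorphM (ser_map chi) _ _) (congr1 (fun t => t * _) (ser_map_scal a)).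
Qed.

Lemma ser2_map_scal a : ser_map (ser_map chi) (ser2_alg A a) = a.
Proof. by apply/funext => n; apply: ser_map_scal. Qed.

Lemma map_inx_scal N (X : 'M[ser A]_N) :
  map_mx (ser_map (ser_map chi)) (map_mx (inx A) X) =
  map_mx (inx F) (map_mx (ser_map chi) X).
Proof. by apply/matrixP => i j; rewrite !mxE; apply: ser_mapC. Qed.

Lemma map_iny_scal N (X : 'M[ser A]_N) :
  map_mx (ser_map (ser_map chi)) (map_mx (iny A) X) =
  map_mx (iny F) (map_mx (ser_map chi) X).
Proof.
apply/matrixP => i j; rewrite !mxE; apply/funext => s; exact: ser_mapC.
Qed.

Lemma ser_shift_scal c h : ser_map chi (ser_shift c h) = shiftF c (ser_map chi h).
Proof.
apply/funext => n; rewrite /ser_map [in LHS](@ser_shift_widen _ _ _ _ n n.+1) //.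
rewrite [RHS](@ser_shift_widen F F^o c _ n n.+1) // rmorph_sum.
by apply: eq_bigr => r _; rewrite -mulr_algl rmorphM chiA.
Qed.

End ScalarMaps.

Lemma rmat_congr (L : nzRingType) N (a a' b b' c c' : L) :
  a = a' -> b = b' -> c = c' -> rmat N a b c = rmat N a' b' c'.
Proof. by move=> -> -> ->. Qed.

Lemma map_rser (F : numFieldType) N (A B : algType F) (v : {rmorphism A -> B})
    (D z : ser (ser F)) : (forall k, v k%:A = k%:A) ->
  map_mx (ser_map (ser_map v)) (rser N A D z) = rser N B D z.
Proof.
by move=> vA; apply: etrans (map_rmat _ _ _ _ _) _;
  apply: rmat_congr; apply: (ser2_map_alg vA).
Qed.

Lemma map_rser_scal (F : numFieldType) N (A : algType F) (chi : {rmorphism A -> F})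
    (D z : ser (ser F)) : (forall k, chi k%:A = k) ->
  map_mx (ser_map (ser_map chi)) (rser N A D z) =
  rmat N (D * (D - konst F (kappa F N) * z)) (z * (D - konst F (kappa F N) * z))
    (z * D).
Proof.
by move=> chiA; apply: etrans (map_rmat _ _ _ _ _) _;
  apply: rmat_congr; apply: (ser2_map_scal chiA).
Qed.

Section CharacterSolution.
Variables (F : numFieldType) (N : nat).
Hypothesis N5 : (5 <= N)%N.
Local Notation c := (kappa F N / 2%:R).
Local Notation d := (dpar F N).
Local Notation x := (serX : ser F).
Variables (A Y : algType F) (v : {rmorphism Y -> A}) (chi : {rmorphism Y -> F}).
Hypothesis vA : forall k, v k%:A = k%:A.
Hypothesis v_inj : injective v.
Hypothesis chiA : forall k, chi k%:A = k.
Variables (T : nat -> 'M[A]_N) (SB : 'I_N -> 'I_N -> ser Y).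
Hypothesis hT : rtt_series T.
Hypothesis hS : forall i j,
  ser_alg A (1 - serC c * x) * ser_shift c (Sser T i j) =
  ser_alg A (1 - serC d * x) * ser_map v (SB i j).
Hypothesis hS0 : forall i j, chi (SB i j 0%N) = gsign F i *+ (i == j).

(** Surjectivity of the shift over Y produces the series of S in w with coefficients in Y;
    injectivity of the shift over A identifies its image with [Sser]. *)
Lemma unshifted_exists : exists KB : 'M[ser Y]_N,
  map_mx (ser_map v) KB = Sser T /\
  forall i j, ser_alg Y (1 - serC c * x) * ser_shift c (KB i j) =
    ser_alg Y (1 - serC d * x) * SB i j.
Proof.
(* geo c is the inverse of 1 - c x, so the right-hand side is (1 - d x)/(1 - c x) times the given
   series. *)
have ex i j : exists f, ser_shift c f =
    ser_alg Y (geo c * (1 - serC d * x)) * SB i j by apply: ser_shift_surj.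
pose KB : 'M[ser Y]_N := \matrix_(i, j) projT1 (cid (ex i j)).
have KBE i j : ser_shift c (KB i j) = ser_alg Y (geo c * (1 - serC d * x)) * SB i j.
  by rewrite mxE; case: (cid (ex i j)).
have KBE' i j : ser_alg Y (1 - serC c * x) * ser_shift c (KB i j) =
    ser_alg Y (1 - serC d * x) * SB i j.
  by rewrite KBE mulrA -(rmorphM (ser_alg Y)) mulrA geoE mul1r.
exists KB; split=> //; apply/matrixP => i j; rewrite mxE.
apply: (@ser_shift_inj F A c); rewrite -(ser_shift_morph vA).
have e1 f : ser_alg A (1 - serC c * x) * f = 0 -> f = 0.
  move=> /(congr1 (fun t => ser_alg A (geo c) * t)).
  by rewrite mulr0 mulrA -(rmorphM (ser_alg A)) mulrC geoE rmorph1 mul1r.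
apply/eqP; rewrite -subr_eq0; apply/eqP/e1; rewrite mulrBr hS.
by rewrite -!(ser_map_scale vA) KBE' subrr.
Qed.

Theorem character_solution : exists (a : F) (g : ser F), even_unital g /\
  forall i j, ser_map chi (SB i j) = shiftF c g * (fun r => Kser N a r i j).
Proof.
have N2 : (2 <= N)%N by lia.
have [KB [eKB hKB]] := unshifted_exists.
pose K := map_mx (ser_map chi) KB.
pose Kf : 'M[ser F]_N := \matrix_(i, j) ser_map chi (SB i j).
have KfE i j : Kf i j = ser_map chi (SB i j) by rewrite mxE.
have KE i j : K i j = ser_map chi (KB i j) by rewrite mxE.
have hKf i j : (1 - serC c * x) * shiftF c (K i j) = (1 - serC d * x) * Kf i j.
  have := congr1 (ser_map chi) (hKB i j).
  by rewrite 2!(ser_map_scal_scale chiA) (ser_shift_scal chiA) KfE KE.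
have hK0 i j : K i j 0%N = gsign F i *+ (i == j).
  rewrite KE -hS0 /ser_map; congr (chi _).
  have := congr1 (fun f : ser Y => f 0%N) (hKB i j); rewrite /= 2!serM0.
  rewrite ser_shiftE big_ord0 addr0.
  have at0 b : ser_alg Y (1 - serC b * x) 0%N = 1.
    rewrite /ser_alg /= /ser_map /= serBE serCM /serX mulr0 subr0.
    exact: scale1r.
  by rewrite !at0 !mul1r.
have vv : injective (ser_map (ser_map v)).
  exact: (ser_map_inj (ser_map_inj v_inj)).
have hrefl : reflection (rminusF F N) (rplusF F N)
    (map_mx (inx F) K) (map_mx (iny F) K).
  have hY : reflection (rminus N Y) (rplus N Y)
      (map_mx (inx Y) KB) (map_mx (iny Y) KB).
    apply: (reflection_descent vv (map_rser _ _ _ vA) (map_rser _ _ _ vA)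
      (etrans (map_inx v KB) (congr1 _ eKB)) (etrans (map_iny v KB) (congr1 _ eKB))).
    exact: reflection_Sser.
  exact: (reflection_transfer (map_rser_scal _ _ _ chiA) (map_rser_scal _ _ _ chiA)
    (map_inx_scal chi KB) (map_iny_scal chi KB) hY).
have eneg : map_mx (ser_map v) (map_mx (@ser_neg Y) KB) =
    map_mx (@ser_neg A) (Sser T).
  by rewrite -eKB; apply/matrixP => i j; rewrite !mxE ser_map_neg.
have eneg' : map_mx (ser_map chi) (map_mx (@ser_neg Y) KB) = map_mx (@ser_neg F) K.
  by apply/matrixP => i j; rewrite !mxE ser_map_neg.
have sv a := ser_map_alg vA a; have sc a := ser_map_scal chiA a.
have hY : fuse N Y *m first KB *m contraction =
    ser_alg Y (fuse_factor F N) *: (second (map_mx (@ser_neg Y) KB) *m contraction).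
  exact: (fusion_descent (ser_map_inj v_inj) (sv _) (sv _) (sv _) (sv _) eKB eneg
    (fusion_Sser N2 hT)).
have hfuse := fusion_transfer (sc _) (sc _) (sc _) (sc _) (erefl K) eneg' hY.
have [a [g [ge hg]]] := scalar_solution N5 hrefl hK0 hfuse hKf.
by exists a, g; split=> // i j; rewrite -KfE hg.
Qed.

End CharacterSolution.

(** * Universal properties and the automorphisms nu_g *)

Section FreeLift.
Variables (F : fieldType) (G : choiceType) (A : algType F) (h : G -> A).

Definition monom_lift (m : {fmonom G}) : A := \prod_(i <- (m : seq G)) h i.

Lemma monom_lift_mmorphism : mmorphism monom_lift.
Proof.
by split=> [m1 m2|]; rewrite /monom_lift ?fmM ?big_cat ?fm1 ?big_nil.
Qed.

HB.instance Definition _ := isMultiplicative.Build {fmonom G} A monom_lift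
  monom_lift_mmorphism.

Definition free_lift (x : free_alg F G) : A := mmap (in_alg A) monom_lift x.

Lemma free_lift_is_zmod : zmod_morphism free_lift.
Proof. by move=> x y; apply: mmapB. Qed.

Lemma free_lift_is_monoid : monoid_morphism free_lift.
Proof.
have [|hM h1] := @commr_mmap_is_multiplicative _ _ _ (in_alg A) monom_lift.
  by move=> g m m'; apply: central_scalar.
by split=> [|x y]; [apply: h1 | apply: hM].
Qed.

Lemma free_lift_is_scalable : scalable free_lift.
Proof. by move=> k x; rewrite /free_lift mmapZ /= mulr_algl. Qed.

HB.instance Definition _ := GRing.isZmodMorphism.Build (free_alg F G) A free_lift
  free_lift_is_zmod.
HB.instance Definition _ := GRing.isMonoidMorphism.Build (free_alg F G) A free_lift
  free_lift_is_monoid.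
HB.instance Definition _ := GRing.isScalable.Build F (free_alg F G) A *:%R free_lift
  free_lift_is_scalable.

Lemma free_liftE i : free_lift (free_gen F i) = h i.
Proof.
by rewrite /free_lift /free_gen mmapU /= /monom_lift fmU big_seq1 scale1r mul1r.
Qed.

End FreeLift.

Section QuotientLift.
Variables (F : fieldType) (A B : algType F) (rels : A -> Prop).
Variables (proper : ~ ideal_gen rels 1) (f : {lrmorphism A -> B}).

Definition quotient_lift of (forall x, rels x -> f x = 0) :
  quotient_alg proper -> B := fun q => f (repr q).

Hypothesis f_rels : forall x, rels x -> f x = 0.
Local Notation fq := (quotient_lift f_rels).

(** The kernel of f is a two-sided ideal containing the relations, so the value of f does not depend
    on the representative. *)
Lemma quotient_lift_pi x : fq (quot_pi proper x) = f x.
Proof.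
apply/eqP; rewrite -subr_eq0 /quotient_lift -rmorphB; apply/eqP.
have /ideal_predP/(_ (fun y => f y = 0)) := quot_repr_pi proper x.
apply=> //; split=> [|y z fy fz|a y fy|a y fy]; first exact: rmorph0.
- by rewrite rmorphD /= fy fz addr0.
- by rewrite rmorphM /= fy mulr0.
by rewrite rmorphM /= fy mul0r.
Qed.

Lemma quotient_lift_is_zmod : zmod_morphism fq.
Proof.
move=> p q; rewrite -[p]quot_reprK -[q]quot_reprK -rmorphB.
by rewrite !quotient_lift_pi rmorphB.
Qed.

Lemma quotient_lift_is_monoid : monoid_morphism fq.
Proof.
split=> [|p q]; first by rewrite -(rmorph1 (quot_pi proper)) quotient_lift_pi rmorph1.
rewrite -[p]quot_reprK -[q]quot_reprK -rmorphM.
by rewrite !quotient_lift_pi rmorphM.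
Qed.

Lemma quotient_lift_is_scalable : scalable fq.
Proof.
move=> k q; rewrite -[q]quot_reprK -linearZ.
by rewrite !quotient_lift_pi linearZ.
Qed.

HB.instance Definition _ := GRing.isZmodMorphism.Build (quotient_alg proper) B
  fq quotient_lift_is_zmod.
HB.instance Definition _ := GRing.isMonoidMorphism.Build (quotient_alg proper) B
  fq quotient_lift_is_monoid.
HB.instance Definition _ := GRing.isScalable.Build F (quotient_alg proper) B *:%R
  fq quotient_lift_is_scalable.

End QuotientLift.

Section SubalgebraLift.
Variables (F : fieldType) (A : algType F) (gens : A -> Prop).
Variable (f : {lrmorphism A -> A}).

Lemma subalg_pred_lift :
  (forall x, gens x -> f x \in subalg_pred gens) ->
  forall x, x \in subalg_pred gens -> f x \in subalg_pred gens.
Proof.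
move=> fg x /subalg_predP/(_ [pred z | f z \in subalg_pred gens]).
apply; last exact: fg.
have [h1 hZ hM] := subalg_pred_closed gens.
split=> [|k y z fy fz|y z fy fz]; rewrite inE.
- by rewrite rmorph1.
- by rewrite linearP; apply: hZ.
by rewrite rmorphM; apply: hM.
Qed.

Definition subalg_lift (fg : forall x, gens x -> f x \in subalg_pred gens)
  (y : subalg gens) : subalg gens := Subalg (subalg_pred_lift fg (subalg_valP y)).

Hypothesis fg : forall x, gens x -> f x \in subalg_pred gens.
Local Notation fs := (subalg_lift fg).

Lemma subalg_lift_is_zmod : zmod_morphism fs.
Proof. by move=> x y; apply: val_inj; rewrite /= !raddfB. Qed.

Lemma subalg_lift_is_monoid : monoid_morphism fs.
Proof.
by split=> [|x y]; apply: val_inj; rewrite /= ?rmorph1 ?rmorphM.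
Qed.

Lemma subalg_lift_is_scalable : scalable fs.
Proof. by move=> k x; apply: val_inj; rewrite /= !linearZ. Qed.

HB.instance Definition _ := GRing.isZmodMorphism.Build (subalg gens) (subalg gens)
  fs subalg_lift_is_zmod.
HB.instance Definition _ := GRing.isMonoidMorphism.Build (subalg gens) (subalg gens)
  fs subalg_lift_is_monoid.
HB.instance Definition _ := GRing.isScalable.Build F (subalg gens) (subalg gens)
  *:%R fs subalg_lift_is_scalable.

End SubalgebraLift.

(** The image in A of the equalizer of f and g is a subalgebra containing the generators. *)
Lemma subalg_morph_ext (F : fieldType) (A : algType F) (gens : A -> Prop)
    (B : algType F) (f g : {lrmorphism subalg gens -> B}) :
  (forall x (gx : gens x), f (subalg_of_gen gx) = g (subalg_of_gen gx)) -> f =1 g.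
Proof.
move=> fg x.
pose E : {pred A} := fun z => `[< exists2 y : subalg gens, val y = z & f y = g y >].
have EP z : reflect (exists2 y : subalg gens, val y = z & f y = g y) (z \in E).
  exact: asboolP.
suff /EP[y /val_inj-> //] : val x \in E.
have /subalg_predP/(_ E) := subalg_valP x; apply; last first.
  by move=> z gz; apply/EP; exists (subalg_of_gen gz).
split=> [|k y z /EP[y' <- fy] /EP[z' <- fz]|y z /EP[y' <- fy] /EP[z' <- fz]].
- by apply/EP; exists 1; rewrite ?rmorph1.
- apply/EP; exists (k *: y' + z'); first by [].
  by rewrite !linearP /= fy fz.
apply/EP; exists (y' * z'); first by [].
by rewrite !rmorphM /= fy fz.
Qed.

Lemma rtt_scale (L : nzRingType) N (a b c p q : L) (X Y : 'M[L]_N) :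
  central p -> central q -> rtt a b c X Y -> rtt a b c (p *: X) (q *: Y).
Proof.
move=> cp cq; rewrite /rtt.
have -> : first (p *: X) = p *: first X.
  by apply/matrixP => i j; rewrite !mxE mulrA.
have -> : second (q *: Y) = q *: second Y.
  by apply/matrixP => i j; rewrite !mxE mulrA mulrA; congr (_ * _); rewrite cq.
rewrite !(mulmxZc _ _ cp) !(mulmxZc _ _ cq) -!scalemxAl => ->.
by rewrite !scalerA cp.
Qed.

Lemma scale_sandwich (L : nzRingType) N (p q : L) (X G Z : 'M[L]_N) :
  central q -> (p *: X) *m G *m (q *: Z) = (p * q) *: (X *m G *m Z).
Proof. by move=> cq; rewrite mulmxZc // -!scalemxAl scalerA cq. Qed.

Section ScaledSeries.
Variables (F : numFieldType) (N : nat) (A : algType F) (T : nat -> 'M[A]_N).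
Variable f : ser F.
Local Notation c := (kappa F N / 2%:R).
Local Notation d := (dpar F N).
Local Notation x := (serX : ser F).

Definition scaleT (r : nat) : 'M[A]_N :=
  \matrix_(i, j) (ser_alg A f * ser_mx T i j : ser A) r.

Lemma ser_mx_scaleT : ser_mx scaleT = ser_alg A f *: ser_mx T.
Proof.
by apply/matrixP => i j; rewrite ser_mxE [RHS]mxE; apply/funext => r; rewrite mxE.
Qed.

Lemma scaleT_rtt : rtt_series T -> rtt_series scaleT.
Proof.
rewrite /rtt_series /ser_mx1 /ser_mx2 ser_mx_scaleT => h.
have -> : map_mx (@serC (ser A)) (ser_alg A f *: ser_mx T) =
    inx A (ser_alg A f) *: map_mx (@serC (ser A)) (ser_mx T).
  exact: (map_mxZ (inx A)).
have -> : map_mx (ser_map (@serC A)) (ser_alg A f *: ser_mx T) =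
    iny A (ser_alg A f) *: map_mx (ser_map (@serC A)) (ser_mx T).
  exact: (map_mxZ (iny A)).
apply: rtt_scale h; rewrite ?inx_alg ?iny_alg; exact: central_ser2_alg.
Qed.

Lemma scaleT0 : f 0%N = 1 -> T 0%N = 1%:M -> scaleT 0%N = 1%:M.
Proof.
move=> f0 T0; apply/matrixP => i j; rewrite mxE serM0 ser_mxE T0.
by rewrite /ser_alg /= /ser_map /= f0 scale1r mul1r.
Qed.

Variables (phi : {rmorphism A -> A}) (S : 'I_N -> 'I_N -> ser A).
Hypothesis phiA : forall k, phi k%:A = k%:A.
Hypothesis phiT : forall i j r, phi (T r i j) = scaleT r i j.
Hypothesis hS : forall i j,
  ser_alg A (1 - serC c * x) * ser_shift c (Sser T i j) =
  ser_alg A (1 - serC d * x) * S i j.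

(** The factor T^t(-w) contributes f(-w), whence f(w) f(-w) and not f(w)^2; the two agree for an
    even f. *)
Lemma Sser_scale i j : ser_map phi (Sser T i j) =
  ser_alg A (f * ser_neg f) * Sser T i j.
Proof.
have e : map_mx (ser_map phi) (Sser T) = ser_alg A (f * ser_neg f) *: Sser T.
  have ceA g := @central_ser_alg F A g.
  have eT : map_mx (ser_map phi) (ser_mx T) = ser_alg A f *: ser_mx T.
    rewrite -ser_mx_scaleT; apply/matrixP => k l; rewrite !mxE.
    by apply/funext => r; rewrite [LHS]phiT.
  have eG : map_mx (ser_map phi) (map_mx (ser_alg A) (gser F N)) =
      map_mx (ser_alg A) (gser F N).
    by rewrite -map_mx_comp; apply: eq_map_mx => g; apply: ser_map_alg.
  have eTn : map_mx (ser_map phi) (ttr (map_mx (@ser_neg A) (ser_mx T))) =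
      ser_alg A (ser_neg f) *: ttr (map_mx (@ser_neg A) (ser_mx T)).
    apply/matrixP => k l; rewrite [LHS]mxE [RHS]mxE.
    have := congr1 (fun M : 'M[ser A]_N => ser_neg (M (rev_ord l) (rev_ord k))) eT.
    rewrite /= [map_mx _ _ _ _]mxE [(_ *: _ : 'M_N) _ _]mxE.
    rewrite (rmorphM (@ser_neg A)) /= ser_alg_neg.
    by rewrite [ttr _ _ _]mxE [map_mx _ _ _ _]mxE ser_map_neg.
  apply: etrans (map_Sser T (ser_map phi)) _; rewrite eT eG eTn.
  by rewrite (rmorphM (ser_alg A)); apply: scale_sandwich.
have := congr1 (fun M : 'M[ser A]_N => M i j) e.
by rewrite /= [LHS]mxE [RHS]mxE.
Qed.

Lemma series_S_scale i j : ser_map phi (S i j) =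
  ser_alg A (shiftF c (f * ser_neg f)) * S i j.
Proof.
have reg g : ser_alg A (1 - serC d * x) * g = 0 -> g = 0.
  move=> /(congr1 (fun t => ser_alg A (geo d) * t)).
  by rewrite mulr0 mulrA -(rmorphM (ser_alg A)) mulrC geoE rmorph1 mul1r.
apply/eqP; rewrite -subr_eq0; apply/eqP/reg; rewrite mulrBr.
rewrite -(ser_map_scale phiA) -hS (ser_map_scale phiA) (ser_shift_morph phiA).
rewrite Sser_scale (rmorphM (@ser_shift F A c)) /= ser_shift_alg.
rewrite mulrA (central_ser_alg (1 - serC c * x)) -mulrA hS.
by rewrite !mulrA (central_ser_alg (1 - serC d * x)) subrr.
Qed.

End ScaledSeries.

Lemma map_mx_eq_entry (R S : Type) (f : R -> S) m n (M M' : 'M[R]_(m, n)) i j :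
  map_mx f M = map_mx f M' -> f (M i j) = f (M' i j).
Proof. by move=> /matrixP/(_ i j); rewrite !mxE. Qed.

Section YangianMorphisms.
Variables (F : numFieldType) (N : nat).

Lemma yangian_lift (A : algType F) (T' : nat -> 'M[A]_N) :
  T' 0%N = 1%:M -> (forall r s, rtt_lhs T' r s = rtt_rhs T' r s) ->
  exists phi : {lrmorphism yangian F N -> A},
    forall r i j, phi (yangian_T F N r i j) = T' r i j.
Proof.
move=> T0 rT'.
(* The successor is there because the generator (i, j, r) stands for t_ij^(r+1). *)
pose h (t : tgen N) : A := T' t.2.+1 t.1.1 t.1.2.
pose phi0 : {lrmorphism free_alg F (tgen N) -> A} := free_lift h.
have phi0T r : map_mx phi0 (free_T F N r) = T' r.
  case: r => [|r]; first by rewrite map_mx1 T0.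
  by apply/matrixP => i j; rewrite !mxE; apply: free_liftE.
have rel0 y : rtt_rels y -> phi0 y = 0.
  move=> [r [s [i [j ->]]]]; rewrite rmorphB /=.
  have fA k : phi0 k%:A = k%:A by apply: morph_scalar.
  have eL := map_rtt_lhs fA (free_T F N) r s.
  have eR := map_rtt_rhs fA (free_T F N) r s.
  have eT : (fun r => map_mx phi0 (free_T F N r)) = T' by apply/funext.
  rewrite eT in eL eR.
  apply/eqP; rewrite subr_eq0; apply/eqP.
  exact: (map_mx_eq_entry i j (etrans eL (etrans (rT' r s) (esym eR)))).
pose phi : {lrmorphism yangian F N -> A} := 
  quotient_lift (proper := @rtt_proper F N) rel0.
exists phi => r i j; rewrite -phi0T !mxE.
exact: quotient_lift_pi.
Qed.

End YangianMorphisms.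

Lemma Sser0 (F : numFieldType) N (A : algType F) (T : nat -> 'M[A]_N) i j :
  T 0%N = 1%:M -> Sser T i j 0%N = (gsign F i *+ (i == j))%:A.
Proof.
move=> T0; have ev0 (X Y : 'M[ser A]_N) :
    map_mx (@ser_ev A) (X *m Y) = map_mx (@ser_ev A) X *m map_mx (@ser_ev A) Y.
  exact: map_mxM.
have eT : map_mx (@ser_ev A) (ser_mx T) = 1%:M.
  by rewrite -T0; apply/matrixP => k l; rewrite !mxE.
have eTn : map_mx (@ser_ev A) (ttr (map_mx (@ser_neg A) (ser_mx T))) = 1%:M.
  apply/matrixP => k l; rewrite !mxE /ser_ev /ser_neg expr0 mul1r T0 mxE.
  by rewrite (inj_eq rev_ord_inj) eq_sym.
have eG : map_mx (@ser_ev A) (map_mx (ser_alg A) (gser F N)) =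
    \matrix_(i, j) (gsign F i *+ (i == j))%:A.
  apply/matrixP => k l; rewrite !mxE /ser_ev /ser_alg /= /ser_map /=; congr (_ *: _).
  rewrite serMnE serBE !serM0 serDE serM0 ser1E /serX !mulr0 addr0 subr0 mul1r.
  by rewrite /serC mulr1n.
have e : map_mx (@ser_ev A) (Sser T) = \matrix_(i, j) (gsign F i *+ (i == j))%:A.
  by rewrite /Sser 2!ev0 eT eTn eG mul1mx mulmx1.
by move/matrixP/(_ i j): e; rewrite [LHS]mxE [RHS]mxE.
Qed.

Section SubalgebraInclusion.
Variables (F : fieldType) (A : algType F) (gens : A -> Prop).

Definition subalg_inclusion (y : subalg gens) : A := subalg_val y.

Lemma subalg_inclusion_is_zmod : zmod_morphism subalg_inclusion.
Proof. by []. Qed.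
Lemma subalg_inclusion_is_monoid : monoid_morphism subalg_inclusion.
Proof. by []. Qed.
Lemma subalg_inclusion_is_scalable : scalable subalg_inclusion.
Proof. by []. Qed.

HB.instance Definition _ := GRing.isZmodMorphism.Build (subalg gens) A
  subalg_inclusion subalg_inclusion_is_zmod.
HB.instance Definition _ := GRing.isMonoidMorphism.Build (subalg gens) A
  subalg_inclusion subalg_inclusion_is_monoid.
HB.instance Definition _ := GRing.isScalable.Build F (subalg gens) A *:%R
  subalg_inclusion subalg_inclusion_is_scalable.

Lemma subalg_inclusion_inj : injective subalg_inclusion.
Proof. by move=> y z; apply: val_inj. Qed.

End SubalgebraInclusion.

Lemma shift_lead_eq (F : fieldType) (A : algType F) (a b c : F) (f g : ser A) :
  ser_alg A (1 - serC a * serX) * ser_shift c f =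
    ser_alg A (1 - serC b * serX) * g ->
  f 0%N = g 0%N.
Proof.
move=> /(congr1 (fun f : ser A => f 0%N)); rewrite /= 2!serM0.
rewrite ser_shiftE big_ord0 addr0.
have at0 k : ser_alg A (1 - serC k * serX) 0%N = 1.
  rewrite /ser_alg /= /ser_map /= serBE serCM /serX mulr0 subr0.
  exact: scale1r.
by rewrite !at0 !mul1r.
Qed.

Section TwistedInclusion.
Variables (F : numFieldType) (N : nat).
Hypothesis N2 : (2 <= N)%N.
Local Notation A := (yangian F N).
Local Notation Y := (twisted_yangian F N).
Local Notation T := (yangian_T F N).
Local Notation c := (kappa F N / 2%:R).

Lemma yangian_T0 : T 0%N = 1%:M.
Proof. by rewrite /yangian_T map_mx1. Qed.

(** This makes the constant chosen for [twisted_s] at index 0 agree with the constant term of S(u)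
    in the Yangian. *)
Lemma yangian_S0 i j : yangian_S F N 0%N i j = (Gmx F N i j)%:A.
Proof.
have h := shift_lead_eq (yangian_S_shift F N2 i j).
apply: etrans (esym h) _; rewrite (Gmx_gsign F N2).
exact: Sser0 yangian_T0.
Qed.

Definition twisted_val : {lrmorphism Y -> A} :=
  @subalg_inclusion F A (@twisted_gens F N).

Lemma twisted_val_s i j r : twisted_val (twisted_s F i j r) = yangian_S F N r i j.
Proof.
case: r => [|r]; last exact: erefl.
exact: etrans (morph_scalar twisted_val _) (esym (yangian_S0 i j)).
Qed.

Lemma twisted_val_series i j :
  ser_map twisted_val (twisted_s F i j) = (fun r => yangian_S F N r i j).
Proof. by apply/funext => r; apply: twisted_val_s. Qed.

End TwistedInclusion.

Lemma fps_scaleE (F : fieldType) (A : algType F) (a : ser F) (f : ser A) :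
  fps_scale a f = ser_alg A a * f.
Proof.
apply/funext => n; rewrite serME; apply: eq_bigr => k _.
by rewrite -mulr_algl.
Qed.

Lemma morph_fps_scale (F : fieldType) (A B : algType F) (v : {lrmorphism A -> B})
    (a : ser F) (f : ser A) r :
  v (fps_scale a f r) = (ser_alg B a * ser_map v f) r.
Proof.
by rewrite fps_scaleE -(ser_map_scale (morph_scalar v)).
Qed.

(** The scalar by which an element acts on the spanning vector is chosen classically; it is unique
    because v is nonzero, and uniqueness yields the morphism laws. *)
Lemma one_dim_character (F : fieldType) (A : algType F) (V : representation A) :
  one_dimensional V ->
  exists chi : {rmorphism A -> F}, (forall k, chi k%:A = k) /\
    forall y w, rep_act (r := V) y w = chi y *: w.
Proof.
move=> [v [v0 vV]].
have [chi chiE] : exists chi : A -> F, forall y, rep_act (r := V) y v = chi y *: v.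
  exists (fun y => projT1 (cid (vV (rep_act y v)))) => y.
  by case: (cid _).
have inj k l : k *: v = l *: v -> k = l.
  move/eqP; rewrite -subr_eq0 -scalerBl scaler_eq0 (negbTE v0) orbF subr_eq0.
  by move/eqP.
have act0 x : rep_act (r := V) x 0 = 0.
  have := rep_linearr x 1 (0 : rep_space V) 0; rewrite !scale1r addr0 => e.
  by apply: (addrI (rep_act x 0)); rewrite -e addr0.
have actZ x k w : rep_act (r := V) x (k *: w) = k *: rep_act x w.
  by have := rep_linearr x k w 0; rewrite !addr0 act0 addr0.
have chiB : zmod_morphism chi.
  move=> x y; apply: inj; rewrite -chiE addrC -scaleN1r rep_linearl !chiE.
  by rewrite scaleN1r scalerBl addrC.
have chiM : monoid_morphism chi.
  split=> [|x y]; apply: inj; rewrite -chiE; first by rewrite rep_act1 scale1r.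
  by rewrite rep_actM chiE actZ chiE scalerA mulrC.
pose chi' : {rmorphism A -> F} := HB.pack chi
  (GRing.isZmodMorphism.Build A F chi chiB) (GRing.isMonoidMorphism.Build A F chi chiM).
have chi'E y w : rep_act (r := V) y w = chi' y *: w.
  by have [k ->] := vV w; rewrite actZ chiE scalerA mulrC -scalerA.
exists chi'; split=> // k; apply: inj; rewrite -chi'E.
have := rep_linearl (r := V) v k 1 0; rewrite addr0 rep_act1 => ->.
have -> : rep_act (r := V) 0 v = 0 by rewrite chi'E rmorph0 scale0r.
by rewrite addr0.
Qed.

Section TwistedEndomorphisms.
Variables (F : numFieldType) (N : nat).
Hypothesis N2 : (2 <= N)%N.
Local Notation A := (yangian F N).
Local Notation Y := (twisted_yangian F N).
Local Notation T := (yangian_T F N).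
Local Notation c := (kappa F N / 2%:R).

Lemma twisted_endomorphism (g : ser F) : g 0%N = 1 -> ser_neg g = g ->
  exists nu : {lrmorphism Y -> Y}, forall i j,
    ser_map nu (twisted_s F i j) = ser_alg Y (shiftF c g) * twisted_s F i j.
Proof.
move=> g0 gN; have [f [f0 fN ff]] := ser_sqrt_even g0 gN.
have rT : forall r s, rtt_lhs (scaleT T f) r s = rtt_rhs (scaleT T f) r s.
  exact/rtt_seriesP/scaleT_rtt/yangian_rtt_series.
have [phi phiT] := yangian_lift (scaleT0 f0 (yangian_T0 F N)) rT.
have phiS := series_S_scale (morph_scalar phi) (fun i j r => phiT r i j)
  (yangian_S_shift F N2).
have phis i j r : phi (yangian_S F N r i j) =
    twisted_val F N (fps_scale (shiftF c g) (twisted_s F i j) r).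
  have := congr1 (fun h : ser A => h r) (phiS i j); rewrite /= fN ff.
  rewrite /ser_map => ->; rewrite morph_fps_scale.
  by rewrite (twisted_val_series F N2).
(* Each coefficient of s_ij(u) is sent to a combination of coefficients of the same s_ij(u), so the
   endomorphism of the Yangian restricts to the subalgebra. *)
have gen x : twisted_gens x -> phi x \in subalg_pred (@twisted_gens F N).
  by move=> [r [i [j ->]]]; rewrite phis; apply: subalg_valP.
pose nu : {lrmorphism Y -> Y} := subalg_lift gen.
exists nu => i j; apply/funext => r; rewrite -fps_scaleE.
apply: subalg_inclusion_inj; apply: etrans (esym (esym (phis i j r))).
by rewrite -(twisted_val_s F N2).
Qed.

End TwistedEndomorphisms.

(** * Classification of one-dimensional representations *)

Section Classification.
Variables (F : numFieldType) (N : nat).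
Hypothesis N5 : (5 <= N)%N.
Local Notation A := (yangian F N).
Local Notation Y := (twisted_yangian F N).
Local Notation c := (kappa F N / 2%:R).
Let N2 : (2 <= N)%N. Proof. by apply: leq_trans N5. Qed.

Lemma twisted_morph_ext (B : algType F) (f g : {lrmorphism Y -> B}) :
  (forall i j, ser_map f (twisted_s F i j) = ser_map g (twisted_s F i j)) ->
  f =1 g.
Proof.
move=> fg; apply: subalg_morph_ext => x gx.
have [r [i [j ex]]] := gx.
have -> : subalg_of_gen gx = twisted_s F i j r.+1 by apply: val_inj.
exact: (congr1 (fun h : ser B => h r.+1) (fg i j)).
Qed.

Lemma twisted_endomorphism_cancel (g h : ser F) (nu mu : {lrmorphism Y -> Y}) :
  g * h = 1 ->
  (forall i j, ser_map nu (twisted_s F i j) =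
    ser_alg Y (shiftF c g) * twisted_s F i j) ->
  (forall i j, ser_map mu (twisted_s F i j) =
    ser_alg Y (shiftF c h) * twisted_s F i j) ->
  cancel mu nu.
Proof.
move=> gh nuE muE; apply: (@twisted_morph_ext Y (nu \o mu) idfun) => i j.
transitivity (ser_map nu (ser_map mu (twisted_s F i j))); first by [].
rewrite muE (ser_map_scale (morph_scalar nu)) nuE mulrA -(rmorphM (ser_alg Y)).
rewrite -(rmorphM (shiftF c)) (mulrC h g) gh (rmorph1 (shiftF c)).
by rewrite (rmorph1 (ser_alg Y)) mul1r.
Qed.

Lemma twisted_character (chi : {rmorphism Y -> F}) :
  (forall k, chi k%:A = k) ->
  exists (a : F) (g : ser F), even_unital g /\
    forall i j, ser_map chi (twisted_s F i j) =
      shiftF c g * (fun r => Kser N a r i j).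
Proof.
move=> chiA.
apply: (character_solution N5 (morph_scalar (twisted_val F N)) _ chiA
  (yangian_rtt_series F N)).
- exact: subalg_inclusion_inj.
- by move=> i j; rewrite (twisted_val_series F N2); apply: yangian_S_shift.
by move=> i j; rewrite chiA Gmx_gsign.
Qed.

End Classification.

Lemma one_dimensional_iso (F : fieldType) (A : algType F) (V W : representation A) :
  rep_iso V W -> one_dimensional W -> one_dimensional V.
Proof.
move=> [phi [[psi phiK psiK] _]] [w [w0 wW]]; exists (psi w); split.
  by apply: contraNneq w0 => e; rewrite -(psiK w) e linear0.
move=> v; have [k e] := wW (phi v); exists k.
by rewrite -(phiK v) e -{1}(psiK w) -linearZ_LR phiK.
Qed.

(** g(x) h(-x) = (g h)(-x) = 1, so h(-x) is the inverse of g as well. *)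
Lemma even_inverse (F : fieldType) (g : ser F) :
  g 0%N = 1 -> ser_neg g = g ->
  exists h : ser F, [/\ h 0%N = 1, ser_neg h = h & g * h = 1].
Proof.
move=> g0 gN; have gn0 : g 0%N != 0 by rewrite g0 oner_neq0.
have [h gh] := ser_inverse gn0; exists h; split=> //.
  by have := congr1 (fun f : ser F => f 0%N) gh; rewrite /= serM0 g0 mul1r.
apply/eqP; rewrite -subr_eq0; apply/eqP/(ser_field_lreg gn0).
by rewrite mulrBr gh -{1}gN -(rmorphM (@ser_neg F)) gh rmorph1 subrr.
Qed.

Section OneDimensional.
Variables (F : numFieldType) (N : nat).
Hypothesis N5 : (5 <= N)%N.
Local Notation Y := (twisted_yangian F N).
Local Notation c := (kappa F N / 2%:R).

Lemma is_nu_scale (g h : ser F) (nu mu : {lrmorphism Y -> Y}) :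
  g * h = 1 ->
  (forall i j, ser_map nu (twisted_s F i j) =
    ser_alg Y (shiftF c g) * twisted_s F i j) ->
  (forall i j, ser_map mu (twisted_s F i j) =
    ser_alg Y (shiftF c h) * twisted_s F i j) ->
  is_nu g nu.
Proof.
move=> gh nuE muE; have hg : h * g = 1 by rewrite mulrC.
split=> [|i j r].
  exact: Bijective (twisted_endomorphism_cancel hg muE nuE)
    (twisted_endomorphism_cancel gh nuE muE).
have := congr1 (fun f : ser Y => f r) (nuE i j).
by rewrite /= /ser_map => ->; rewrite -fps_scaleE.
Qed.

Theorem one_dimensional_classification (V : representation Y) :
  one_dimensional V ->
  exists (a : F) (g : nat -> F), even_unital g /\
    exists (Va : representation Y) (nu : {lrmorphism Y -> Y}),
      [/\ is_V a Va, is_nu g nu & rep_iso V (rep_twist Va nu)].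
Proof.
move=> V1; have [chi [chiA chiV]] := one_dim_character V1.
have [a [g [geven gK]]] := twisted_character N5 chiA.
have N2 : (2 <= N)%N by apply: leq_trans N5.
have [g0 gN] := (even_unitalP g).1 geven.
have [h [h0 hN gh]] := even_inverse g0 gN.
have [nu nuE] := twisted_endomorphism N2 g0 gN.
have [mu muE] := twisted_endomorphism N2 h0 hN.
have hg : h * g = 1 by rewrite mulrC.
exists a, g; split=> //; exists (rep_twist V mu), nu; split.
- split=> // i j r w.
  have e : ser_map chi (ser_map mu (twisted_s F i j)) = (fun s => Kser N a s i j).
    rewrite muE (ser_map_scal_scale chiA) gK mulrA -(rmorphM (shiftF c)) hg.
    by rewrite (rmorph1 (shiftF c)) mul1r.
  apply: etrans (chiV (mu (twisted_s F i j r)) w) _.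
  by have := congr1 (fun f : ser F => f r *: w) e.
- exact: is_nu_scale gh nuE muE.
(* On the double twist x acts as mu (nu x) = x on V, so the isomorphism is the identity map. *)
exists idfun; split; first by exists idfun.
move=> x v; rewrite /= /twist_act.
by rewrite (twisted_endomorphism_cancel hg muE nuE).
Qed.

End OneDimensional.

Unset Implicit Arguments.
Set Strict Implicit.

Theorem proposition5p6 (R : realType) (N : nat) (hN : (5 <= N)%N)
    (V : representation (twisted_yangian R[i] N)) :
  one_dimensional V <->
  exists (a : R[i]) (g : nat -> R[i]),
    even_unital g /\
    exists (Va : representation (twisted_yangian R[i] N))
           (nu : {lrmorphism twisted_yangian R[i] N -> twisted_yangian R[i] N}),
      [/\ is_V a Va, is_nu g nu & rep_iso V (rep_twist Va nu)].
Proof.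
split; first exact: one_dimensional_classification.
(* A twist keeps the underlying space, so the one-dimensionality of V(a) passes to its twist and
   then across the isomorphism. *)
move=> [a [g [_ [Va [nu [[Va1 _] _ hiso]]]]]].
exact: one_dimensional_iso hiso Va1.
Qed.
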